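(* Let $G=(V,E)$ be a directed graph with $n=|V|$ vertices, $m=|E|$ edges and real edge weights in $[1,W]$, and let $k\ge 1$ be an integer. Then there exists a $(2k-1)$-roundtrip spanner of $G$ with $O(k\,n^{1+1/k}\log(nW))$ edges, and such a spanner can be constructed in $\tilde{O}(kmn\log W)$ time.
   Context: For vertices $u,v$, $d(u\to v)$ denotes the length of a shortest directed path from $u$ to $v$, and the roundtrip distance is $d(u\leftrightarrows v)=d(u\to v)+d(v\to u)$. A subgraph $H=(V,E')$ with $E'\subseteq E$ is a $t$-roundtrip spanner of $G$ if for all $u,v\in V$, the roundtrip distance between $u$ and $v$ in $H$ is at most $t\cdot d(u\leftrightarrows v)$. The notation $\tilde{O}(\cdot)$ hides polylogarithmic factors in $n$.
   Formalization: The time bound is read as O(1 + kmn(1 + log W)(1 + log n)^b) for a fixed b, on a real RAM, because the literal kmn log W is zero for W = 1 (unweighted graphs) or m = 0, where any algorithm still takes at least one step. *)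

(* Defs.v *)
From HB Require Import structures.
From mathcomp Require Import all_boot all_order all_algebra.
From mathcomp Require Import all_classical all_reals all_analysis.

Set Implicit Arguments.
Unset Strict Implicit.
Unset Printing Implicit Defensive.

Import Order.TTheory GRing.Theory Num.Theory.
Local Open Scope ring_scope.

Section Roundtrip.
Context {R : realType} {n : nat}.
Implicit Types (E H : {set 'I_n * 'I_n}) (w : 'I_n * 'I_n -> R) (u v : 'I_n).

Definition path_length w u (p : seq 'I_n) : R :=
  \sum_(e <- zip (belast u p) p) w e.

(* [p] lists the vertices after [u]; the empty [p] is the path from [u] to [u]. *)
Definition dipaths E u v : set (seq 'I_n) :=
  [set p | path (fun x y => (x, y) \in E) u p /\ last u p = v]%classic.

(* [+oo] when [v] is not reachable from [u]. *)
Definition dist E w u v : \bar R :=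
  ereal_inf [set (path_length w u p)%:E | p in dipaths E u v]%classic.

Definition roundtrip_dist E w u v : \bar R :=
  (dist E w u v + dist E w v u)%E.

Definition roundtrip_spanner (t : R) E w H : Prop :=
  H \subset E /\
  forall u v, (roundtrip_dist H w u v <= t%:E * roundtrip_dist E w u v)%E.

End Roundtrip.

(* A real RAM, given as a structured language: it has word variables and word
   arrays, real variables and real arrays, all named by natural numbers (a
   program mentions finitely many names), and arrays are indexed by words.
   Word operations are modulo the number [B] of words, except that subtraction
   is truncated at 0. Reals have exact arithmetic and comparison, and words can
   be cast to reals; there is no rounding from reals to words. *)
Inductive wexp : Type :=
| WConst of nat
| WVar of nat
| WGet of nat & wexp
| WAdd of wexp & wexp
| WSub of wexp & wexp
| WMul of wexp & wexp
| WDiv of wexp & wexp.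

Inductive rexp : Type :=
| RVar of nat
| RGet of nat & wexp
| RCast of wexp
| RAdd of rexp & rexp
| RSub of rexp & rexp
| RMul of rexp & rexp
| RDiv of rexp & rexp.

Inductive bexp : Type :=
| BLeW of wexp & wexp
| BLeR of rexp & rexp
| BNot of bexp
| BAnd of bexp & bexp.

Inductive cmd : Type :=
| Skip
| WSet of nat & wexp
| WPut of nat & wexp & wexp
| RSet of nat & rexp
| RPut of nat & wexp & rexp
| Seq of cmd & cmd
| If of bexp & cmd & cmd
| While of bexp & cmd.

(* Every operation and every memory access costs one unit. *)
Fixpoint wcost (e : wexp) : nat :=
  match e with
  | WConst _ | WVar _ => 1
  | WGet _ e1 => (wcost e1).+1
  | WAdd e1 e2 | WSub e1 e2 | WMul e1 e2 | WDiv e1 e2 =>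
      (wcost e1 + wcost e2).+1
  end.

Fixpoint rcost (e : rexp) : nat :=
  match e with
  | RVar _ => 1
  | RGet _ e1 | RCast e1 => (wcost e1).+1
  | RAdd e1 e2 | RSub e1 e2 | RMul e1 e2 | RDiv e1 e2 =>
      (rcost e1 + rcost e2).+1
  end.

Fixpoint bcost (b : bexp) : nat :=
  match b with
  | BLeW e1 e2 => (wcost e1 + wcost e2).+1
  | BLeR e1 e2 => (rcost e1 + rcost e2).+1
  | BNot b1 => (bcost b1).+1
  | BAnd b1 b2 => (bcost b1 + bcost b2).+1
  end.

Record state (R : Type) : Type := State {
  wvar : nat -> nat;
  warr : nat -> nat -> nat;
  rvar : nat -> R;
  rarr : nat -> nat -> R
}.

Definition upd (T : Type) (f : nat -> T) (i : nat) (x : T) : nat -> T :=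
  fun j => if j == i then x else f j.

Section Semantics.
Context {R : realType}.
Variable B : nat.
Implicit Type s : state R.

Fixpoint weval s (e : wexp) : nat :=
  match e with
  | WConst c => c %% B
  | WVar x => wvar s x
  | WGet a e1 => warr s a (weval s e1)
  | WAdd e1 e2 => (weval s e1 + weval s e2) %% B
  | WSub e1 e2 => weval s e1 - weval s e2
  | WMul e1 e2 => (weval s e1 * weval s e2) %% B
  | WDiv e1 e2 => weval s e1 %/ weval s e2
  end%N.

Fixpoint reval s (e : rexp) : R :=
  match e with
  | RVar x => rvar s x
  | RGet a e1 => rarr s a (weval s e1)
  | RCast e1 => (weval s e1)%:R
  | RAdd e1 e2 => reval s e1 + reval s e2
  | RSub e1 e2 => reval s e1 - reval s e2
  | RMul e1 e2 => reval s e1 * reval s e2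
  | RDiv e1 e2 => reval s e1 / reval s e2
  end.

Fixpoint beval s (b : bexp) : bool :=
  match b with
  | BLeW e1 e2 => (weval s e1 <= weval s e2)%N
  | BLeR e1 e2 => reval s e1 <= reval s e2
  | BNot b1 => ~~ beval s b1
  | BAnd b1 b2 => beval s b1 && beval s b2
  end.

Definition set_wvar s x v :=
  State (upd (wvar s) x v) (warr s) (rvar s) (rarr s).
Definition set_warr s a i v :=
  State (wvar s) (upd (warr s) a (upd (warr s a) i v)) (rvar s) (rarr s).
Definition set_rvar s x v :=
  State (wvar s) (warr s) (upd (rvar s) x v) (rarr s).
Definition set_rarr s a i v :=
  State (wvar s) (warr s) (rvar s) (upd (rarr s) a (upd (rarr s a) i v)).

(* [exec c s t s']: [c] started in [s] halts in [s'] after exactly [t] steps. *)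
Inductive exec : cmd -> state R -> nat -> state R -> Prop :=
| ExSkip s : exec Skip s 1 s
| ExWSet s x e :
    exec (WSet x e) s (wcost e).+1 (set_wvar s x (weval s e))
| ExWPut s a i e :
    exec (WPut a i e) s (wcost i + wcost e).+1
      (set_warr s a (weval s i) (weval s e))
| ExRSet s x e :
    exec (RSet x e) s (rcost e).+1 (set_rvar s x (reval s e))
| ExRPut s a i e :
    exec (RPut a i e) s (wcost i + rcost e).+1
      (set_rarr s a (weval s i) (reval s e))
| ExSeq s1 s2 s3 c1 c2 t1 t2 :
    exec c1 s1 t1 s2 -> exec c2 s2 t2 s3 ->
    exec (Seq c1 c2) s1 (t1 + t2) s3
| ExIfTrue s s' b c1 c2 t :
    beval s b -> exec c1 s t s' ->
    exec (If b c1 c2) s (bcost b + t).+1 s'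
| ExIfFalse s s' b c1 c2 t :
    ~~ beval s b -> exec c2 s t s' ->
    exec (If b c1 c2) s (bcost b + t).+1 s'
| ExWhileFalse s b c :
    ~~ beval s b -> exec (While b c) s (bcost b).+1 s
| ExWhileTrue s1 s2 s3 b c t1 t2 :
    beval s1 b -> exec c s1 t1 s2 -> exec (While b c) s2 t2 s3 ->
    exec (While b c) s1 (bcost b + t1 + t2).+1 s3.

End Semantics.

(* Words of [a * ceil(log2 (n + m + k + 2))] bits. *)
Definition num_words (a n m k : nat) : nat :=
  (2 ^ (a * up_log 2 (n + m + k + 2)))%N.

Section InputOutput.
Context {R : realType} {n : nat}.
Variable es : seq ('I_n * 'I_n).

(* The graph is given as an unsorted edge list: word variables 0, 1, 2 hold
   [n], [m], [k]; entry [i] of word arrays 0 and 1 and of real array 0 is the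
   tail, the head and the weight of the [i]-th edge; all the rest is 0. *)
Definition input (w : 'I_n * 'I_n -> R) (k : nat) : state R :=
  State
    (fun x => nth 0%N [:: n; size es; k] x)
    (fun a i =>
       nth 0%N
         (nth [::] [:: [seq val e.1 | e <- es]; [seq val e.2 | e <- es]] a) i)
    (fun _ => 0)
    (fun a i => nth 0 (nth [::] [:: [seq w e | e <- es]] a) i).

(* The [i]-th edge is selected iff entry [i] of word array 2 is nonzero. *)
Definition output (s : state R) : {set 'I_n * 'I_n} :=
  [set e in es | warr s 2%N (index e es) != 0%N].

End InputOutput.

(* Main.v *)
Require Import Defs.
From HB Require Import structures.
From mathcomp Require Import all_boot all_order all_algebra.
From mathcomp Require Import all_classical all_reals all_analysis.
From mathcomp Require Import zify ring lra.

Set Implicit Arguments.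
Unset Strict Implicit.
Unset Printing Implicit Defensive.

Import Order.TTheory GRing.Theory Num.Theory.
Local Open Scope ring_scope.

(** Write d for roundtrip distance, and let [t] be the least integer with [t >= 2] and [t ^ k >= n],
    so that t <= 2 n^(1/k). For a vertex x let rho(x) be the roundtrip radius at which ceil(n/t)
    nearest vertices of x have been collected; if fewer vertices are in reach, rho(x) gets a value
    that acts as infinity. A pair x, y at distance d is served in one of two ways.

    If rho(x) <= (k-1) d, a hitting set serves it. Every collected near set has at least n/t
    elements, so the greedy choice of a vertex lying in most of the sets not yet hit shrinks their
    number by the factor 1 - 1/t and ends after O(t log n) picks ([hit_loop_run], [hits_bound]).
    Each pick h adds shortest-path trees from h and to h, at most 2n edges. The detour over a pick h
    near x costs at most 2 rho(x) + d <= (2k-1) d; this is [far_good].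

    The other pairs are served by ball growing, separately for each scale [lo, hi) with hi = lo (1 +
    1/(2k)). The centre c is the remaining vertex of largest rho, and the step is st = min(hi,
    rho(c)/(k-1)). The roundtrip ball of c in the graph induced by the remaining vertices is
    enlarged by st as long as this multiplies its size by more than t. Since (k-1) st <= rho(c), the
    open ball of radius (k-1) st has fewer than n/t <= t^(k-1) vertices, so the final inner radius r
    is at most (k-2) st. Tree edges of the ball of radius r + st are kept and the inner ball of
    radius r is removed: at most 2t edges per removed vertex, hence 2tn per scale
    ([scale_step_run]). If d < st and the closed walk through x and y meets a removed vertex, then x
    and y lie in the outer ball, and the detour over c costs 2 (r + d) <= (2k-1) d by
    [stretch_bound]. If d >= st, then st = rho(c)/(k-1), so rho(x) <= rho(c) <= (k-1) d and the
    hitting set serves the pair. There are O(k log(nW)) scales ([scales_bound]), which gives the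
    size ([size_bound]).

    For the time, each search is one Dijkstra run, with a tournament tree as queue, on the graph
    together with its reversed copy. In each of the first two phases and at each scale the runs
    number at most the vertices that touch an edge, which are at most min(n, 2m); so these runs cost
    O(nm log n) ([core_time_bound]). The outcome of Dijkstra enters the later arguments only as a
    certificate [cert]: the keys form a feasible potential, which bounds all walks from below, and
    the parent edges realise the keys. [core_run] joins the phases, and [spanner_of_paths] passes
    from walks to the infima that define distances. *)

(** * A program logic for total correctness with exact step counts *)

Section Logic.
Context {R : realType}.
Variable B : nat.
Implicit Types (s : state R) (c : cmd) (Q : state R -> nat -> Prop).

(** The postcondition also sees the step count, so time bounds are proved together with the
    results. *)
Definition run c s Q := exists s' t, exec B c s t s' /\ Q s' t.

Lemma run_weaken c s Q Q' :
  run c s Q -> (forall s' t, Q s' t -> Q' s' t) -> run c s Q'.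
Proof. by move=> [s' [t [e q]]] h; exists s', t; split=> //; apply: h. Qed.

Fixpoint wmod c : seq nat :=
  match c with
  | WSet x _ => [:: x]
  | Seq a b | If _ a b => wmod a ++ wmod b
  | While _ a => wmod a
  | _ => [::]
  end.

Fixpoint amod c : seq nat :=
  match c with
  | WPut a _ _ => [:: a]
  | Seq a b | If _ a b => amod a ++ amod b
  | While _ a => amod a
  | _ => [::]
  end.

Fixpoint rmod c : seq nat :=
  match c with
  | RSet x _ => [:: x]
  | Seq a b | If _ a b => rmod a ++ rmod b
  | While _ a => rmod a
  | _ => [::]
  end.

Fixpoint ramod c : seq nat :=
  match c with
  | RPut a _ _ => [:: a]
  | Seq a b | If _ a b => ramod a ++ ramod b
  | While _ a => ramod a
  | _ => [::]
  end.

(** A frame condition read off the syntax: what a command never assigns is unchanged. It spares the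
    loop invariants from listing everything that stays fixed. *)
Definition keep c s s' :=
  [/\ forall x, x \notin wmod c -> wvar s' x = wvar s x,
      forall a, a \notin amod c -> warr s' a = warr s a,
      forall x, x \notin rmod c -> rvar s' x = rvar s x
    & forall a, a \notin ramod c -> rarr s' a = rarr s a].

Lemma keep_refl c s : keep c s s.
Proof. by []. Qed.

Lemma keep_trans c s1 s2 s3 : keep c s1 s2 -> keep c s2 s3 -> keep c s1 s3.
Proof.
move=> [a1 a2 a3 a4] [b1 b2 b3 b4].
split=> x hx; first by rewrite b1 ?a1.
- by rewrite b2 ?a2.
- by rewrite b3 ?a3.
- by rewrite b4 ?a4.
Qed.

Lemma keepL c1 c2 c s s' :
  wmod c = wmod c1 ++ wmod c2 -> amod c = amod c1 ++ amod c2 ->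
  rmod c = rmod c1 ++ rmod c2 -> ramod c = ramod c1 ++ ramod c2 ->
  keep c1 s s' \/ keep c2 s s' -> keep c s s'.
Proof.
move=> e1 e2 e3 e4.
by case=> -[a1 a2 a3 a4]; split=> x; rewrite ?(e1, e2, e3, e4) mem_cat negb_or => /andP[h h'];
  rewrite ?a1 ?a2 ?a3 ?a4.
Qed.

Lemma exec_keep c s t s' : exec B c s t s' -> keep c s s'.
Proof.
elim=> {c s t s'} //.
- by move=> s x e; split=> //= y; rewrite inE /upd => /negbTE ->.
- by move=> s x i e; split=> //= y; rewrite inE /upd => /negbTE ->.
- by move=> s x e; split=> //= y; rewrite inE /upd => /negbTE ->.
- by move=> s x i e; split=> //= y; rewrite inE /upd => /negbTE ->.
- move=> s1 s2 s3 c1 c2 t1 t2 _ k1 _ k2.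
  by apply: (@keep_trans _ _ s2); apply: (@keepL c1 c2) => //; [left|right].
- by move=> s s' b c1 c2 t _ _ k1; apply: (@keepL c1 c2) => //; left.
- by move=> s s' b c1 c2 t _ _ k1; apply: (@keepL c1 c2) => //; right.
- by move=> s1 s2 s3 b c t1 t2 _ _ k1 _ k2; apply: (keep_trans k1 k2).
Qed.

Lemma run_keep c s Q :
  run c s Q -> run c s (fun s' t => Q s' t /\ keep c s s').
Proof.
by move=> [s' [t [e q]]]; exists s', t; split=> //; split=> //; apply: exec_keep e.
Qed.

Lemma run_seq c1 c2 s Q1 Q :
  run c1 s Q1 ->
  (forall s1 t1, keep c1 s s1 -> Q1 s1 t1 ->
     run c2 s1 (fun s2 t2 => Q s2 (t1 + t2)%N)) ->
  run (Seq c1 c2) s Q.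
Proof.
move=> /run_keep[s1 [t1 [e1 [q1 k1]]]] h.
have [s2 [t2 [e2 q2]]] := h _ _ k1 q1.
by exists s2, (t1 + t2)%N; split=> //; apply: ExSeq e1 e2.
Qed.

Lemma run_if b c1 c2 s Q :
  (beval B s b -> run c1 s (fun s' t => Q s' (bcost b + t).+1)) ->
  (~~ beval B s b -> run c2 s (fun s' t => Q s' (bcost b + t).+1)) ->
  run (If b c1 c2) s Q.
Proof.
move=> h1 h2; case: (boolP (beval B s b)) => hb.
  have [s' [t [e q]]] := h1 hb; exists s', (bcost b + t).+1.
  by split=> //; apply: ExIfTrue.
have [s' [t [e q]]] := h2 hb; exists s', (bcost b + t).+1.
by split=> //; apply: ExIfFalse.
Qed.

(** On loop-free code this reduces by computation to a statement about the explicit final state; a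
    loop falls back on [run] and is treated with [run_while]. *)
Fixpoint wp c s Q {struct c} : Prop :=
  match c with
  | Skip => Q s 1%N
  | WSet x e => Q (set_wvar s x (weval B s e)) (wcost e).+1
  | WPut a i e =>
      Q (set_warr s a (weval B s i) (weval B s e)) (wcost i + wcost e).+1
  | RSet x e => Q (set_rvar s x (reval B s e)) (rcost e).+1
  | RPut a i e =>
      Q (set_rarr s a (weval B s i) (reval B s e)) (wcost i + rcost e).+1
  | Seq c1 c2 => wp c1 s (fun s1 t1 => wp c2 s1 (fun s2 t2 => Q s2 (t1 + t2)%N))
  | If b c1 c2 =>
      (beval B s b -> wp c1 s (fun s' t => Q s' (bcost b + t).+1)) /\
      (~~ beval B s b -> wp c2 s (fun s' t => Q s' (bcost b + t).+1))
  | While _ _ => run c s Q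
  end.

Lemma wp_run c s Q : wp c s Q -> run c s Q.
Proof.
elim: c s Q => //=.
- by move=> s Q h; exists s, 1%N; split=> //; constructor.
- by move=> x e s Q h; exists (set_wvar s x (weval B s e)), (wcost e).+1; split=> //; constructor.
- move=> a i e s Q h; exists (set_warr s a (weval B s i) (weval B s e)), (wcost i + wcost e).+1.
  by split=> //; constructor.
- by move=> x e s Q h; exists (set_rvar s x (reval B s e)), (rcost e).+1; split=> //; constructor.
- move=> a i e s Q h; exists (set_rarr s a (weval B s i) (reval B s e)), (wcost i + rcost e).+1.
  by split=> //; constructor.
- move=> c1 IH1 c2 IH2 s Q /IH1 h; apply: (run_seq h) => s1 t1 _; exact: IH2.
- by move=> b c1 IH1 c2 IH2 s Q [h1 h2]; apply: run_if => [/h1/IH1|/h2/IH2].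
Qed.

(* [I mu s T]: [mu] is the termination measure and [T] the time spent so far. *)
Lemma run_while b c s0 (I : nat -> state R -> nat -> Prop) mu0 Q :
  I mu0 s0 0%N ->
  (forall mu s T, keep c s0 s -> I mu s T -> beval B s b ->
     run c s (fun s' t =>
       exists2 mu', (mu' < mu)%N & I mu' s' (T + t + (bcost b).+1)%N)) ->
  (forall mu s T, keep c s0 s -> I mu s T -> ~~ beval B s b ->
     Q s (T + (bcost b).+1)%N) ->
  run (While b c) s0 Q.
Proof.
move=> hI hstep hend.
suff H mu : forall s T, keep c s0 s -> I mu s T ->
    run (While b c) s (fun s' t => Q s' (T + t)%N).
  exact: (H _ _ _ (@keep_refl c s0) hI).
have [N] := ubnP mu; elim: N mu => // N IH mu muN s T ks Is.
case: (boolP (beval B s b)) => hb; last first.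
  by exists s, (bcost b).+1; split; [exact: ExWhileFalse|exact: hend ks Is hb].
have /run_keep[s1 [t1 [e1 [[mu' lmu I1] k1]]]] := hstep _ _ _ ks Is hb.
have [|s2 [t2 [e2 q2]]] := IH mu' _ s1 _ (keep_trans ks k1) I1; first by lia.
exists s2, (bcost b + t1 + t2).+1; split; first exact: ExWhileTrue e1 e2.
by have -> : (T + (bcost b + t1 + t2).+1 = T + t1 + (bcost b).+1 + t2)%N by lia.
Qed.

Definition Lt e1 e2 := BNot (BLeW e2 e1).

Definition For x be body :=
  Seq (WSet x (WConst 0))
    (While (Lt (WVar x) be)
       (Seq body (WSet x (WAdd (WVar x) (WConst 1))))).

(** The invariant [I i] speaks of the state whose counter already is [i]; [N < B] keeps the counter
    from wrapping around. The 8 collects the overhead of test and increment in a round, the 6 that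
    of the initial assignment and the final failing test. *)
Lemma run_for x be body s0 N (I : nat -> state R -> nat -> Prop) Q :
  (N < B)%N -> (1 < B)%N -> x \notin wmod body ->
  (forall i s, keep (For x be body) s0 s -> wvar s x = i -> (i <= N)%N ->
     weval B s be = N) ->
  I 0%N (set_wvar s0 x 0) 0%N ->
  (forall i s T, (i < N)%N -> keep (For x be body) s0 s -> wvar s x = i ->
     I i s T ->
     run body s (fun s' t =>
       I i.+1 (set_wvar s' x i.+1) (T + t + (wcost be + 8))%N)) ->
  (forall s T, keep (For x be body) s0 s -> wvar s x = N -> I N s T ->
     Q s (T + wcost be + 6)%N) ->
  run (For x be body) s0 Q.
Proof.
move=> NB B1 xb hbe hI hstep hend.
rewrite /For; apply: (@run_seq _ _ _ (fun s t => s = set_wvar s0 x 0 /\ t = 2%N)).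
  by apply: wp_run => /=; rewrite mod0n.
move=> s1 t1 _ [-> ->] {s1 t1}.
have k0 s : keep (Seq body (WSet x (WAdd (WVar x) (WConst 1)))) (set_wvar s0 x 0) s ->
    keep (For x be body) s0 s.
  move=> [k1 k2 k3 k4]; split=> y.
  - rewrite /= inE negb_or => /andP[yx] h; rewrite k1 //= /upd.
    by rewrite (negbTE yx).
  - by move=> h; rewrite k2.
  - by move=> h; rewrite k3.
  - by move=> h; rewrite k4.
pose J mu s T := exists i, [/\ wvar s x = i, (i <= N)%N, mu = (N - i)%N & I i s T].
apply: (@run_while _ _ _ J N).
- by exists 0%N; split=> //=; rewrite ?subn0 // /upd eqxx.
- move=> mu s T /k0 ks [i [sx iN -> Is]] /=; rewrite (hbe _ _ ks sx iN) sx -ltnNge => lt_iN.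
  have /run_keep h := hstep i s T lt_iN ks sx Is.
  apply: (run_seq h) => s1 t1 _ [I1 [kx _ _ _]].
  apply: wp_run => /=; exists (N - i.+1)%N; first lia.
  have -> : ((wvar s1 x + 1 %% B) %% B = i.+1)%N.
    by rewrite kx // sx !modn_small ?addn1 //; lia.
  exists i.+1; split=> //=; first by rewrite /upd eqxx.
  by have -> : (T + (t1 + 4) + (wcost be + 1).+3 = T + t1 + (wcost be + 8))%N by lia.
- move=> mu s T /k0 ks [i [sx iN _ Is]] /=; rewrite (hbe _ _ ks sx iN) sx -ltnNge -leqNgt => hi.
  have ei : i = N by lia.
  rewrite ei in Is sx.
  have := hend s T ks sx Is.
  by have -> : (2 + (T + (wcost be + 1).+3) = T + wcost be + 6)%N by lia.
Qed.

End Logic.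

(** * A tournament tree as priority queue *)

Notation v_n := 0%N (only parsing).
Notation v_m := 1%N (only parsing).
Notation v_k := 2%N (only parsing).
Notation v_lf := 3%N (only parsing).
Notation v_t := 4%N (only parsing).
Notation v_i := 5%N (only parsing).
Notation v_a := 6%N (only parsing).
Notation v_b := 7%N (only parsing).
Notation v_u := 8%N (only parsing).
Notation v_e := 9%N (only parsing).
Notation v_v := 10%N (only parsing).
Notation v_z := 11%N (only parsing).
Notation v_c := 12%N (only parsing).
Notation v_x := 13%N (only parsing).
Notation v_y := 14%N (only parsing).
Notation v_q := 15%N (only parsing).
Notation v_o := 16%N (only parsing).
Notation v_p := 17%N (only parsing).
Notation v_j := 18%N (only parsing).

Notation a_tl := 0%N (only parsing).
Notation a_hd := 1%N (only parsing).
Notation a_out := 2%N (only parsing).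
Notation a_hd2 := 3%N (only parsing).
Notation a_nx := 4%N (only parsing).
Notation a_first := 5%N (only parsing).
Notation a_act := 6%N (only parsing).
Notation a_mask := 7%N (only parsing).
Notation a_seen := 8%N (only parsing).
Notation a_par := 9%N (only parsing).
Notation a_tree := 10%N (only parsing).
Notation a_near := 11%N (only parsing).
Notation a_has := 12%N (only parsing).
Notation a_cnt := 13%N (only parsing).

Notation x_wt := 0%N (only parsing).
Notation x_wt2 := 1%N (only parsing).
Notation x_key := 2%N (only parsing).
Notation x_rho := 3%N (only parsing).

Notation r_max := 0%N (only parsing).
Notation r_lo := 1%N (only parsing).
Notation r_hi := 2%N (only parsing).
Notation r_step := 3%N (only parsing).
Notation r_rad := 4%N (only parsing).

Notation V x := (WVar x) (only parsing).
Notation K x := (WConst x) (only parsing).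
Notation G a e := (WGet a e) (only parsing).
Notation "a ;; b" := (Seq a b) (at level 100, b at level 200, only parsing).
Arguments upd {T} f i x j /.
Definition Nz e := Lt (WConst 0) e.

Section Tournament.
Context {R : realType}.
Variable q : nat.
Local Notation lf := (2 ^ q)%N.
Implicit Types (tree : nat -> nat) (key : nat -> R).

Definition comb key a b : nat :=
  if a == 0%N then b else if b == 0%N then a else
  if key a.-1 <= key b.-1 then a else b.

Definition consistent tree key i := tree i = comb key (tree (2 * i)%N) (tree (2 * i + 1)%N).

(* Node [i] has the children [2i] and [2i+1], the leaf of the item [v] is
   [lf + v], and a nonzero entry [v.+1] stands for the item [v]. *)
Definition tournament tree key :=
  (forall i, (0 < i < lf)%N -> consistent tree key i) /\
  (forall v, (v < lf)%N -> tree (lf + v)%N = 0%N \/ tree (lf + v)%N = v.+1).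

(** The situation while a change at [l] is being propagated: only proper ancestors of [l], which are
    its iterated halves, may be inconsistent. *)
Definition broken_above tree key l :=
  (forall i, (0 < i < lf)%N ->
     consistent tree key i \/ exists j, i = (l %/ 2 ^ j.+1)%N) /\
  (forall v, (v < lf)%N -> tree (lf + v)%N = 0%N \/ tree (lf + v)%N = v.+1).

Lemma divn2S l j : (l %/ 2 ^ j.+1 = (l %/ 2 ^ j) %/ 2)%N.
Proof. by rewrite expnSr divnMA. Qed.

(** Descending to the child whose entry was copied ends at a leaf, so the winner of a subtree is an
    item of that subtree. *)
Lemma tournament_leaf tree key c : tournament tree key -> (0 < c < 2 * lf)%N ->
  tree c != 0%N ->
  exists v j, [/\ (v < lf)%N, tree c = v.+1, tree (lf + v)%N = v.+1
                & c = ((lf + v) %/ 2 ^ j)%N].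
Proof.
move=> [h1 h2].
have [N] := ubnP (2 * lf - c)%N; elim: N c => // N IH c cN hc tc.
have [clf|clf] := leqP lf c.
  have := h2 (c - lf)%N; rewrite subnKC // => /(_ _)[|e|e]; first by lia.
    by rewrite e in tc.
  exists (c - lf)%N, 0%N; split=> //; first lia.
    by rewrite subnKC.
  by rewrite divn1; lia.
have e : consistent tree key c by apply: h1; lia.
rewrite /consistent /comb in e.
have [d [dc td]] : exists d, (d = 2 * c \/ d = 2 * c + 1)%N /\ tree c = tree d.
  rewrite e; case: ifP => _; first by exists (2 * c + 1)%N; split=> //; right.
  case: ifP => _; first by exists (2 * c)%N; split=> //; left.
  by case: ifP => _; [exists (2 * c)%N|exists (2 * c + 1)%N]; split=> //; [left|right].
have [|||v [j [v1 v2 v3 v4]]] := IH d; [lia|lia|by rewrite -td|].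
exists v, j.+1; split=> //; first by rewrite td.
by rewrite divn2S -v4; lia.
Qed.

(** At a node that is no ancestor of [v], the winners of both children come from subtrees without
    [v] by [tournament_leaf]; hence neither the entries nor the keys compared there have changed. *)
Lemma tournament_change tree key tree' key' v : (v < lf)%N -> tournament tree key ->
  (forall i, i <> (lf + v)%N -> tree' i = tree i) ->
  (forall u, u <> v -> key' u = key u) ->
  tree' (lf + v)%N = 0%N \/ tree' (lf + v)%N = v.+1 ->
  broken_above tree' key' (lf + v)%N.
Proof.
move=> vlf T ht hk hv; split; last first.
  move=> u ulf; have [->//|uv] := eqVneq u v.
  by rewrite ht; [case: T => _ /(_ u ulf)|move/eqP: uv; lia].
move=> i hi; case: (pselect (exists j, i = ((lf + v) %/ 2 ^ j.+1)%N)) => [|hj]; [by right|left].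
have nl d : (d = 2 * i \/ d = 2 * i + 1)%N ->
    tree' d = tree d /\ (tree d != 0%N -> key' (tree d).-1 = key (tree d).-1).
  move=> hd; have de : d <> (lf + v)%N.
    by move=> e; apply: hj; exists 0%N; rewrite expn1; lia.
  split=> [|td]; first exact: ht.
  have [|u [j [u1 u2 u3 u4]]] := tournament_leaf T _ td; first by lia.
  rewrite u2 /= hk // => uv; apply: hj; exists j.
  by rewrite divn2S -uv -u4; lia.
have [e1 k1] := nl _ (or_introl erefl).
have [e2 k2] := nl _ (or_intror erefl).
have : consistent tree key i by case: T => + _; apply.
rewrite /consistent e1 e2 ht; last by lia.
move=> ->; rewrite /comb; case: eqP => // /eqP /k1 ->.
by case: eqP => // /eqP /k2 ->.
Qed.

(** Winning is transitive along the path from the leaf of [v] up to the root. *)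
Lemma tournament_min tree key v j : tournament tree key -> (v < lf)%N ->
  tree (lf + v)%N != 0%N -> (0 < (lf + v) %/ 2 ^ j)%N ->
  tree ((lf + v) %/ 2 ^ j)%N != 0%N /\
  key (tree ((lf + v) %/ 2 ^ j)%N).-1 <= key v.
Proof.
move=> [h1 h2] vlf tv; elim: j => [|j IH].
  rewrite divn1 => _; split=> //.
  by case: (h2 v vlf) tv => -> //.
rewrite divn2S; set d := ((lf + v) %/ 2 ^ j)%N in IH * => d0.
have [|td kd] := IH; first by lia.
have dl : (d <= lf + v)%N by apply: leq_div.
have -> : consistent tree key (d %/ 2) by apply: h1; lia.
have [e|e] : (d = 2 * (d %/ 2) \/ d = 2 * (d %/ 2) + 1)%N by lia.
  rewrite -e /comb (negbTE td); set o := tree _.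
  have [h|h] := eqVneq o 0%N; first by rewrite /= (negbTE td).
  case: (lerP (key (tree d).-1) (key o.-1)) => [_|/ltW h']; first by rewrite (negbTE td).
  by rewrite (negbTE h); split=> //; apply: le_trans kd.
rewrite -e /comb (negbTE td); set o := tree _.
have [h|h] := eqVneq o 0%N; first by rewrite (negbTE td).
case: (lerP (key o.-1) (key (tree d).-1)) => [h'|_]; last by rewrite (negbTE td).
by rewrite (negbTE h); split=> //; apply: le_trans kd.
Qed.

Lemma tournament_root tree key v : tournament tree key -> (v < lf)%N ->
  tree (lf + v)%N != 0%N -> tree 1%N != 0%N /\ key (tree 1%N).-1 <= key v.
Proof.
move=> T vlf tv.
have e : ((lf + v) %/ 2 ^ q = 1)%N.
  by rewrite divnDl // divnn expn_gt0 /= divn_small.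
by have := @tournament_min _ _ _ q T vlf tv; rewrite e; apply.
Qed.

Lemma tournament_root_leaf tree key : tournament tree key -> tree 1%N != 0%N ->
  exists v, [/\ (v < lf)%N, tree 1%N = v.+1 & tree (lf + v)%N = v.+1].
Proof.
move=> T t1; have q0 : (0 < lf)%N by rewrite expn_gt0.
have [|v [j [v1 v2 v3 v4]]] := tournament_leaf T _ t1; first lia.
by exists v.
Qed.

Lemma tournament0 tree key : (forall i, (i < 2 * lf)%N -> tree i = 0%N) -> tournament tree key.
Proof.
move=> h; split=> [i hi|v hv].
  by rewrite /consistent /comb !h //; lia.
by left; apply: h; lia.
Qed.

Definition pq_fix : cmd :=
  While (Lt (K 1) (V v_i)) (
    WSet v_i (WDiv (V v_i) (K 2)) ;;
    WSet v_a (G a_tree (WMul (K 2) (V v_i))) ;;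
    WSet v_b (G a_tree (WAdd (WMul (K 2) (V v_i)) (K 1))) ;;
    If (BLeW (V v_a) (K 0)) (WPut a_tree (V v_i) (V v_b))
      (If (BLeW (V v_b) (K 0)) (WPut a_tree (V v_i) (V v_a))
        (If (BLeR (RGet x_key (WSub (V v_a) (K 1))) (RGet x_key (WSub (V v_b) (K 1))))
          (WPut a_tree (V v_i) (V v_a)) (WPut a_tree (V v_i) (V v_b))))).

Variable B : nat.
Hypothesis lfB : (2 * lf + 2 < B)%N.

Lemma pq_fix_run (s : state R) l :
  wvar s v_i = l -> (lf <= l < 2 * lf)%N ->
  broken_above (warr s a_tree) (rarr s x_key) l ->
  run B pq_fix s (fun s' t =>
    [/\ tournament (warr s' a_tree) (rarr s' x_key),
        forall j, (lf <= j)%N -> warr s' a_tree j = warr s a_tree j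
      & (t <= 50 * q + 10)%N]).
Proof.
move=> si hl hb.
pose J mu (s' : state R) T := exists j, [/\ wvar s' v_i = (l %/ 2 ^ j)%N, (j <= q)%N,
  mu = (q - j)%N, broken_above (warr s' a_tree) (rarr s' x_key) (l %/ 2 ^ j) &
  (forall i, (lf <= i)%N -> warr s' a_tree i = warr s a_tree i) /\ (T <= 50 * j)%N].
have q0 : (0 < lf)%N by rewrite expn_gt0.
have m1 : (1 %% B = 1)%N by rewrite modn_small //; lia.
have m2 : (2 %% B = 2)%N by rewrite modn_small //; lia.
apply: (@run_while _ _ _ _ _ J q).
- by exists 0%N; rewrite divn1 subn0; split.
- move=> mu s1 T ks [j [i1 jq -> [hb1 hb2] [hlf hT]]] /=.
  rewrite m1 -ltnNge i1 => lt1.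
  have jlt : (j < q)%N.
    rewrite ltnNge; apply/negP => qj; have ej : j = q by lia.
    have : (l %/ 2 ^ j < 2)%N by rewrite ltn_divLR ?expn_gt0 // ej; lia.
    lia.
  set i2 := (l %/ 2 ^ j)%N in i1 hb1 lt1 *.
  have i2l : (i2 < 2 * lf)%N by apply: leq_ltn_trans (leq_div _ _) _; lia.
  have e3 : (l %/ 2 ^ j.+1 = i2 %/ 2)%N by rewrite divn2S.
  set i3 := (i2 %/ 2)%N in e3.
  have i3l : (0 < i3 < lf)%N by rewrite /i3; lia.
  (* One step of the climb: once [i3] holds the value of [comb], only its own proper ancestors may
     be inconsistent. The four branches of the program are the cases of [comb]. *)
  have fin s' t : wvar s' v_i = i3 -> rarr s' x_key = rarr s1 x_key ->
      warr s' a_tree = upd (warr s1 a_tree) i3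
        (comb (rarr s1 x_key) (warr s1 a_tree (2 * i3)%N) (warr s1 a_tree (2 * i3 + 1)%N)) ->
      (t <= 50)%N ->
      exists2 mu', (mu' < q - j)%N & J mu' s' (T + t)%N.
    move=> ei er et ht; exists (q - j.+1)%N; first by lia.
    exists j.+1; rewrite e3; split=> //; last first.
      split; last by lia.
      by move=> i hi; rewrite et /upd; case: eqP => [|_]; [lia|exact: hlf].
    split; last first.
      by move=> v hv; rewrite et /upd; case: eqP => [|_]; [lia|exact: hb2].
    move=> i hi; have [->|ne] := eqVneq i i3.
      left; rewrite /consistent er et /upd eqxx !ifF //; apply/eqP; clear -i3l; lia.
    have [ea|nea] := eqVneq (i3 %/ 2)%N i.
      by right; exists 0%N; rewrite expn1 ea.
    move/eqP: (ne) => ne2; move/eqP: (nea) => nea2.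
    case: (hb1 i hi) => [hc|[j' ej']].
      left; move: hc; rewrite /consistent er et /upd !ifF //; apply/eqP;
        clear -i3l ne2 nea2; lia.
    right; case: j' ej' => [|j'] ej'; first by case: ne2; rewrite ej' expn1.
    by exists j'; rewrite ej' expnS divnMA.
  have w3 : ((2 * i3) %% B = 2 * i3)%N by rewrite modn_small //; lia.
  have w4 : ((2 * i3 + 1) %% B = 2 * i3 + 1)%N by rewrite modn_small //; lia.
  apply: wp_run; rewrite /= m1 m2 mod0n i1 -/i3 w3 w4 !subn1.
  split=> ha; last split=> hbb; last split=> hk.
  + rewrite -addnA; apply: fin => //=.
    by rewrite /comb -leqn0 ha.
  + rewrite -addnA; apply: fin => //=.
    by rewrite /comb -!leqn0 (negbTE ha) hbb.
  + rewrite -addnA; apply: fin => //=.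
    by rewrite /comb -!leqn0 (negbTE ha) (negbTE hbb) hk.
  + rewrite -addnA; apply: fin => //=.
    by rewrite /comb -!leqn0 (negbTE ha) (negbTE hbb) (negbTE hk).
- move=> mu s1 T ks [j [i1 jq _ [hb1 hb2] [hlf hT]]] /=.
  rewrite m1 -ltnNge -leqNgt i1 => le1; split=> //; last (clear -jq hT; lia).
  split=> // i hi; case: (hb1 i hi) => // -[j' ej'].
  have : ((l %/ 2 ^ j) %/ 2 ^ j'.+1 = 0)%N.
    rewrite divn_small // (leq_ltn_trans le1) // -{1}(expn0 2) ltn_exp2l //.
  lia.
Qed.

End Tournament.

(** Stated with additions on both sides, which avoids truncated subtraction. *)
Lemma sum_upd N (f g : nat -> nat) u : (u < N)%N ->
  (forall v, (v < N)%N -> v <> u -> g v = f v) ->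
  (\sum_(v < N) g v + f u = \sum_(v < N) f v + g u)%N.
Proof.
move=> uN h; rewrite (bigD1 (Ordinal uN)) //= [in RHS](bigD1 (Ordinal uN)) //=.
rewrite (eq_bigr (fun i : 'I_N => f i)); first by lia.
by move=> i /eqP hi; apply: h => // e; apply: hi; apply: val_inj.
Qed.

Lemma leq_sum_nat N (f g : nat -> nat) : (forall v, (v < N)%N -> (f v <= g v)%N) ->
  (\sum_(v < N) f v <= \sum_(v < N) g v)%N.
Proof. by move=> h; apply: leq_sum => i _; apply: h. Qed.

(** * Queue operations: insertion, deletion and minimum *)

Section PqOps.
Context {R : realType}.
Variables (q B : nat).
Local Notation lf := (2 ^ q)%N.
Hypothesis lfB : (2 * lf + 2 < B)%N.
Implicit Types s : state R.

Definition queued s v := warr s a_tree (2 ^ q + v)%N != 0%N.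
Definition pq_ok s := tournament q (warr s a_tree) (rarr s x_key).

Definition pq_put e :=
  (WSet v_i (WAdd (V v_lf) e) ;;
   WPut a_tree (V v_i) (WAdd (WSub (V v_i) (V v_lf)) (K 1))) ;;
  pq_fix.

Definition pq_del e :=
  (WSet v_i (WAdd (V v_lf) e) ;; WPut a_tree (V v_i) (K 0)) ;; pq_fix.

(** [key0] is the key table before the key of [v] was overwritten; the lemma thus covers insertion
    and change of key alike. *)
Lemma pq_put_run s e v key0 :
  wvar s v_lf = lf -> weval B s e = v -> (v < lf)%N ->
  tournament q (warr s a_tree) key0 ->
  (forall u, u <> v -> rarr s x_key u = key0 u) ->
  run B (pq_put e) s (fun s' t =>
    [/\ pq_ok s', queued s' v,
        forall u, (u < lf)%N -> u <> v -> queued s' u = queued s u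
      & (t <= 50 * q + wcost e + 20)%N]).
Proof.
move=> hlf he vlf T hk.
have m1 : (1 %% B = 1)%N by rewrite modn_small //; lia.
have m2 : ((lf + v) %% B = lf + v)%N by rewrite modn_small //; lia.
have m3 : ((lf + v - lf + 1) %% B = v + 1)%N by rewrite addKn modn_small //; lia.
apply: (@run_seq _ _ _ _ _ (fun s1 t1 => s1 = set_warr (set_wvar s v_i (lf + v)%N) a_tree (lf + v)%N (v + 1)%N /\ (t1 <= wcost e + 10)%N)).
  by apply: wp_run; rewrite /= m1 hlf he m2 m3; split=> //; lia.
move=> s1 t1 _ [-> ht1].
apply: run_weaken.
  apply: (@pq_fix_run _ q B lfB _ (lf + v)%N) => //=; first by lia.
  apply: (tournament_change vlf T) => //=.
  - by move=> i /eqP/negbTE ->.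
  - by right; rewrite eqxx addn1.
move=> s' t [h1 h2 h3]; split=> //; last by lia.
- by rewrite /queued h2 ?leq_addr //= eqxx addn1.
- by move=> u ul /eqP/negbTE uv; rewrite /queued h2 ?leq_addr //= eqn_add2l uv.
Qed.

Lemma pq_del_run s e v :
  wvar s v_lf = lf -> weval B s e = v -> (v < lf)%N -> pq_ok s ->
  run B (pq_del e) s (fun s' t =>
    [/\ pq_ok s', ~~ queued s' v,
        forall u, (u < lf)%N -> u <> v -> queued s' u = queued s u
      & (t <= 50 * q + wcost e + 20)%N]).
Proof.
move=> hlf he vlf T.
have m1 : (0 %% B = 0)%N by rewrite mod0n.
have m2 : ((lf + v) %% B = lf + v)%N by rewrite modn_small //; lia.
apply: (@run_seq _ _ _ _ _ (fun s1 t1 => s1 = set_warr (set_wvar s v_i (lf + v)%N) a_tree (lf + v)%N 0%N /\ (t1 <= wcost e + 10)%N)).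
  by apply: wp_run; rewrite /= m1 hlf he m2; split=> //; lia.
move=> s1 t1 _ [-> ht1].
apply: run_weaken.
  apply: (@pq_fix_run _ q B lfB _ (lf + v)%N) => //=; first by lia.
  apply: (tournament_change vlf T) => //=.
  - by move=> i /eqP/negbTE ->.
  - by left; rewrite eqxx.
move=> s' t [h1 h2 h3]; split=> //; last by lia.
- by rewrite /queued h2 ?leq_addr //= eqxx.
- by move=> u ul /eqP/negbTE uv; rewrite /queued h2 ?leq_addr //= eqn_add2l uv.
Qed.

Lemma pq_root s : pq_ok s -> warr s a_tree 1 != 0%N ->
  exists v, [/\ (v < lf)%N, warr s a_tree 1 = v.+1, queued s v &
    forall u, (u < lf)%N -> queued s u -> rarr s x_key v <= rarr s x_key u].
Proof.
move=> T h1; have [v [vl e1 e2]] := tournament_root_leaf T h1.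
exists v; split=> // [|u ul qu]; first by rewrite /queued e2.
by have [_] := tournament_root T ul qu; rewrite e1.
Qed.

Lemma pq_empty s v : pq_ok s -> warr s a_tree 1 = 0%N -> (v < lf)%N -> ~~ queued s v.
Proof.
move=> T h1 vl; apply/negP => qv.
by have [] := tournament_root T vl qv; rewrite h1.
Qed.

End PqOps.

(** * Dijkstra's algorithm *)

Section Dijkstra.
Context {R : realType}.
Variables (q B n N M : nat) (tl hd : nat -> nat) (wt : nat -> R).
Variable adj : nat -> seq nat.
Local Notation lf := (2 ^ q)%N.
Hypothesis lfB : (2 * lf + 2 < B)%N.
Hypothesis N2 : N = (2 * n)%N.
Hypothesis MB : (M + 2 < B)%N.
Hypothesis Nlf : (N <= lf)%N.
Hypothesis hdN : forall e, (e < M)%N -> (hd e < N)%N.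
Hypothesis wt1 : forall e, (e < M)%N -> 1 <= wt e.
Hypothesis adjE : forall u e, e \in adj u -> (e < M)%N /\ tl e = u.
Hypothesis adj_tl : forall e, (e < M)%N -> (tl e < N)%N /\ e \in adj (tl e).
Hypothesis adj_sum : (\sum_(v < N) size (adj v) <= M)%N.
Hypothesis adj_uniq : forall u, uniq (adj u).
Implicit Types s : state R.

(** A linked list in an array: a pointer is an edge number plus one, and 0 ends the list. *)
Fixpoint chain (nx : nat -> nat) p (l : seq nat) : Prop :=
  if l is e :: l' then p = e.+1 /\ chain nx (nx e) l' else p = 0%N.

Definition graph_in s :=
  [/\ wvar s v_n = n /\ wvar s v_lf = lf,
      forall e, (e < M)%N -> warr s a_hd2 e = hd e,
      forall e, (e < M)%N -> rarr s x_wt2 e = wt e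
    & forall u, (u < N)%N -> chain (warr s a_nx) (warr s a_first u) (adj u)].

Lemma graph_in_keep c s s' :
  [&& v_n \notin wmod c, v_lf \notin wmod c, a_hd2 \notin amod c, a_nx \notin amod c,
      a_first \notin amod c & x_wt2 \notin ramod c] ->
  keep c s s' -> graph_in s -> graph_in s'.
Proof.
case/and5P=> h1 h2 h3 h4 /andP[h5 h6] [kw ka kr kx].
by rewrite /graph_in !kw // (ka _ h3) (ka _ h4) (ka _ h5) (kx _ h6).
Qed.

Definition seen s v := warr s a_seen v != 0%N.
Definition mask s v := warr s a_mask v != 0%N.
Definition done s v := seen s v && ~~ queued q s v.
Local Notation key s v := (rarr s x_key v).
Local Notation par s v := (warr s a_par v).

(* While the edges out of [u] are scanned, [l] lists those still to come;
   [d] separates the keys of the settled vertices from the queued ones. *)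
Record dij_inv (src : pred nat) s (d : R) u (l : seq nat) : Prop := DijInv {
  di_pq : pq_ok q s;
  di_queued : forall v, (v < lf)%N -> queued q s v -> (v < N)%N /\ seen s v;
  di_mask : forall v, (v < N)%N -> seen s v -> mask s v;
  di_par : forall v, (v < N)%N -> seen s v ->
    (src v /\ par s v = 0%N) \/
    exists e, [/\ (e < M)%N, par s v = e.+1, hd e = v, done s (tl e)
                & key s v = key s (tl e) + wt e];
  di_key : forall v, (v < N)%N -> seen s v ->
    if queued q s v then d <= key s v else key s v <= d;
  di_src : forall v, (v < N)%N -> src v -> seen s v /\ key s v = 0;
  di_edge : forall e, (e < M)%N -> done s (tl e) -> mask s (hd e) ->
    (tl e = u /\ e \in l) \/
    (seen s (hd e) /\ key s (hd e) <= key s (tl e) + wt e);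
  di_ge0 : 0 <= d
}.

Lemma dij_inv_eq src s s' d u l :
  warr s' a_tree = warr s a_tree -> warr s' a_seen = warr s a_seen ->
  warr s' a_mask = warr s a_mask -> warr s' a_par = warr s a_par ->
  rarr s' x_key = rarr s x_key ->
  dij_inv src s d u l -> dij_inv src s' d u l.
Proof.
move=> e1 e2 e3 e4 e5 [i1 i2 i3 i4 i5 i6 i7 i8].
by split; rewrite /pq_ok /done /seen /queued /mask ?e1 ?e2 ?e3 ?e4 ?e5.
Qed.

Definition relax :=
  WSet v_v (G a_hd2 (WSub (V v_e) (K 1))) ;;
  If (BAnd (Nz (G a_mask (V v_v)))
        (BNot (BAnd (Nz (G a_seen (V v_v)))
           (BLeR (RGet x_key (V v_v))
              (RAdd (RGet x_key (V v_u)) (RGet x_wt2 (WSub (V v_e) (K 1))))))))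
     ((RPut x_key (V v_v) (RAdd (RGet x_key (V v_u)) (RGet x_wt2 (WSub (V v_e) (K 1)))) ;;
       WPut a_par (V v_v) (V v_e) ;;
       WPut a_seen (V v_v) (K 1)) ;;
      pq_put (V v_v))
     Skip ;;
  WSet v_e (G a_nx (WSub (V v_e) (K 1))).

Definition dij_scan := While (Nz (V v_e)) relax.

(** A settled head has key at most [d], which is below [d + wt e] as weights are positive. So a
    successful relaxation concerns an unsettled vertex, and the settled keys stay as they are. *)
Lemma relax_run src s d u e l :
  graph_in s -> dij_inv src s d u (e :: l) -> wvar s v_u = u -> (u < N)%N ->
  wvar s v_e = e.+1 -> done s u -> key s u = d -> (e < M)%N -> tl e = u ->
  uniq (e :: l) ->
  run B relax s (fun s' t =>
    [/\ dij_inv src s' d u l, wvar s' v_e = warr s a_nx e,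
        forall v, (v < N)%N -> done s' v = done s v, key s' u = d
      & (t <= 50 * q + 100)%N]).
Proof.
move=> [[_ glf] ghd gwt gch] I su uN se du ku eM tle /= /andP[el ul].
have m1 : (1 %% B = 1)%N by rewrite modn_small //; clear -lfB; lia.
set v := hd e.
have vN : (v < N)%N by apply: hdN.
have vlf : (v < lf)%N by apply: leq_trans Nlf.
apply: (@run_seq _ _ _ _ _ (fun s1 t1 => s1 = set_wvar s v_v v /\ t1 = 5%N)).
  by apply: wp_run; rewrite /= m1 se subn1 /= ghd.
move=> s1 t1 _ [-> ->].
pose s0 := set_wvar s v_v v.
have dge0 := di_ge0 I.
have we1 := wt1 eM.
have wd : d < d + wt e by rewrite ltrDl (lt_le_trans ltr01).
apply: (@run_seq _ _ _ _ _ (fun s2 t2 =>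
    [/\ dij_inv src s2 d u l,
        forall v, (v < N)%N -> done s2 v = done s v, key s2 u = d
      & (t2 <= 50 * q + 80)%N])); last first.
  move=> s2 t2 [kw ka kr kx] [I2 h2 h3 h4].
  apply: wp_run; rewrite /= m1 (kw v_e isT) (ka a_nx isT) /= se subn1 /=.
  split=> //; last by clear -h4; lia.
  exact: dij_inv_eq I2.
apply: run_if => /=.
- rewrite !mod0n su m1 se subn1 /= gwt // ku => /andP[mv better].
  rewrite -ltnNge lt0n in mv.
  have {}better : seen s v -> d + wt e < key s v.
    by move=> sv; move: better; rewrite leqn0 -/(seen s v) sv /= -ltNge.
  have nd : ~~ done s v.
    apply/negP => dv; have /andP[sv nqv] := dv.
    have := di_key I vN sv; rewrite (negbTE nqv) => kv.
    by have := better sv; rewrite ltNge (le_trans kv (ltW wd)).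
  have vu : v <> u by move=> vu; rewrite vu du in nd.
  apply: (@run_seq _ _ _ _ _ (fun s1 t1 => s1 =
     set_warr (set_warr (set_rarr s0 x_key v (d + wt e)) a_par v e.+1) a_seen v 1%N
     /\ (t1 <= 16)%N)).
    by apply: wp_run; rewrite /= m1 su se ku subn1 /= gwt.
  move=> s2 t2 _ [-> ht2]; set s3 := set_warr _ a_seen v 1%N.
  apply: run_weaken.
    apply: run_keep.
    apply: (@pq_put_run _ q B lfB s3 _ v (rarr s x_key)) => //.
    - exact: (di_pq I).
    - by move=> w wv /=; case: eqP.
  move=> s' t [[p1 p2 p3 p4] [kw ka kr kx]].
  have sK w : key s' w = if w == v then d + wt e else key s w by rewrite (kx x_key isT).
  have sP w : par s' w = if w == v then e.+1 else par s w by rewrite (ka a_par isT).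
  have sS w : seen s' w = (w == v) || seen s w.
    by rewrite /seen (ka a_seen isT) /=; case: (w == v).
  have sM w : mask s' w = mask s w by rewrite /mask (ka a_mask isT).
  have sQ w : (w < N)%N -> queued q s' w = (w == v) || queued q s w.
    by move=> wN; have [->|/eqP wv] := eqVneq w v => //; rewrite p3 //; apply: leq_trans Nlf.
  have sD w : (w < N)%N -> done s' w = done s w.
    move=> wN; rewrite /done sS sQ //; have [->|wv] //= := eqVneq w v.
    by move: nd; rewrite /done => /negbTE ->.
  have kd w : done s w -> key s' w = key s w.
    by move=> dw; rewrite sK; case: eqP => // wv; rewrite -wv dw in nd.
  have tlN e' : (e' < M)%N -> (tl e' < N)%N by move=> /adj_tl[].
  split; [| by [] | by rewrite kd | by clear -p4 ht2; move: p4 => /=; lia].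
  split=> //.
  + move=> w wl; have [->|/eqP wv] := eqVneq w v.
      by rewrite sS eqxx.
    by rewrite p3 // => /(di_queued I wl) [wN sw]; rewrite sS sw orbT.
  + move=> w wN; rewrite sS sM; have [->|wv] //= := eqVneq w v.
    exact: (di_mask I).
  + move=> w wN; rewrite sS sP sK; have [->|wv] /= := eqVneq w v.
      by move=> _; right; exists e; rewrite sD tle // kd // ku.
    move=> /(di_par I wN) [|[e' [h1 h2 h3 h4 h5]]]; [by left|right].
    by exists e'; rewrite sD ?kd ?tlN.
  + move=> w wN; rewrite sS sQ // sK; have [->|wv] /= := eqVneq w v; first by rewrite ltW.
    exact: (di_key I).
  + move=> w wN sw; have [h1 h2] := di_src I wN sw; rewrite sS sK h1 orbT; split=> //.
    case: eqP => // wv; rewrite -wv in better.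
    by have := better h1; rewrite h2 ltNge addr_ge0 // (le_trans ler01).
  + move=> e' e'M; rewrite sD ?tlN // sM => de' me'; rewrite (kd _ de').
    rewrite sS sK; have [e1|ne1] := eqVneq (hd e') v.
      case: (di_edge I e'M de' me') => [[h1]|[sv kv]].
        rewrite inE => /orP[/eqP ee|h2]; last by left.
        by right; rewrite ee tle ku.
      right; split=> //; apply: le_trans kv; rewrite e1 in sv *.
      by apply: ltW; apply: better.
    case: (di_edge I e'M de' me') => [[h1]|h1]; last by right.
    rewrite inE => /orP[/eqP ee|h2]; last by left.
    by rewrite ee eqxx in ne1.
- rewrite !mod0n su m1 se subn1 /= gwt // ku => better.
  apply: wp_run => /=; split=> //; last (clear; lia).
  apply: (@dij_inv_eq _ s) => //.
  case: I => i1 i2 i3 i4 i5 i6 i7 i8; split=> //.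
  move=> e' e'M de' me'; case: (i7 e' e'M de' me') => [[h1]|h1]; last by right.
  rewrite inE => /orP[/eqP ee|h2]; last by left.
  have mv : mask s v by rewrite /v -ee.
  move: better; rewrite !leqn0 -/(mask s v) mv /= -/(seen s v) negbK => /andP[sv kv].
  by right; rewrite ee tle ku.
Qed.

Lemma dij_scan_run src s d u :
  graph_in s -> dij_inv src s d u (adj u) -> wvar s v_u = u -> (u < N)%N ->
  wvar s v_e = warr s a_first u -> done s u -> key s u = d ->
  run B dij_scan s (fun s' t =>
    [/\ dij_inv src s' d u [::],
        forall v, (v < N)%N -> done s' v = done s v
      & (t <= (50 * q + 120) * size (adj u) + 10)%N]).
Proof.
move=> gs I su uN se du ku.
pose J mu s1 T := exists l, [/\ dij_inv src s1 d u l, chain (warr s a_nx) (wvar s1 v_e) l,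
  (forall v, (v < N)%N -> done s1 v = done s v) /\ key s1 u = d,
  uniq l /\ {subset l <= adj u} &
  mu = size l /\ (T + (50 * q + 120) * size l <= (50 * q + 120) * size (adj u))%N].
apply: (@run_while _ _ _ _ _ J (size (adj u))).
- exists (adj u); split=> //; first by rewrite se; case: gs => _ _ _; apply.
  by split; [exact: adj_uniq|].
- move=> mu s1 T ks [l [I1 c1 [d1 k1] [u1 l1] [emu hT]]] /=.
  rewrite mod0n; case: l I1 c1 u1 l1 emu hT => [|e l] I1 /=; first by move=> ->.
  move=> [e1 c1] u1 l1 emu hT _.
  have [eM tle] := adjE (l1 e (mem_head _ _)).
  have gs1 : graph_in s1 by apply: graph_in_keep ks gs.
  have [kw ka kr kx] := ks.
  have du1 : done s1 u by rewrite d1.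
  apply: run_weaken.
    by apply: (relax_run gs1 I1 _ uN e1 du1) => //; rewrite (kw v_u isT).
  move=> s2 t [I2 e2 d2 k2 ht]; exists (size l); first by rewrite emu.
  exists l; split=> //.
  - by rewrite e2 (ka a_nx isT).
  - by split=> // v vN; rewrite d2 // d1.
  - split; first by case/andP: u1.
    by move=> x xl; apply: l1; rewrite inE xl orbT.
  - split=> //; apply: leq_trans hT; rewrite mulnS; clear -ht; lia.
- move=> mu s1 T ks [l [I1 c1 [d1 k1] [u1 l1] [emu hT]]] /=.
  rewrite mod0n -ltnNge -leqNgt leqn0 => /eqP e0.
  case: l I1 c1 hT {u1 l1 emu} => [|e l] I1 /= c1 hT; last by rewrite e0 in c1; case: c1.
  by split=> //; clear -hT; lia.
Qed.

Definition dij_loop :=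
  While (Nz (G a_tree (K 1))) (
    WSet v_u (WSub (G a_tree (K 1)) (K 1)) ;;
    pq_del (V v_u) ;;
    WSet v_e (G a_first (V v_u)) ;;
    dij_scan).

(** The time account: a settled vertex pays for its extraction and for the scan of its outgoing
    edges. *)
Let weight s := (\sum_(v < N) done s v * (size (adj v)).+1)%N.

(** The key of the extracted minimum is the new value separating settled from queued keys, and the
    edges out of [u] become the pending ones. *)
Lemma dij_extract src s d v0 u s' :
  dij_inv src s d v0 [::] -> (u < lf)%N -> queued q s u ->
  (forall w, (w < lf)%N -> queued q s w -> key s u <= key s w) ->
  warr s' a_seen = warr s a_seen ->
  warr s' a_mask = warr s a_mask -> warr s' a_par = warr s a_par ->
  rarr s' x_key = rarr s x_key -> pq_ok q s' -> ~~ queued q s' u ->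
  (forall w, (w < lf)%N -> w <> u -> queued q s' w = queued q s w) ->
  (forall w, (w < N)%N -> done s' w = done s w || (w == u)) /\
  dij_inv src s' (key s u) u (adj u).
Proof.
move=> I ulf qu umin e1 e2 e3 e4 pq' nqu hq.
have [uN su] := di_queued I ulf qu.
have sK w : key s' w = key s w by rewrite e4.
have sP w : par s' w = par s w by rewrite e3.
have sS w : seen s' w = seen s w by rewrite /seen e1.
have sM w : mask s' w = mask s w by rewrite /mask e2.
have nl w : (w < N)%N -> (w < lf)%N by move=> wN; apply: leq_trans Nlf.
have sD w : (w < N)%N -> done s' w = done s w || (w == u).
  move=> wN; rewrite /done sS; have [->|/eqP wu] := eqVneq w u.
    by rewrite nqu su orbT.
  by rewrite hq ?orbF // nl.
have tlN e' : (e' < M)%N -> (tl e' < N)%N by move=> /adj_tl[].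
have du : d <= key s u by have := di_key I uN su; rewrite qu.
split=> //; split=> //.
- move=> w wl; have [->|/eqP wu] := eqVneq w u; first by rewrite (negbTE nqu).
  by rewrite hq // sS; apply: (di_queued I).
- by move=> w wN; rewrite sS sM; apply: (di_mask I).
- move=> w wN; rewrite sS sP sK => /(di_par I wN) [h|[e [h1 h2 h3 h4 h5]]]; [by left|right].
  by exists e; rewrite sK sD ?tlN // h4.
- move=> w wN; rewrite sS sK => sw; have [->|/eqP wu] := eqVneq w u.
    by rewrite (negbTE nqu).
  rewrite hq ?nl //; have := di_key I wN sw.
  by case: ifP => qw kw; [apply: umin => //; apply: nl|apply: le_trans du].
- by move=> w wN sw; rewrite sS sK; apply: (di_src I).
- move=> e eM; rewrite sD ?tlN // sM sS !sK => /orP[dt|/eqP et] me.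
    by case: (di_edge I eM dt me) => [[]|]; [|right].
  by left; split=> //; rewrite -et; have [] := adj_tl eM.
- exact: le_trans (di_ge0 I) du.
Qed.

Lemma dij_loop_run src s u0 :
  graph_in s -> dij_inv src s 0 u0 [::] -> (forall v, (v < N)%N -> ~~ done s v) ->
  run B dij_loop s (fun s' t =>
    [/\ exists d u, dij_inv src s' d u [::],
        forall v, (v < lf)%N -> ~~ queued q s' v
      & (t <= (50 * q + 120) * (N + M) + 10)%N]).
Proof.
move=> gs I0 nd0.
have m1 : (1 %% B = 1)%N by rewrite modn_small //; clear -lfB; lia.
pose dn s1 := (\sum_(v < N) done s1 v)%N.
pose J mu s1 T := exists d u, [/\ dij_inv src s1 d u [::], (mu + dn s1 = N)%N &
  (T <= (50 * q + 120) * weight s1)%N].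
have dnN s1 : (dn s1 <= N)%N.
  by rewrite -[leqRHS]card_ord -sum1_card; apply: leq_sum => i _; case: done.
have dn0 : dn s = 0%N by apply: big1 => i _; rewrite (negbTE (nd0 i _)).
apply: (@run_while _ _ _ _ _ J N).
- by exists 0, u0; rewrite dn0 addn0.
- move=> mu s1 T ks [d [v0 [I1 hmu hT]]] /=.
  rewrite m1 mod0n -ltnNge lt0n => ht.
  have gs1 : graph_in s1 by apply: graph_in_keep ks gs.
  have [u [ulf eu qu umin]] := pq_root (di_pq I1) ht.
  have [uN su] := di_queued I1 ulf qu.
  have ndu : ~~ done s1 u by rewrite /done qu andbF.
  apply: (@run_seq _ _ _ _ _ (fun s2 t2 => s2 = set_wvar s1 v_u u /\ t2 = 5%N)).
    by apply: wp_run; rewrite /= m1 eu subn1.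
  move=> s9 t9 _ [-> ->] {s9 t9}.
  apply: (@run_seq _ _ _ _ _ (fun s2 t2 =>
     [/\ forall w, (w < N)%N -> done s2 w = done s1 w || (w == u),
         dij_inv src s2 (key s1 u) u (adj u), key s2 u = key s1 u
       & (t2 <= 50 * q + 21)%N])).
    apply: run_weaken.
      apply: run_keep.
      apply: (@pq_del_run _ q B lfB _ _ u) => //=; first by case: gs1 => -[].
      exact: (di_pq I1).
    move=> s3 t3 [[p1 p2 p3 p4] [kw ka kr kx]].
    have [h1 h2] := @dij_extract src s1 d v0 u s3 I1 ulf qu umin (ka a_seen isT) (ka a_mask isT)
      (ka a_par isT) (kx x_key isT) p1 p2 p3.
    split=> //; first by rewrite (kx x_key isT).
    by clear -p4; move: p4 => /=; lia.
  move=> s2 t2 [kw ka kr kx] [h1 h2 h3 h4].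
  have wu : wvar s2 v_u = u by rewrite (kw v_u isT).
  have gs2 : graph_in s2.
    have k2 : keep (pq_del (V v_u)) (set_wvar s1 v_u u) s2 by split.
    exact: (graph_in_keep _ k2).
  apply: (@run_seq _ _ _ _ _ (fun s3 t3 => s3 = set_wvar s2 v_e (warr s2 a_first u) /\ t3 = 3%N)).
    by apply: wp_run; rewrite /= wu.
  move=> s3 t3 _ [-> ->].
  have du2 : done s2 u by rewrite h1 // eqxx orbT.
  apply: run_weaken.
    apply: (@dij_scan_run src _ (key s1 u) u) => //=.
    exact: dij_inv_eq h2.
  move=> s4 t4 [I4 d4 ht4].
  have dd w : (w < N)%N -> done s4 w = done s1 w || (w == u).
    by move=> wN; rewrite d4 // -h1.
  have upd1 : (dn s4 = dn s1 + 1)%N.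
    have := @sum_upd N (done s1) (done s4) u uN; rewrite dd // eqxx orbT (negbTE ndu) addn0.
    by apply => v vN /eqP/negbTE vu; rewrite dd // vu orbF.
  have upd2 : (weight s4 = weight s1 + (size (adj u)).+1)%N.
    have := @sum_upd N (fun v => done s1 v * (size (adj v)).+1)%N
      (fun v => done s4 v * (size (adj v)).+1)%N u uN.
    rewrite dd // eqxx orbT (negbTE ndu) mul0n mul1n addn0.
    by apply => v vN /eqP/negbTE vu; rewrite dd // vu orbF.
  exists mu.-1; first by have := dnN s4; clear -hmu upd1; lia.
  exists (key s1 u), u; split=> //.
    by have := dnN s4; clear -hmu upd1; lia.
  by rewrite upd2 mulnDr mulnS; clear -hT h4 ht4; lia.
- move=> mu s1 T ks [d [v0 [I1 hmu hT]]] /=.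
  rewrite m1 mod0n -ltnNge -leqNgt leqn0 => /eqP ht; split.
  + by exists d, v0.
  + by move=> v vl; apply: pq_empty ht vl; apply: (di_pq I1).
  + have : (weight s1 <= N + M)%N.
      apply: (@leq_trans (\sum_(v < N) (size (adj v) + 1))%N).
        by apply: leq_sum => i _; rewrite addn1; case: done; rewrite ?mul1n ?mul0n.
      rewrite big_split /= sum1_card card_ord addnC leq_add2l; exact: adj_sum.
    rewrite -(leq_pmul2l (m := 50 * q + 120)); last by rewrite addn_gt0 orbT.
    clear -hT; lia.
Qed.

Definition dij_source e :=
  (RPut x_key e (RCast (K 0)) ;; WPut a_seen e (K 1)) ;; pq_put e.

Definition dij :=
  For v_z (WMul (K 2) (V v_n)) (WPut a_seen (V v_z) (K 0) ;; WPut a_par (V v_z) (K 0)) ;;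
  For v_z (WMul (K 2) (V v_lf)) (WPut a_tree (V v_z) (K 0)) ;;
  dij_source (V v_c) ;;
  dij_source (WAdd (V v_n) (V v_c)) ;;
  dij_loop.

(** What the invariant says once the queue is empty and every seen vertex is settled: parent edges
    attain the keys, and no edge into the mask can improve a key. *)
Definition sssp (src : pred nat) s :=
  [/\ forall v, (v < N)%N -> seen s v -> mask s v,
      forall v, (v < N)%N -> seen s v ->
        (src v /\ par s v = 0%N) \/
        exists e, [/\ (e < M)%N, par s v = e.+1, hd e = v, seen s (tl e)
                    & key s v = key s (tl e) + wt e],
      forall v, (v < N)%N -> src v -> seen s v /\ key s v = 0
    & forall e, (e < M)%N -> seen s (tl e) -> mask s (hd e) ->
        seen s (hd e) /\ key s (hd e) <= key s (tl e) + wt e].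

Definition fresh (src : pred nat) s :=
  [/\ pq_ok q s, forall v, (v < lf)%N -> queued q s v = src v,
      forall v, (v < N)%N -> seen s v = src v /\ par s v = 0%N
    & forall v, src v -> [/\ (v < N)%N, key s v = 0 & mask s v]].

Lemma dij_source_run src s e x :
  wvar s v_lf = lf -> (wcost e <= 3)%N ->
  (forall s', wvar s' v_n = wvar s v_n -> wvar s' v_c = wvar s v_c -> weval B s' e = x) ->
  (x < N)%N -> mask s x -> fresh src s ->
  run B (dij_source e) s (fun s' t =>
    fresh (predU1 x src) s' /\ (t <= 50 * q + 60)%N).
Proof.
move=> slf ce he xN mx [f1 f2 f3 f4].
have m1 : (1 %% B = 1)%N by rewrite modn_small //; clear -lfB; lia.
have xlf : (x < lf)%N by apply: leq_trans Nlf.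
apply: (@run_seq _ _ _ _ _ (fun s1 t1 =>
    s1 = set_warr (set_rarr s x_key x 0) a_seen x 1%N /\ (t1 <= 20)%N)).
  by apply: wp_run; rewrite /= m1 mod0n !he //=; split=> //; clear -ce; lia.
move=> s1 t1 _ [-> ht1]; set s2 := set_warr _ a_seen x 1%N.
apply: run_weaken.
  apply: run_keep; apply: (@pq_put_run _ q B lfB s2 e x (rarr s x_key)) => //.
    exact: he.
  by move=> u /eqP/negbTE ux /=; rewrite ux.
move=> s' t [[p1 p2 p3 p4] [kw ka kr kx]]; split; last by clear -p4 ht1 ce; lia.
have sQ w : (w < lf)%N -> queued q s' w = (w == x) || src w.
  by move=> wl; have [->|/eqP wx] := eqVneq w x => //=; rewrite p3 // -f2.
split=> //.
- move=> v vN; rewrite /seen (ka a_seen isT) (ka a_par isT) /=.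
  by have [h1 h2] := f3 _ vN; rewrite h2 -h1 /seen /predU1 /= ; case: (v == x).
- move=> v; rewrite /mask (kx x_key isT) (ka a_mask isT) /= /predU1 /=.
  by have [->|vx] //= := eqVneq v x => sv; apply: f4.
Qed.

Lemma dij_run s c :
  (1 < n)%N -> (2 * n + 2 < B)%N -> graph_in s -> wvar s v_c = c -> (c < n)%N ->
  mask s c -> mask s (n + c) ->
  run B dij s (fun s' t =>
    [/\ sssp (pred2 c (n + c)%N) s', pq_ok q s',
        forall v, (v < lf)%N -> ~~ queued q s' v
      & (t <= (50 * q + 200) * (N + M + 2 * lf + 2))%N]).
Proof.
move=> n1 nB gs sc cn mc mnc.
have m1 : (1 %% B = 1)%N by rewrite modn_small //; clear -lfB; lia.
have m2 : (2 %% B = 2)%N by rewrite modn_small //; clear -nB n1; lia.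
have [[gn glf] _ _ _] := gs.
apply: (@run_seq _ _ _ _ _ (fun s1 t1 =>
  (forall v, (v < N)%N -> seen s1 v = false /\ par s1 v = 0%N) /\ (t1 <= 20 * N + 20)%N)).
  apply: (@run_for _ _ _ _ _ _ N (fun i s1 T =>
     (forall v, (v < i)%N -> seen s1 v = false /\ par s1 v = 0%N) /\ (T <= 20 * i)%N)) => //.
  - by rewrite N2; clear -nB; lia.
  - by clear -nB n1; lia.
  - by move=> i s1 [kw _ _ _] _ _; rewrite /= m2 (kw v_n isT) gn -N2 modn_small //; clear -nB N2; lia.
  - move=> i s1 T iN _ si [h hT]; apply: wp_run; rewrite /= mod0n si; split.
      move=> v vi; rewrite /seen /=; have [//|vi'] := eqVneq v i.
      by apply: h; move/eqP: vi'; clear -vi; lia.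
    by clear -hT; lia.
  - by move=> s1 T _ _ [h hT]; split=> //=; clear -hT; lia.
move=> s1 t1 k1 [h1 ht1].
have gs1 : graph_in s1 by apply: graph_in_keep k1 gs.
have [[gn1 glf1] _ _ _] := gs1.
apply: (@run_seq _ _ _ _ _ (fun s2 t2 =>
  (forall v, (v < 2 * lf)%N -> warr s2 a_tree v = 0%N) /\ (t2 <= 20 * (2 * lf) + 20)%N)).
  apply: (@run_for _ _ _ _ _ _ (2 * lf)%N (fun i s1 T =>
     (forall v, (v < i)%N -> warr s1 a_tree v = 0%N) /\ (T <= 20 * i)%N)) => //.
  - by clear -lfB; lia.
  - by clear -nB n1; lia.
  - by move=> i s2 [kw _ _ _] _ _; rewrite /= m2 (kw v_lf isT) glf1 modn_small //; clear -lfB; lia.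
  - move=> i s2 T iN _ si [h hT]; apply: wp_run; rewrite /= mod0n si; split.
      move=> v vi /=; have [//|vi'] := eqVneq v i.
      by apply: h; move/eqP: vi'; clear -vi; lia.
    by clear -hT; lia.
  - by move=> s2 T _ _ [h hT]; split=> //=; clear -hT; lia.
move=> s2 t2 k2 [h2 ht2].
have gs2 : graph_in s2 by apply: graph_in_keep k2 gs1.
have [[gn2 glf2] _ _ _] := gs2.
have [kw1 ka1 kr1 kx1] := k1; have [kw2 ka2 kr2 kx2] := k2.
have sc2 : wvar s2 v_c = c by rewrite (kw2 v_c isT) (kw1 v_c isT).
have fr0 : fresh pred0 s2.
  split=> //; first exact: tournament0.
  - by move=> v vl; rewrite /queued h2 //; clear -vl; lia.
  - by move=> v vN; rewrite /seen (ka2 a_seen isT) (ka2 a_par isT); apply: h1.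
have mask2 v : mask s2 v = mask s v by rewrite /mask (ka2 a_mask isT) (ka1 a_mask isT).
apply: (@run_seq _ _ _ _ _ (fun s3 t3 => fresh (predU1 c pred0) s3 /\ (t3 <= 50 * q + 60)%N)).
  apply: dij_source_run => //; last by rewrite mask2.
    by move=> s' _ /= ->.
  by rewrite N2; clear -cn; lia.
move=> s3 t3 k3 [fr3 ht3].
have gs3 : graph_in s3 by apply: graph_in_keep k3 gs2.
have [[gn3 glf3] _ _ _] := gs3.
have [kw3 ka3 kr3 kx3] := k3.
have mask3 v : mask s3 v = mask s v by rewrite -mask2 /mask (ka3 a_mask isT).
apply: (@run_seq _ _ _ _ _ (fun s4 t4 => fresh (predU1 (n + c)%N (predU1 c pred0)) s4 /\
    (t4 <= 50 * q + 60)%N)).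
  apply: dij_source_run => //; last by rewrite mask3.
    move=> s' /= -> ->; rewrite gn3 (kw3 v_c isT) sc2 modn_small //; clear -cn nB; lia.
  by rewrite N2; clear -cn; lia.
move=> s4 t4 k4 [[f1 f2 f3 f4] ht4].
have gs4 : graph_in s4 by apply: graph_in_keep k4 gs3.
pose src := predU1 (n + c)%N (predU1 c pred0).
apply: run_weaken.
  apply: (@dij_loop_run src s4 0%N) => //; last first.
    move=> v vN; rewrite /done; have [-> _] := f3 v vN; rewrite f2 ?andbN //.
    by apply: leq_trans Nlf.
  have nl w : (w < N)%N -> (w < lf)%N by move=> wN; apply: leq_trans Nlf.
  split=> //.
  - move=> v vl; rewrite f2 // => sv; have [vN _ _] := f4 v sv; split=> //.
    by have [->] := f3 v vN.
  - by move=> v vN; have [-> _] := f3 v vN => sv; have [] := f4 v sv.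
  - by move=> v vN; have [-> ->] := f3 v vN => sv; left.
  - move=> v vN; have [-> _] := f3 v vN => sv; rewrite f2 ?nl // sv.
    by have [_ -> _] := f4 v sv.
  - by move=> v vN sv; have [-> _] := f3 v vN; have [_ -> _] := f4 v sv.
  - move=> e eM; have [tN _] := adj_tl eM.
    by rewrite /done; have [-> _] := f3 _ tN; rewrite f2 ?nl // andbN.
move=> s5 t5 [[d [u I5]] nq ht5]; split=> //; last 2 first.
- exact: (di_pq I5).
- have ez : (20 * N + 20 + (20 * (2 * lf) + 20) + 2 * (50 * q + 60) + 50 * 0 <=
      20 * N + 20 * (2 * lf) + (50 * q + 200) * 2)%N by clear; lia.
  have e2 : ((50 * q + 120) * (N + M) + 20 * N + 20 * (2 * lf) + (50 * q + 180) * 2 <=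
      (50 * q + 200) * (N + M + 2 * lf + 2))%N.
    rewrite !mulnDl !mulnDr; clear; lia.
  clear -ez e2 ht1 ht2 ht3 ht4 ht5; lia.
have nl w : (w < N)%N -> (w < lf)%N by move=> wN; apply: leq_trans Nlf.
have dE v : (v < N)%N -> done s5 v = seen s5 v.
  by move=> vN; rewrite /done nq ?andbT // nl.
have srcE v : pred2 c (n + c)%N v = src v by rewrite /src /= !orbF orbC.
split.
- exact: (di_mask I5).
- move=> v vN sv; rewrite srcE; case: (di_par I5 vN sv) => [|[e [a1 a2 a3 a4 a5]]]; [by left|right].
  by exists e; rewrite -dE //; have [] := adj_tl a1.
- by move=> v vN; rewrite srcE; apply: (di_src I5).
- move=> e eM se me; have [tN _] := adj_tl eM.
  by case: (di_edge I5 eM _ me) => [|[]|] //; rewrite dE.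
Qed.

End Dijkstra.

(** * Walks and shortest-path certificates *)

Section Walk.
Context {R : realType}.
Variables (tl hd : nat -> nat) (wt : nat -> R).
Implicit Types A H : pred nat.

(** Walks grow at their far end, as paths recovered from parent pointers do: the last edge is the
    parent edge. *)
Inductive walk A : nat -> nat -> R -> Prop :=
| Walk0 u : walk A u u 0
| WalkS u e l : walk A u (tl e) l -> A e -> walk A u (hd e) (l + wt e).

Lemma walk_mono A H u v l : (forall e, A e -> H e) -> walk A u v l -> walk H u v l.
Proof. by move=> AH; elim=> [w|w e d _ IH Ae]; [exact: Walk0|apply: WalkS => //; apply: AH]. Qed.

Lemma walk_cat A u v w l l' : walk A u v l -> walk A v w l' -> walk A u w (l + l').
Proof.
move=> h1 h2; elim: h2 h1 => [x|x e d _ IH Ae] h1; first by rewrite addr0.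
by rewrite addrA; apply: WalkS => //; apply: IH.
Qed.

Lemma walk1 A e : A e -> walk A (tl e) (hd e) (wt e).
Proof. by move=> Ae; rewrite -[wt e]add0r; apply: WalkS => //; apply: Walk0. Qed.

(** A closed walk of length [d] through [x] and [y], not necessarily shortest; this allows reasoning
    without naming distances. *)
Definition rtw A x y d := exists d1 d2, [/\ walk A x y d1, walk A y x d2 & d = d1 + d2].

Lemma rtw_refl A x : rtw A x x 0.
Proof. by exists 0, 0; rewrite addr0; split=> //; apply: Walk0. Qed.

Lemma rtw_sym A x y d : rtw A x y d -> rtw A y x d.
Proof. by move=> [d1 [d2 [h1 h2 ->]]]; exists d2, d1; rewrite addrC. Qed.

Lemma rtw_trans A x y z d d' : rtw A x y d -> rtw A y z d' -> rtw A x z (d + d').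
Proof.
move=> [d1 [d2 [h1 h2 ->]]] [d3 [d4 [h3 h4 ->]]]; exists (d1 + d3), (d4 + d2).
split; [exact: walk_cat h1 h3|exact: walk_cat h4 h2|].
by rewrite addrACA [d2 + d4]addrC.
Qed.

Lemma rtw_mono A H x y d : (forall e, A e -> H e) -> rtw A x y d -> rtw H x y d.
Proof.
move=> AH [d1 [d2 [h1 h2 ->]]]; exists d1, d2.
by split=> //; apply: walk_mono AH _.
Qed.

End Walk.

Lemma walk_rev (R : realType) (tl hd : nat -> nat) (wt : nat -> R) A u v l :
  walk tl hd wt A u v l -> walk hd tl wt A v u l.
Proof.
elim=> [w|w e d _ IH Ae]; first exact: Walk0.
by rewrite addrC; apply: walk_cat IH; apply: walk1.
Qed.

(** * Certificates for distances from one vertex *)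

Section Cert.
Context {R : realType}.
Variables (n m : nat) (tl hd : nat -> nat) (wt : nat -> R) (W : R).
Hypothesis tlN : forall e, (e < m)%N -> (tl e < n)%N.
Hypothesis hdN : forall e, (e < m)%N -> (hd e < n)%N.
Hypothesis W1 : 1 <= W.
Hypothesis wt1 : forall e, (e < m)%N -> 1 <= wt e <= W.
Implicit Types (A H : pred nat) (U sn : nat -> bool) (ky : nat -> R).
Local Notation walk := (walk tl hd wt).

Definition inside U : pred nat := fun e => [&& (e < m)%N, U (tl e) & U (hd e)].

Lemma walk_ge0 A u v l : (forall e, A e -> (e < m)%N) -> walk A u v l -> 0 <= l.
Proof.
move=> Am; elim=> // w e d _ IH Ae; rewrite addr_ge0 //.
by have /andP[h _] := wt1 (Am _ Ae); apply: le_trans h.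
Qed.

Lemma walk_ge1 A u v l : (forall e, A e -> (e < m)%N) -> walk A u v l -> u <> v -> 1 <= l.
Proof.
move=> Am; case=> // w e d h Ae _; have /andP[h1 _] := wt1 (Am _ Ae).
by rewrite -[leLHS]add0r lerD // (walk_ge0 Am h).
Qed.

Lemma walk_split U U' x y d : walk (inside U) x y d -> U x ->
  (walk (inside U') x y d /\ U' x /\ U' y) \/
  exists z l1 l2, [/\ U z, ~~ U' z, walk (inside U) x z l1, walk (inside U) z y l2
                    & d = l1 + l2].
Proof.
elim=> [w|w e l h IH Ae] Ux.
  have [U'w|U'w] := boolP (U' w); [left|right]; first by split; [exact: Walk0|].
  by exists w, 0, 0; rewrite addr0; split=> //; apply: Walk0.
have /and3P[em Ut Uh] := Ae.
case: (IH Ux) => [[h' [U'w U't]]|[z [l1 [l2 [h1 h2 h3 h4 ->]]]]].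
  have [U'h|U'h] := boolP (U' (hd e)); [left|right].
    by split=> //; apply: WalkS => //; rewrite /inside em U't.
  by exists (hd e), (l + wt e), 0; rewrite addr0; split=> //; [apply: WalkS|apply: Walk0].
by right; exists z, l1, (l2 + wt e); split=> //; [apply: WalkS|rewrite addrA].
Qed.

(** A closed walk that meets a vertex [z] outside [U'] can be rotated to start at [z]. It is then a
    roundtrip walk between [z] and [x], and also one between [z] and [y], of the same length [d]. *)
Lemma rtw_split U U' x y d : rtw tl hd wt (inside U) x y d -> U x -> U y ->
  (rtw tl hd wt (inside U') x y d /\ U' x /\ U' y) \/
  exists z, [/\ U z, ~~ U' z, rtw tl hd wt (inside U) z x d & rtw tl hd wt (inside U) z y d].
Proof.
move=> [d1 [d2 [h1 h2 ->]]] Ux Uy.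
case: (walk_split U' h1 Ux) => [[h1' [U'x U'y]]|[z [l1 [l2 [Uz U'z w1 w2 ->]]]]].
  case: (walk_split U' h2 Uy) => [[h2' _]|[z [l1 [l2 [Uz U'z w1 w2 ->]]]]].
    by left; split=> //; exists d1, d2.
  right; exists z; split=> //.
    by exists l2, (d1 + l1); split=> //; [exact: walk_cat h1 w1|rewrite addrA addrC].
  exists (l2 + d1), l1; split=> //; first exact: walk_cat w2 h1.
  by rewrite -addrA [RHS]addrC -!addrA [l1 + l2]addrC.
right; exists z; split=> //.
  exists (l2 + d2), l1; split=> //; first exact: walk_cat w2 h2.
  by rewrite -addrA addrC.
by exists l2, (d2 + l1); split=> //; [exact: walk_cat h2 w1|rewrite [l1 + l2]addrC -addrA [l1 + d2]addrC].
Qed.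

(* [pr v e] states that [e] is the last edge of the path found from [c] to [v]. *)
Definition cert U sn ky (pr : nat -> nat -> Prop) c :=
  [/\ sn c /\ ky c = 0,
      forall v, (v < n)%N -> sn v -> U v,
      forall v, (v < n)%N -> sn v -> v = c \/
        exists e, [/\ (e < m)%N, pr v e, hd e = v, sn (tl e) & ky v = ky (tl e) + wt e]
    & forall e, (e < m)%N -> sn (tl e) -> U (hd e) ->
        sn (hd e) /\ ky (hd e) <= ky (tl e) + wt e].

Section OneCert.
Variables (U sn : nat -> bool) (ky : nat -> R) (pr : nat -> nat -> Prop) (c : nat).
Hypothesis C : cert U sn ky pr c.
Hypothesis cn : (c < n)%N.

(** The keys are a feasible potential: along a walk in [U] the key grows by at most the weight of
    each edge, and seen vertices are not left. *)
Lemma cert_lower v l : walk (inside U) c v l -> sn v /\ ky v <= l.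
Proof.
case: C => [[c1 c2] c3 c4 c5].
suff H u : walk (inside U) u v l -> u = c -> sn v /\ ky v <= l by move=> h; apply: H h erefl.
elim=> [w ->|w e d _ IH /and3P[em Ut Uh] wc]; first by rewrite c2.
have [st kt] := IH wc.
by have [sh kh] := c5 e em st Uh; split=> //; apply: le_trans kh _; rewrite lerD2r.
Qed.

(** The rank [f v], the number of seen vertices with smaller key, drops strictly from a vertex to
    its parent, while each tree edge costs at most [W]. *)
Lemma cert_bound v : (v < n)%N -> sn v -> 0 <= ky v <= W * n%:R.
Proof.
case: C => [[c1 c2] c3 c4 c5] vn sv.
pose f v := (\sum_(w < n) (sn w && (ky w < ky v)%R : nat))%N.
suff H N : forall v, (f v < N)%N -> (v < n)%N -> sn v -> 0 <= ky v <= W * (f v)%:R.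
  have /andP[-> /= h] := H _ v (ltnSn _) vn sv.
  apply: le_trans h _; rewrite ler_pM2l ?(lt_le_trans ltr01) // ler_nat.
  by rewrite -[leqRHS]card_ord -sum1_card; apply: leq_sum => i _; case: (_ && _).
elim: N => // N IH {vn sv}v vN vn sv.
case: (c4 v vn sv) => [->|[e [em _ he st kv]]].
  by rewrite c2 lexx mulr_ge0 // (le_trans ler01).
have /andP[w1 w2] := wt1 em.
have tv : ky (tl e) < ky v by rewrite kv ltrDl (lt_le_trans ltr01).
have lf : (f (tl e) < f v)%N.
  rewrite /f (bigD1 (Ordinal (tlN em))) //= [X in (_ < X)%N](bigD1 (Ordinal (tlN em))) //=.
  rewrite st tv ltxx /= add0n add1n ltnS; apply: leq_sum => i _.
  by case: (sn i) => //=; case: (ltrP (ky i) (ky (tl e))) => // h; rewrite (lt_trans h tv).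
have /andP[k1 k2] := IH (tl e) (leq_trans lf vN) (tlN em) st.
rewrite kv; apply/andP; split; first by rewrite addr_ge0 // (le_trans ler01).
apply: (@le_trans _ _ (W * (f (tl e)).+1%:R)).
  by rewrite -addn1 natrD mulrDr mulr1 lerD.
by rewrite ler_pM2l ?(lt_le_trans ltr01) // ler_nat.
Qed.

(** Weights are at least 1, so a key falls by at least 1 at each parent step, and a natural number
    above the key serves for the induction. [P] confines the argument to a set closed under parents,
    such as a roundtrip ball. *)
Lemma cert_tree (P : nat -> bool) H v :
  (forall v e, (v < n)%N -> P v -> sn v -> (e < m)%N -> pr v e -> hd e = v -> sn (tl e) ->
     ky v = ky (tl e) + wt e -> H e /\ P (tl e)) ->
  (v < n)%N -> P v -> sn v -> walk H c v (ky v).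
Proof.
move=> hP; case: C => [[c1 c2] c3 c4 c5].
suff S N : forall v, ky v < N%:R -> (v < n)%N -> P v -> sn v -> walk H c v (ky v).
  move=> vn Pv sv; apply: (S (Num.bound (ky v))) => //; apply: archi_boundP.
  by have /andP[] := cert_bound vn sv.
elim: N => [|N IH] {}v kN vn Pv sv.
  by have /andP[k0 _] := cert_bound vn sv; move: kN; rewrite ltNge k0.
case: (c4 v vn sv) => [->|[e [em pe he st kv]]]; first by rewrite c2; exact: Walk0.
have [He Pt] := hP v e vn Pv sv em pe he st kv.
have /andP[w1 _] := wt1 em.
rewrite kv -he; apply: WalkS => //; apply: IH => //; last exact: tlN.
by move: kN; rewrite kv -addn1 natrD => h; rewrite -(ltrD2r 1); apply: le_lt_trans h; rewrite lerD2l.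
Qed.

Lemma cert_walk v : (v < n)%N -> sn v -> walk (inside U) c v (ky v).
Proof.
move=> vn sv; apply: (@cert_tree xpredT) => // u e un _ su em _ he st _.
case: C => _ c3 _ _; by rewrite /inside em he !c3 ?tlN.
Qed.

End OneCert.

End Cert.

(** * Roundtrip distances from a pair of certificates *)

Section BiCert.
Context {R : realType}.
Variables (n m : nat) (tl hd : nat -> nat) (wt : nat -> R) (W : R).
Hypothesis tlN : forall e, (e < m)%N -> (tl e < n)%N.
Hypothesis hdN : forall e, (e < m)%N -> (hd e < n)%N.
Hypothesis W1 : 1 <= W.
Hypothesis wt1 : forall e, (e < m)%N -> 1 <= wt e <= W.
Implicit Types (H : pred nat) (U sn : nat -> bool) (ky : nat -> R).
Local Notation walkG := (walk tl hd wt).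
Local Notation rtwG := (rtw tl hd wt).
Local Notation insideG := (inside m tl hd).

(** Distances to [c] are distances from [c] in the reversed graph, so the second half merely
    exchanges [tl] and [hd]. *)
Record bicert U (sn sb : nat -> bool) (ky kb : nat -> R) (pr pb : nat -> nat -> Prop) c := BiCert {
  bc_fwd : cert n m tl hd wt U sn ky pr c;
  bc_bwd : cert n m hd tl wt U sb kb pb c
}.

Variables (U sn sb : nat -> bool) (ky kb : nat -> R) (pr pb : nat -> nat -> Prop) (c : nat).
Hypothesis C : bicert U sn sb ky kb pr pb c.
Hypothesis cn : (c < n)%N.

Definition rsn v := sn v && sb v.
Definition rt v := ky v + kb v.

Lemma inside_rev e : inside m hd tl U e = insideG U e.
Proof. by rewrite /inside andbCA [U _ && U _]andbC andbCA. Qed.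

Lemma rt_lower x d : rtwG (insideG U) c x d -> rsn x /\ rt x <= d.
Proof.
move=> [d1 [d2 [h1 h2 ->]]]; have [s1 k1] := cert_lower (bc_fwd C) h1.
have h3 : walk hd tl wt (inside m hd tl U) c x d2.
  by apply: (@walk_mono _ _ _ _ (insideG U)); [move=> e; rewrite inside_rev|exact: walk_rev].
have [s2 k2] := cert_lower (bc_bwd C) h3.
by rewrite /rsn s1 s2 lerD.
Qed.

Lemma rt_walk x : (x < n)%N -> rsn x -> rtwG (insideG U) c x (rt x).
Proof.
move=> xn /andP[s1 s2]; exists (ky x), (kb x); split=> //.
  exact: (cert_walk tlN W1 wt1 (bc_fwd C)).
apply: walk_rev; apply: (@walk_mono _ _ _ _ (inside m hd tl U)).
  by move=> e; rewrite inside_rev.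
exact: (cert_walk hdN W1 wt1 (bc_bwd C)).
Qed.

Lemma rt_bound x : (x < n)%N -> rsn x -> 0 <= rt x <= 2 * (W * n%:R).
Proof.
move=> xn /andP[s1 s2]; have /andP[a b] := cert_bound tlN W1 wt1 (bc_fwd C) xn s1.
have /andP[a' b'] := cert_bound hdN W1 wt1 (bc_bwd C) xn s2.
by rewrite addr_ge0 //= mulr_natl mulr2n lerD.
Qed.

Lemma rt_triangle z x d : (z < n)%N -> rsn z -> rtwG (insideG U) z x d ->
  rsn x /\ rt x <= rt z + d.
Proof. by move=> zn sz h; apply: rt_lower; apply: rtw_trans h; apply: rt_walk. Qed.

Lemma rt_tree H x :
  (forall v e, (v < n)%N -> sn v -> (e < m)%N -> pr v e -> H e) ->
  (forall v e, (v < n)%N -> sb v -> (e < m)%N -> pb v e -> H e) ->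
  (x < n)%N -> rsn x -> rtwG H c x (rt x).
Proof.
move=> h1 h2 xn /andP[s1 s2]; exists (ky x), (kb x); split=> //.
  apply: (cert_tree tlN W1 wt1 (bc_fwd C) (P := xpredT)) => // v e vn _ sv em pe _ _ _.
  by split=> //; apply: h1 pe.
apply: walk_rev; apply: (cert_tree hdN W1 wt1 (bc_bwd C) (P := xpredT)) => //.
by move=> v e vn _ sv em pe _ _ _; split=> //; apply: h2 pe.
Qed.

(* Roundtrip balls are closed under shortest paths: the shortest closed walk
   through [c] and [v] consists of vertices at roundtrip distance at most
   [rt v] from [c]. *)
Lemma rt_ball_tree H r x :
  (forall v e, (v < n)%N -> rsn v -> rt v < r -> (e < m)%N -> pr v e \/ pb v e -> H e) ->
  (x < n)%N -> rsn x -> rt x < r -> rtwG H c x (rt x).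
Proof.
move=> hH xn sx rx; have /andP[s1 s2] := sx; exists (ky x), (kb x).
have [_ mf _ ef] := bc_fwd C; have [_ mb _ eb] := bc_bwd C.
have P v := rsn v && (rt v < r).
split=> //.
  apply: (cert_tree tlN W1 wt1 (bc_fwd C) (P := fun v => rsn v && (rt v < r))) => //;
    last by rewrite sx.
  move=> v e vn /andP[sv rv] _ em pe he st kv; split.
    by apply: (hH v) => //; left.
  have /andP[sv1 sv2] := sv.
  have [sb1 kb1] : sb (tl e) /\ kb (tl e) <= kb v + wt e.
    by rewrite -he; apply: eb; rewrite // ?he // mf ?tlN.
  rewrite /rsn st sb1 /=; apply: le_lt_trans rv.
  by rewrite /rt kv -addrA lerD2l addrC.
apply: walk_rev.
apply: (cert_tree hdN W1 wt1 (bc_bwd C) (P := fun v => rsn v && (rt v < r))) => //;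
  last by rewrite sx.
move=> v e vn /andP[sv rv] _ em pe he st kv; split.
  by apply: (hH v) => //; right.
have /andP[sv1 sv2] := sv.
have [sn1 kn1] : sn (hd e) /\ ky (hd e) <= ky v + wt e.
  by rewrite -he; apply: ef; rewrite // ?he // mb ?hdN.
rewrite /rsn st sn1 /=; apply: le_lt_trans rv.
by rewrite /rt kv addrA addrAC lerD2r.
Qed.

(* Both [x] and [y] are near [c] as soon as their closed walk meets a vertex of
   the removed inner ball. *)
Lemma rt_remove H U' r s x y d :
  (forall v e, (v < n)%N -> rsn v -> rt v < r + s -> (e < m)%N -> pr v e \/ pb v e -> H e) ->
  (forall v, (v < n)%N -> U v -> ~~ U' v -> rsn v /\ rt v <= r) ->
  (forall v, U v -> (v < n)%N) ->
  rtwG (insideG U) x y d -> U x -> U y -> d < s ->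
  (rtwG (insideG U') x y d /\ U' x /\ U' y) \/
  exists2 d', rtwG H x y d' & d' <= 2 * (r + d).
Proof.
move=> hH hU' hU w Ux Uy ds; case: (rtw_split U' w Ux Uy) => [h|[z [Uz U'z wx wy]]]; [by left|right].
have zn := hU _ Uz.
have [sz rz] := hU' z zn Uz U'z.
have [sx rx] := rt_triangle zn sz wx.
have [sy ry] := rt_triangle zn sz wy.
have bx : rt x < r + s by apply: le_lt_trans rx _; apply: ler_ltD.
have by' : rt y < r + s by apply: le_lt_trans ry _; apply: ler_ltD.
exists (rt x + rt y).
  apply: rtw_trans (rt_ball_tree hH _ sy by'); last exact: hU.
  by apply: rtw_sym; apply: rt_ball_tree hH _ sx bx; apply: hU.
by rewrite mulr_natl mulr2n lerD // (le_trans rx _, le_trans ry _) // lerD2r.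
Qed.

End BiCert.

(** * The doubled graph *)

Section Doubled.
Context {R : realType}.
Variables (n m : nat) (tl hd : nat -> nat) (wt : nat -> R).

(* A copy of the graph and, on the vertices [n + v] and with the edges [m + e],
   a copy of the reversed graph: the distances from [c] and to [c] are those
   from [c] and from [n + c] here. *)
Definition tl2 e := if (e < m)%N then tl e else (n + hd (e - m))%N.
Definition hd2 e := if (e < m)%N then hd e else (n + tl (e - m))%N.
Definition wt2 e := if (e < m)%N then wt e else wt (e - m).

(** Vertices touching no edge take part in no roundtrip between distinct vertices. Skipping them
    leaves at most [2 * m] centres, so that work of order n for each centre stays within order nm
    even if m < n. *)
Definition active v := has (fun e => (tl e == v) || (hd e == v)) (iota 0 m).

End Doubled.

(** The facts established by [setup]. [2 ^ q] is the number of leaves of the queue, [cx_tk] limits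
    how often a ball can grow by the factor [t], and [cx_tmin] keeps [t] below [2 n^(1/k)]. *)
Record ctx (R : realType) (n m k t q B : nat) (tl hd : nat -> nat) (wt : nat -> R) (W : R)
    (adj : nat -> seq nat) : Prop := Ctx {
  cx_n : (1 < n)%N;
  cx_m : (0 < m)%N;
  cx_k : (0 < k)%N;
  cx_tl : forall e, (e < m)%N -> (tl e < n)%N;
  cx_hd : forall e, (e < m)%N -> (hd e < n)%N;
  cx_W : 1 <= W;
  cx_wt : forall e, (e < m)%N -> 1 <= wt e <= W;
  cx_B : ((n + m + k + 2) ^ 3 <= B)%N;
  cx_lf : (2 * n <= 2 ^ q <= 4 * n)%N;
  cx_adj : forall u e, (e \in adj u) = (e < 2 * m)%N && (tl2 n m tl hd e == u);
  cx_uniq : forall u, uniq (adj u);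
  cx_t : (1 < t <= n)%N;
  cx_tk : (n <= t ^ k)%N;
  cx_tmin : t = 2 \/ (t.-1 ^ k < n)%N
}.

Lemma sum_eq_pred n v : (\sum_(i < n) (v == i :> nat) <= 1)%N.
Proof.
have [vn|vn] := ltnP v n.
  rewrite (bigD1 (Ordinal vn)) //= eqxx big1 // => i.
  by case: (eqVneq v (val i)) => // e /eqP[]; apply: val_inj.
by rewrite big1 // => i _; case: eqP => // e; move: vn; rewrite e leqNgt ltn_ord.
Qed.

(** * Dijkstra on the doubled graph yields both certificates *)

Section Ctx.
Context {R : realType}.
Variables (n m k t q B : nat) (tl hd : nat -> nat) (wt : nat -> R) (W : R).
Variable adj : nat -> seq nat.
Hypothesis cx : ctx n m k t q B tl hd wt W adj.
Local Notation tlD := (tl2 n m tl hd).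
Local Notation hdD := (hd2 n m tl hd).
Local Notation wtD := (wt2 m wt).
Implicit Types s : state R.

(** Word arithmetic never wraps around: indices into the [n] by [n] table and products such as
    [c * t] with both factors at most [n] remain below [B]. *)
Lemma cx_bounds : [/\ (2 * 2 ^ q + 2 < B)%N, (2 * m + 2 < B)%N, (k + 2 < B)%N,
  (n * n + n < B)%N & (8 < B)%N].
Proof.
have [h0 h1 h2 h3] := And4 (cx_n cx) (cx_m cx) (cx_k cx) (cx_lf cx).
have := cx_B cx; rewrite !expnS expn0 muln1; set x := (n + m + k + 2)%N => h.
have hx : (n + m + k + 2 = x)%N by [].
have x5 : (5 < x)%N by lia.
have : (5 * x <= x * x)%N by rewrite leq_mul2r; lia.
have : (6 * (x * x) <= x * (x * x))%N by rewrite leq_mul2r; lia.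
have : (n * n <= x * x)%N by apply: leq_mul; lia.
move: (2 ^ q)%N h3 => lf h3 *.
split; lia.
Qed.

Lemma cx_tl2 e : (e < 2 * m)%N -> (tlD e < 2 * n)%N.
Proof.
rewrite /tl2; case: ifP => h eM; first by have := cx_tl cx h; lia.
have : (e - m < m)%N by lia.
by move/(cx_hd cx); lia.
Qed.

Lemma cx_hd2 e : (e < 2 * m)%N -> (hdD e < 2 * n)%N.
Proof.
rewrite /hd2; case: ifP => h eM; first by have := cx_hd cx h; lia.
have : (e - m < m)%N by lia.
by move/(cx_tl cx); lia.
Qed.

Lemma cx_wt2 e : (e < 2 * m)%N -> 1 <= wtD e.
Proof.
rewrite /wt2; case: ifP => h eM; first by have /andP[] := cx_wt cx h.
have : (e - m < m)%N by lia.
by move/(cx_wt cx) => /andP[].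
Qed.

Lemma cx_adj_sum : (\sum_(v < 2 * n) size (adj v) <= 2 * m)%N.
Proof.
apply: (@leq_trans (\sum_(v < 2 * n) \sum_(e < 2 * m) (tlD e == v))%N).
  apply: leq_sum => v _.
  have sz : (size (adj v) <= size [seq e <- iota 0 (2 * m) | tlD e == v])%N.
    apply: uniq_leq_size (cx_uniq cx v) _ => e; rewrite (cx_adj cx) => /andP[h1 h2].
    by rewrite mem_filter h2 mem_iota.
  apply: leq_trans sz _; rewrite size_filter -sum1_count big_mkcond /=.
  have -> : iota 0 (2 * m) = index_iota 0 (2 * m) by rewrite /index_iota subn0.
  rewrite big_mkord.
  by apply: leq_sum => i _; case: eqP.
rewrite exchange_big /=; apply: (@leq_trans (\sum_(e < 2 * m) 1)%N).
  by apply: leq_sum => e _; apply: sum_eq_pred.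
by rewrite sum1_card card_ord.
Qed.

Lemma active_sum : (\sum_(v < n) active m tl hd v <= 2 * m)%N.
Proof.
apply: (@leq_trans (\sum_(v < n) \sum_(e < m) ((tl e == v) + (hd e == v)))%N).
  apply: leq_sum => v _; case: (boolP (active _ _ _ _)) => // /hasP[e].
  rewrite mem_iota /= add0n => em h; rewrite (bigD1 (Ordinal em)) //=.
  by move: h; case: eqP; case: eqP.
rewrite exchange_big /=; apply: (@leq_trans (\sum_(e < m) 2)%N).
  apply: leq_sum => e _; rewrite big_split /= -[2%N]/(1 + 1)%N leq_add //;
  exact: sum_eq_pred.
by rewrite sum_nat_const card_ord mulnC.
Qed.

Definition env s :=
  [/\ graph_in q n (2 * n) (2 * m) hdD wtD adj s /\ wvar s v_t = t,
      wvar s v_m = m /\ wvar s v_k = k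
    & forall v, (v < n)%N -> (warr s a_act v != 0%N) = active m tl hd v].

Lemma env_keep c s s' :
  [&& v_n \notin wmod c, v_m \notin wmod c, v_k \notin wmod c, v_lf \notin wmod c,
      v_t \notin wmod c, a_hd2 \notin amod c, a_nx \notin amod c,
      a_first \notin amod c, a_act \notin amod c & x_wt2 \notin ramod c] ->
  keep c s s' -> env s -> env s'.
Proof.
case/and5P=> h1 h2 h3 h4 /and5P[h5 h6 h7 h8 /andP[h9 h10]] [kw ka kr kx].
by rewrite /env /graph_in !kw // (ka _ h6) (ka _ h7) (ka _ h8) (ka _ h9) (kx _ h10).
Qed.

Definition sn_ s v := seen s v.
Definition sb_ s v := seen s (n + v)%N.
Definition ky_ s v := rarr s x_key v.
Definition kb_ s v := rarr s x_key (n + v)%N.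
Definition pr_ s v e := warr s a_par v = e.+1.
Definition pb_ s v e := warr s a_par (n + v)%N = (m + e).+1.

Definition dij_time := ((50 * q + 200) * (2 * n + 2 * m + 2 * 2 ^ q + 2))%N.

Definition dij_post (U : nat -> bool) c s :=
  [/\ bicert n m tl hd wt U (sn_ s) (sb_ s) (ky_ s) (kb_ s) (pr_ s) (pb_ s) c,
      pq_ok q s & forall v, (v < 2 ^ q)%N -> ~~ queued q s v].

(** No edge joins the two copies, so a single run from [c] and [n + c] treats both directions. A
    parent edge is numbered below [m] exactly when its head lies in the first copy, which separates
    the two families of parents. *)
Lemma dij_correct s c (U : nat -> bool) :
  env s -> wvar s v_c = c -> (c < n)%N -> U c ->
  (forall v, (v < n)%N -> mask s v = U v /\ mask s (n + v)%N = U v) ->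
  run B dij s (fun s' t => dij_post U c s' /\ (t <= dij_time)%N).
Proof.
move=> [[gs _] _ _] sc cn Uc hU.
have [b1 b2 b3 b4 b5] := cx_bounds.
have /andP[l1 l2] := cx_lf cx.
have [mc mc'] := hU c cn.
apply: run_weaken.
  apply: run_keep.
  apply: (@dij_run _ q B n (2 * n) (2 * m) tlD hdD wtD adj b1 erefl l1
    cx_hd2 cx_wt2 _ _ cx_adj_sum (cx_uniq cx) s c) => //.
  - by move=> u e; rewrite (cx_adj cx) => /andP[h /eqP].
  - by move=> e eM; rewrite (cx_adj cx) eM eqxx cx_tl2.
  - exact: cx_n cx.
  - by clear -l1 b1; lia.
  - by rewrite mc.
  - by rewrite mc'.
move=> s' T [[[h1 h2 h3 h4] pq nq hT] [kw ka kr kx]]; split=> //.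
have mk v : mask s' v = mask s v by rewrite /mask (ka a_mask isT).
split=> //.
have tn e : (e < m)%N -> (tl e < n)%N by apply: (cx_tl cx).
have hn e : (e < m)%N -> (hd e < n)%N by apply: (cx_hd cx).
have n2 v : (v < n)%N -> (v < 2 * n)%N by clear; lia.
have n2' v : (v < n)%N -> (n + v < 2 * n)%N by clear; lia.
have m2 e : (e < m)%N -> (e < 2 * m)%N by clear; lia.
have m2' e : (e < m)%N -> (m + e < 2 * m)%N by clear; lia.
have tl2a e : (e < m)%N -> tlD e = tl e by move=> h; rewrite /tl2 h.
have hd2a e : (e < m)%N -> hdD e = hd e by move=> h; rewrite /hd2 h.
have wt2a e : (e < m)%N -> wtD e = wt e by move=> h; rewrite /wt2 h.
have ge e : (m + e < m)%N = false by clear; lia.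
have tl2b e : tlD (m + e) = (n + hd e)%N by rewrite /tl2 ge addKn.
have hd2b e : hdD (m + e) = (n + tl e)%N by rewrite /hd2 ge addKn.
have wt2b e : wtD (m + e) = wt e by rewrite /wt2 ge addKn.
split; split.
- by apply: h3; [apply: n2|rewrite /= eqxx].
- by move=> v vn sv; have := h1 v (n2 v vn) sv; rewrite mk; have [-> _] := hU v vn.
- move=> v vn sv; case: (h2 v (n2 v vn) sv) => [[/orP[/eqP ->|/eqP e] _]|[e [e1 e2 e3 e4 e5]]].
  + by left.
  + by exfalso; clear -vn e; lia.
  + right; have em : (e < m)%N.
      by rewrite ltnNge; apply/negP => me; move: e3; rewrite /hd2 ltnNge me /=; clear -vn; lia.
    by exists e; rewrite /pr_ /ky_ /sn_; move: e3 e4 e5; rewrite hd2a // tl2a // wt2a.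
- move=> e em se Ue.
  have := h4 e (m2 e em); rewrite tl2a // hd2a // wt2a // mk; have [-> _] := hU _ (hn e em).
  exact.
- by apply: h3; [apply: n2'|rewrite /= eqxx orbT].
- by move=> v vn sv; have := h1 _ (n2' v vn) sv; rewrite mk; have [_ ->] := hU v vn.
- move=> v vn sv; case: (h2 _ (n2' v vn) sv) => [[/orP[/eqP e|/eqP e] _]|[e [e1 e2 e3 e4 e5]]].
  + by exfalso; clear -cn e; lia.
  + by left; clear -e; lia.
  + have em : (m <= e)%N.
      rewrite leqNgt; apply/negP => me; move: e3; rewrite hd2a //.
      by have := hn e me; clear; lia.
    have [e' ee] : exists e', e = (m + e')%N by exists (e - m)%N; rewrite subnKC.
    right; rewrite ee in e1 e2 e3 e4 e5.
    exists e'; rewrite /pb_ /kb_ /sb_; move: e3 e4 e5; rewrite hd2b tl2b wt2b => e3 e4 e5.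
    by split=> //; [clear -e1; lia|clear -e3; lia].
- move=> e em se Ue.
  have := h4 _ (m2' e em); rewrite tl2b // hd2b // wt2b // mk; have [_ ->] := hU _ (tn e em).
  exact.
Qed.

End Ctx.

(** * Preprocessing: the doubled graph, the queue size and the parameter [t] *)

Definition setup_graph :=
  For v_z (V v_m) (
    WPut a_hd2 (V v_z) (G a_hd (V v_z)) ;;
    RPut x_wt2 (V v_z) (RGet x_wt (V v_z)) ;;
    WPut a_nx (V v_z) (G a_first (G a_tl (V v_z))) ;;
    WPut a_first (G a_tl (V v_z)) (WAdd (V v_z) (K 1)) ;;
    WPut a_act (G a_tl (V v_z)) (K 1) ;;
    WPut a_act (G a_hd (V v_z)) (K 1) ;;
    WPut a_hd2 (WAdd (V v_m) (V v_z)) (WAdd (V v_n) (G a_tl (V v_z))) ;;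
    RPut x_wt2 (WAdd (V v_m) (V v_z)) (RGet x_wt (V v_z)) ;;
    WPut a_nx (WAdd (V v_m) (V v_z)) (G a_first (WAdd (V v_n) (G a_hd (V v_z)))) ;;
    WPut a_first (WAdd (V v_n) (G a_hd (V v_z)))
      (WAdd (WAdd (V v_m) (V v_z)) (K 1))).

Definition setup_lf :=
  WSet v_lf (K 1) ;;
  While (Lt (V v_lf) (WMul (K 2) (V v_n))) (WSet v_lf (WMul (K 2) (V v_lf))).

Definition setup_pow :=
  While (BAnd (Lt (V v_j) (V v_k)) (Lt (V v_p) (V v_n)))
    (WSet v_p (WMul (V v_p) (V v_t)) ;; WSet v_j (WAdd (V v_j) (K 1))).

(* The least [t >= 2] with [t ^ k >= n]; the powers are cut off at [n]. *)
Definition setup_t :=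
  (WSet v_t (K 1) ;; WSet v_p (K 0)) ;;
  While (Lt (V v_p) (V v_n)) (
    (WSet v_t (WAdd (V v_t) (K 1)) ;; WSet v_p (K 1) ;; WSet v_j (K 0)) ;;
    setup_pow).

Definition setup := setup_graph ;; setup_lf ;; setup_t.

Section Setup.
Context {R : realType}.
Variables (n m k B : nat) (tl hd : nat -> nat) (wt : nat -> R) (W : R).
Hypothesis n1 : (1 < n)%N.
Hypothesis m0 : (0 < m)%N.
Hypothesis k0 : (0 < k)%N.
Hypothesis tlN : forall e, (e < m)%N -> (tl e < n)%N.
Hypothesis hdN : forall e, (e < m)%N -> (hd e < n)%N.
Hypothesis W1 : 1 <= W.
Hypothesis wt1 : forall e, (e < m)%N -> 1 <= wt e <= W.
Hypothesis HB : ((n + m + k + 2) ^ 3 <= B)%N.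
Local Notation tlD := (tl2 n m tl hd).
Local Notation hdD := (hd2 n m tl hd).
Local Notation wtD := (wt2 m wt).
Implicit Types s : state R.

Lemma setup_bounds : [/\ (8 * n + 8 < B)%N, (2 * m + 2 < B)%N, (k + 2 < B)%N & (n * n + n < B)%N].
Proof.
have := HB; rewrite !expnS expn0 muln1; set x := (n + m + k + 2)%N => h.
have hx : (n + m + k + 2 = x)%N by [].
have x5 : (5 < x)%N by lia.
have : (5 * x <= x * x)%N by rewrite leq_mul2r; lia.
have : (6 * (x * x) <= x * (x * x))%N by rewrite leq_mul2r; lia.
have : (n * n <= x * x)%N by apply: leq_mul; lia.
move=> *; split; lia.
Qed.

Definition adjacency (S : pred nat) (nx first : nat -> nat) :=
  forall u, exists l, [/\ chain nx (first u) l, uniq l &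
    forall e, (e \in l) = S e && (tlD e == u)].

Lemma chain_upd nx e x p l : e \notin l -> chain nx p l -> chain (upd nx e x) p l.
Proof.
elim: l p => //= f l IH p; rewrite inE negb_or => /andP[ef el] [-> h]; split=> //.
by rewrite eq_sym (negbTE ef); apply: IH.
Qed.

Lemma adjacency_insert (S : pred nat) nx first e : ~~ S e -> adjacency S nx first ->
  adjacency (predU1 e S) (upd nx e (first (tlD e))) (upd first (tlD e) e.+1).
Proof.
move=> nSe h u; have [l [h1 h2 h3]] := h u.
have el : e \notin l by rewrite h3 (negbTE nSe).
have hc := chain_upd (first (tlD e)) el h1.
have [ue|ue] := eqVneq u (tlD e).
  exists (e :: l); split.
  - by rewrite ue in hc *; split; rewrite /= eqxx.
  - by rewrite /= el.
  - move=> f; rewrite inE h3 /=; have [->|fe] //= := eqVneq f e.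
    by rewrite ue eqxx.
exists l; split=> // [|f]; first by rewrite /= (negbTE ue).
rewrite h3 /=; have [->|fe] //= := eqVneq f e.
by rewrite (negbTE nSe) eq_sym (negbTE ue).
Qed.

Lemma adjacency_eq S S' nx first : S =1 S' -> adjacency S nx first -> adjacency S' nx first.
Proof.
move=> e h u; have [l [h1 h2 h3]] := h u; exists l; split=> // f.
by rewrite h3 e.
Qed.

Definition input_ok s :=
  [/\ [/\ wvar s v_n = n, wvar s v_m = m & wvar s v_k = k],
      forall e, (e < m)%N -> warr s a_tl e = tl e,
      forall e, (e < m)%N -> warr s a_hd e = hd e,
      forall e, (e < m)%N -> rarr s x_wt e = wt e
    & forall a i, (2 <= a)%N -> warr s a i = 0%N].

Lemma setup_graph_run s : input_ok s ->
  run B setup_graph s (fun s' T =>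
    [/\ adjacency (fun e => (e < 2 * m)%N) (warr s' a_nx) (warr s' a_first),
        forall e, (e < 2 * m)%N -> warr s' a_hd2 e = hdD e,
        forall e, (e < 2 * m)%N -> rarr s' x_wt2 e = wtD e,
        forall v, (warr s' a_act v != 0%N) = active m tl hd v
      & (T <= 150 * m + 20)%N]).
Proof.
move=> [[sn sm sk] stl shd swt sz].
have [b1 b2 b3 b4] := setup_bounds.
have mod1 : (1 %% B = 1)%N by rewrite modn_small //; clear -b1; lia.
(* The edges inserted after [i] rounds: each round adds an edge and its reversed copy. *)
pose S i e := ((e < i) || (m <= e < m + i))%N.
pose I i (s' : state R) T :=
  [/\ adjacency (S i) (warr s' a_nx) (warr s' a_first),
      forall e, (e < i)%N -> warr s' a_hd2 e = hdD e /\ warr s' a_hd2 (m + e)%N = hdD (m + e),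
      forall e, (e < i)%N -> rarr s' x_wt2 e = wtD e /\ rarr s' x_wt2 (m + e)%N = wtD (m + e),
      forall v, (warr s' a_act v != 0%N) = has (fun e => (tl e == v) || (hd e == v)) (iota 0 i)
    & (T <= 150 * i)%N].
have half e : (e < 2 * m)%N -> (e < m)%N \/ exists2 e', (e' < m)%N & e = (m + e')%N.
  move=> e2; have [em|em] := ltnP e m; [by left|right; exists (e - m)%N].
    by clear -e2 em; lia.
  by rewrite subnKC.
apply: (@run_for _ _ _ _ _ _ m I).
- by clear -b2; lia.
- by clear -b1; lia.
- by [].
- by move=> i s' [kw _ _ _] _ _ /=; rewrite (kw v_m isT).
- split=> //= [u|v]; last by rewrite sz.
  by exists [::]; rewrite /= !sz; split=> // e; rewrite in_nil /S; case: (tlD e == u); rewrite ?andbF // andbT; clear; lia.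
- move=> i s1 T im [kw ka kr kx] si [h1 h2 h3 h4 hT].
  have em : (i < m)%N by [].
  have ti := tlN em; have hi := hdN em.
  have t1 : warr s1 a_tl i = tl i by rewrite (ka a_tl isT) stl.
  have t2 : warr s1 a_hd i = hd i by rewrite (ka a_hd isT) shd.
  have t3 : rarr s1 x_wt i = wt i by rewrite (kx x_wt isT) swt.
  have t4 : wvar s1 v_n = n by rewrite (kw v_n isT).
  have t5 : wvar s1 v_m = m by rewrite (kw v_m isT).
  have mod2 : ((i + 1) %% B = i.+1)%N by rewrite addn1 modn_small //; clear -im b2; lia.
  have mod3 : ((m + i) %% B = m + i)%N by rewrite modn_small //; clear -im b2; lia.
  have mod4 : ((m + i + 1) %% B = (m + i).+1)%N by rewrite addn1 modn_small //; clear -im b2; lia.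
  have mod5 : ((n + tl i) %% B = n + tl i)%N by rewrite modn_small //; clear -ti b1; lia.
  have mod6 : ((n + hd i) %% B = n + hd i)%N by rewrite modn_small //; clear -hi b1; lia.
  have ta : tlD i = tl i by rewrite /tl2 im.
  have ha : hdD i = hd i by rewrite /hd2 im.
  have wa : wtD i = wt i by rewrite /wt2 im.
  have tb : tlD (m + i) = (n + hd i)%N by rewrite /tl2 ltnNge leq_addr addKn.
  have hb : hdD (m + i) = (n + tl i)%N by rewrite /hd2 ltnNge leq_addr addKn.
  have wb : wtD (m + i) = wt i by rewrite /wt2 ltnNge leq_addr addKn.
  apply: wp_run; rewrite /= !si !t1 !t2 !t3 !t4 !t5 !mod1 !mod2 !mod3 !mod4 !mod5 !mod6.
  have nsi : ~~ S i i by rewrite /S ltnn /= negb_and -ltnNge im.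
  have nsm : ~~ predU1 i (S i) (m + i)%N.
    by rewrite /= /S ltnn !andbF orbF negb_or -leqNgt leq_addl andbT; apply/eqP; clear -im m0; lia.
  have A := adjacency_insert nsm (adjacency_insert nsi h1).
  rewrite ta tb in A.
  split.
  + apply: adjacency_eq A => e.
    by rewrite /= /S; apply/idP/idP; clear -im; lia.
  + move=> e ei; have [->|ne] := eqVneq e i.
      rewrite /= !eqxx ha hb; case: eqP => // h; exfalso; clear -h m0; lia.
    rewrite /= eqn_add2l (negbTE ne).
    have [a1 a2] : warr s1 a_hd2 e = hdD e /\ warr s1 a_hd2 (m + e)%N = hdD (m + e).
      by apply: h2; move/eqP: ne => ne; clear -ei ne; lia.
    rewrite !ifF ?a1 ?a2 //; apply/eqP; move/eqP: ne => ne; clear -ei ne im; lia.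
  + move=> e ei; have [->|ne] := eqVneq e i.
      rewrite /= !eqxx wa wb; case: eqP => // h; exfalso; clear -h m0; lia.
    rewrite /= eqn_add2l (negbTE ne).
    have [a1 a2] : rarr s1 x_wt2 e = wtD e /\ rarr s1 x_wt2 (m + e)%N = wtD (m + e).
      by apply: h3; move/eqP: ne => ne; clear -ei ne; lia.
    rewrite !ifF ?a1 ?a2 //; apply/eqP; move/eqP: ne => ne; clear -ei ne im; lia.
  + move=> v; rewrite -[i.+1]addn1 iotaD has_cat /= add0n orbF -h4 [tl i == v]eq_sym.
    rewrite [hd i == v]eq_sym.
    by case: (v == hd i); case: (v == tl i); rewrite ?orbT ?orbF.
  + by clear -hT; lia.
- move=> s1 T _ _ [h1 h2 h3 h4 hT]; split=> //.
  + by apply: adjacency_eq h1 => e; rewrite /S; clear; lia.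
  + by move=> e /half[em|[e' em ->]]; have [] := h2 _ em.
  + by move=> e /half[em|[e' em ->]]; have [] := h3 _ em.
  + by move: hT => /=; clear; lia.
Qed.

Lemma setup_lf_run s : wvar s v_n = n ->
  run B setup_lf s (fun s' T => exists q,
    [/\ wvar s' v_lf = (2 ^ q)%N, (2 * n <= 2 ^ q <= 4 * n)%N & (T <= 20 * q + 20)%N]).
Proof.
move=> sn; have [b1 b2 b3 b4] := setup_bounds.
have mod1 : (1 %% B = 1)%N by rewrite modn_small //; clear -b1; lia.
have mod2 : (2 %% B = 2)%N by rewrite modn_small //; clear -b1; lia.
have mod3 : ((2 * n) %% B = 2 * n)%N by rewrite modn_small //; clear -b1; lia.
apply: (@run_seq _ _ _ _ _ (fun s1 t1 => s1 = set_wvar s v_lf 1%N /\ (t1 <= 2)%N)).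
  by apply: wp_run; rewrite /= mod1.
move=> s1 t1 _ [-> ht1].
apply: (@run_while _ _ _ _ _ (fun mu s' T => exists q,
  [/\ wvar s' v_lf = (2 ^ q)%N, (2 ^ q <= 4 * n)%N, mu = (4 * n - 2 ^ q)%N & (T <= 20 * q)%N]) (4 * n - 1)%N).
- by exists 0%N; split=> //; rewrite expn0; clear -n1; lia.
- move=> mu s2 T [kw _ _ _] [q [h1 h2 h3 hT]] /=.
  rewrite mod2 h1 (kw v_n isT) /= sn mod3 -ltnNge => lt2.
  apply: wp_run; rewrite /= mod2 h1 modn_small; last by clear -lt2 b1; lia.
  exists (4 * n - 2 ^ q.+1)%N; first by rewrite h3 expnS; clear -lt2 n1; lia.
  exists q.+1; rewrite !expnS; split=> //; first by clear -lt2; lia.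
  by clear -hT; lia.
- move=> mu s2 T [kw _ _ _] [q [h1 h2 h3 hT]] /=.
  rewrite mod2 h1 (kw v_n isT) /= sn mod3 -ltnNge -leqNgt => le2.
  by exists q; split=> //; [rewrite le2|clear -hT ht1; lia].
Qed.

(** Stopping at the first power that reaches [n] keeps all powers at most [n * n] and does not alter
    the comparison with [n]; it happens within [q] rounds because [t >= 2] and [n <= 2 ^ q]. *)
Lemma setup_pow_run s t q : wvar s v_n = n -> wvar s v_k = k -> wvar s v_t = t ->
  (1 < t <= n)%N -> wvar s v_p = 1%N -> wvar s v_j = 0%N -> (n <= 2 ^ q)%N ->
  run B setup_pow s (fun s' T =>
    (wvar s' v_p < n)%N = (t ^ k < n)%N /\ (T <= 20 * q + 20)%N).
Proof.
move=> sn sk st /andP[t1 tn] sp sj nq; have [b1 b2 b3 b4] := setup_bounds.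
have mod1 : (1 %% B = 1)%N by rewrite modn_small //; clear -b1; lia.
apply: (@run_while _ _ _ _ _ (fun mu s' T => exists j,
  [/\ wvar s' v_p = (t ^ j)%N, wvar s' v_j = j, (j <= k)%N, mu = (k - j)%N &
      (T <= 20 * j)%N /\ (j <= q)%N]) k).
- by exists 0%N; rewrite subn0.
- move=> mu s2 T [kw _ _ _] [j [h1 h2 h3 h4 [hT jq]]] /=.
  rewrite h1 h2 !(kw v_k isT) (kw v_n isT) sn sk -!ltnNge => /andP[jk pn].
  have pt : (t ^ j * t <= n * n)%N by apply: leq_mul => //; apply: ltnW.
  have modp : ((t ^ j * t) %% B = t ^ j * t)%N by rewrite modn_small //; clear -pt b4; lia.
  have modj : ((j + 1) %% B = j.+1)%N by rewrite addn1 modn_small //; clear -jk b3; lia.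
  apply: wp_run; rewrite /= mod1 h1 h2 (kw v_t isT) st modp modj.
  exists (k - j.+1)%N; first by rewrite h4; clear -jk; lia.
  exists j.+1; rewrite expnSr; split=> //; split; first by clear -hT; lia.
  rewrite ltnNge; apply/negP => qj.
  have e : j = q by apply/eqP; rewrite eqn_leq jq.
  have : (2 ^ q <= t ^ q)%N by case: (q) => // q'; rewrite leq_exp2r.
  by move: pn; rewrite e; clear -nq; lia.
- move=> mu s2 T [kw _ _ _] [j [h1 h2 h3 h4 [hT jq]]] /=.
  rewrite h1 h2 !(kw v_k isT) (kw v_n isT) sn sk -!ltnNge => h.
  split; last by clear -hT jq; lia.
  have [jk|kj] := ltnP j k; last by have -> : j = k by clear -kj h3; lia.
  move: h; rewrite jk /= -leqNgt => h; rewrite ltnNge h [RHS]ltnNge; congr (~~ _).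
  by apply/esym; apply: leq_trans h _; rewrite leq_exp2l.
Qed.

Lemma setup_t_run s q : wvar s v_n = n -> wvar s v_k = k -> (n <= 2 ^ q)%N ->
  run B setup_t s (fun s' T => exists t,
    [/\ wvar s' v_t = t, (1 < t <= n)%N, (n <= t ^ k)%N, t = 2 \/ (t.-1 ^ k < n)%N
      & (T <= (20 * q + 50) * n + 20)%N]).
Proof.
move=> sn sk nq; have [b1 b2 b3 b4] := setup_bounds.
have mod1 : (1 %% B = 1)%N by rewrite modn_small //; clear -b1; lia.
apply: (@run_seq _ _ _ _ _ (fun s1 t1 => s1 = set_wvar (set_wvar s v_t 1%N) v_p 0%N /\ (t1 <= 4)%N)).
  by apply: wp_run; rewrite /= mod1 mod0n.
move=> s1 t1 _ [-> ht1].
(* The pair [t = 1], [p = 0] only lets the loop start. Later, passing to the next [t] means that the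
   previous power was below [n], which gives minimality of [t] and, as [t <= t ^ k], also
   [t <= n]. *)
pose I mu s' T := exists t,
  [/\ wvar s' v_t = t,
      (t = 1%N /\ wvar s' v_p = 0%N) \/
      [/\ (1 < t)%N, (wvar s' v_p < n)%N = (t ^ k < n)%N & t = 2%N \/ (t.-1 ^ k < n)%N],
      (t <= n)%N, mu = (n - t)%N & (T <= (20 * q + 50) * t)%N].
apply: (@run_while _ _ _ _ _ I (n - 1)%N).
- by exists 1%N; split=> //; [left|clear -n1; lia].
- move=> mu s2 T [kw _ _ _] [t [h1 h2 tn h4 hT]] /=.
  rewrite (kw v_n isT) /= sn -ltnNge => pn.
  have {}tn : (t < n)%N.
    case: h2 => [[-> _] //|[t1' e _]]; move: pn; rewrite e; apply: leq_ltn_trans.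
    by rewrite -{1}(expn1 t) leq_exp2l.
  apply: (@run_seq _ _ _ _ _ (fun s3 t3 =>
      s3 = set_wvar (set_wvar (set_wvar s2 v_t t.+1) v_p 1%N) v_j 0%N /\ (t3 <= 8)%N)).
    by apply: wp_run; rewrite /= mod1 mod0n h1 addn1 modn_small //; clear -tn b1; lia.
  move=> s3 t3 _ [-> ht3].
  apply: run_weaken.
    apply: run_keep; apply: (@setup_pow_run _ t.+1 q) => //=.
    + by rewrite (kw v_n isT).
    + by rewrite (kw v_k isT).
    + by rewrite tn andbT ltnS; case: h2 => [[-> _]|[/ltnW]].
  move=> s4 t4 [[h5 ht4] [kw4 _ _ _]].
  exists (n - t.+1)%N; first by rewrite h4; clear -tn; lia.
  exists t.+1; split=> //.
  + by rewrite (kw4 v_t isT).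
  + right; split=> //; first by case: h2 => [[-> _]|[/ltnW]].
    case: h2 => [[-> _]|[_ e _]]; [by left|right].
    by rewrite -e.
  + by rewrite mulnS; clear -hT ht3 ht4; lia.
- move=> mu s2 T [kw _ _ _] [t [h1 h2 tn h4 hT]] /=.
  rewrite (kw v_n isT) /= sn -ltnNge -leqNgt => np.
  case: h2 => [[_ e]|[t1' e h5]]; first by move: np; rewrite e; clear -n1; lia.
  exists t; split=> //; first by rewrite t1'.
  + by rewrite leqNgt -e -leqNgt.
  + have : ((20 * q + 50) * t <= (20 * q + 50) * n)%N by rewrite leq_mul2l tn orbT.
    by clear -hT ht1; lia.
Qed.

Lemma setup_run s : input_ok s ->
  run B setup s (fun s' T => exists q t adj,
    [/\ ctx n m k t q B tl hd wt W adj, env n m k t q tl hd wt adj s'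
      & (T <= 150 * m + (20 * q + 50) * n + 20 * q + 60)%N]).
Proof.
move=> hin; have [[sn sm sk] _ _ _ _] := hin.
apply: (run_seq (setup_graph_run hin)) => s1 t1 [kw ka kr kx] [h1 h2 h3 h4 ht1].
apply: (@run_seq _ _ _ _ _ _ _ (setup_lf_run _)); first by rewrite (kw v_n isT).
move=> s2 t2 [kw2 ka2 kr2 kx2] [q [l1 l2 ht2]].
have nq : (n <= 2 ^ q)%N by case/andP: l2 => l2 _; clear -l2; lia.
apply: run_weaken.
  apply: run_keep; apply: (@setup_t_run _ q) => //.
  - by rewrite (kw2 v_n isT) (kw v_n isT).
  - by rewrite (kw2 v_k isT) (kw v_k isT).
move=> s3 t3 [[t [e1 e2 e3 e4 ht3]] [kw3 ka3 kr3 kx3]].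
have [adj hadj] := choice h1.
exists q, t, adj; split.
- split=> //; first by move=> u e; have [_ _ ->] := hadj u.
  by move=> u; have [] := hadj u.
- split; [split=> //; split| |].
  + by rewrite (kw3 v_n isT) (kw2 v_n isT) (kw v_n isT) (kw3 v_lf isT).
  + by move=> e em; rewrite (ka3 a_hd2 isT) (ka2 a_hd2 isT) h2.
  + by move=> e em; rewrite (kx3 x_wt2 isT) (kx2 x_wt2 isT) h3.
  + move=> u un; rewrite (ka3 a_nx isT) (ka2 a_nx isT) (ka3 a_first isT) (ka2 a_first isT).
    by have [] := hadj u.
  + by rewrite (kw3 v_m isT) (kw2 v_m isT) (kw v_m isT) (kw3 v_k isT) (kw2 v_k isT) (kw v_k isT).
  + by move=> v vn; rewrite (ka3 a_act isT) (ka2 a_act isT) h4.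
- by clear -ht1 ht2 ht3; lia.
Qed.

End Setup.

(** * Nearest vertices *)

Definition near_insert :=
  For v_y (V v_n)
    (If (BAnd (Nz (G a_seen (V v_y))) (Nz (G a_seen (WAdd (V v_n) (V v_y)))))
       ((RPut x_key (V v_y) (RAdd (RGet x_key (V v_y)) (RGet x_key (WAdd (V v_n) (V v_y)))) ;;
         If (BLeR (RVar r_max) (RGet x_key (V v_y))) (RSet r_max (RGet x_key (V v_y))) Skip) ;;
        pq_put (V v_y))
       Skip).

Definition near_select :=
  WSet v_q (K 0) ;;
  While (BAnd (Nz (G a_tree (K 1))) (Lt (WMul (V v_q) (V v_t)) (V v_n)))
    (WSet v_u (WSub (G a_tree (K 1)) (K 1)) ;;
     pq_del (V v_u) ;;
     (WPut a_near (WAdd (WMul (V v_x) (V v_n)) (V v_u)) (K 1) ;;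
      WSet v_q (WAdd (V v_q) (K 1)) ;;
      RPut x_rho (V v_x) (RGet x_key (V v_u)))).

Definition near_body :=
  WSet v_c (V v_x) ;;
  dij ;;
  near_insert ;;
  near_select ;;
  If (BLeW (V v_n) (WMul (V v_q) (V v_t))) (WPut a_has (V v_x) (K 1)) Skip.

Definition phase1 :=
  For v_z (WMul (K 2) (V v_n)) (WPut a_mask (V v_z) (K 1)) ;;
  For v_x (V v_n) (If (Nz (G a_act (V v_x))) near_body Skip).

Lemma idx_neq n x x' y y' : (y < n)%N -> (y' < n)%N -> x <> x' ->
  (x * n + y == x' * n + y')%N = false.
Proof.
move=> yn y'n xx'; apply/eqP => h; apply: xx'.
have n0 : (0 < n)%N by apply: leq_ltn_trans yn.
have : ((x * n + y) %/ n = (x' * n + y') %/ n)%N by rewrite h.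
by rewrite !divnMDl // !divn_small // !addn0.
Qed.

Lemma idx_bound n x y : (x < n)%N -> (y < n)%N -> (x * n + y < n * n)%N.
Proof.
move=> xn yn; apply: (@leq_trans (x * n + n)%N); first by rewrite ltn_add2l.
by rewrite addnC -mulSn leq_mul2r xn orbT.
Qed.

Section Near.
Context {R : realType}.
Variables (n m k t q B : nat) (tl hd : nat -> nat) (wt : nat -> R) (W : R).
Variable adj : nat -> seq nat.
Hypothesis cx : ctx n m k t q B tl hd wt W adj.
Local Notation envC := (env n m k t q tl hd wt adj).
Local Notation rtwE := (rtw tl hd wt (inside m tl hd xpredT)).
Implicit Types s : state R.

(** [h] is the flag that at least n/t vertices were collected. The first two clauses feed the
    hitting set; the last one, which says that open balls of radius up to [r] (of any radius if [h]
    is 0) have fewer than n/t vertices, stops the growth of balls. *)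
Definition near_spec (nr : nat -> nat) (h : nat) (r : R) x :=
  [/\ forall y, (y < n)%N -> nr y != 0%N -> exists2 d, rtwE x y d & d <= r,
      h != 0%N -> (n <= t * \sum_(y < n) (nr y != 0%N))%N
    & forall (P : pred nat) r', (h != 0%N -> r' <= r) ->
        (forall y, (y < n)%N -> P y -> exists2 d, rtwE x y d & d < r') ->
        (t * (\sum_(y < n) P y) < n)%N].

(** [r] bounds all finite roundtrip distances from [x]; this is phrased by replacing walks, so that
    no minimum has to be named. *)
Definition max_spec (r : R) x :=
  forall y d, (y < n)%N -> rtwE x y d -> exists2 d', rtwE x y d' & d' <= d /\ d' <= r.

Lemma near_spec_eq nr nr' h h' r r' x : (forall y, (y < n)%N -> nr' y = nr y) ->
  h' = h -> r' = r -> near_spec nr h r x -> near_spec nr' h' r' x.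
Proof.
move=> e -> -> [h1 h2 h3]; split=> //.
- by move=> y yn; rewrite e //; apply: h1.
- by move=> /h2; under eq_bigr do rewrite -e //.
Qed.

Lemma max_spec_le r r' x : r <= r' -> max_spec r x -> max_spec r' x.
Proof.
move=> rr h y d yn w; have [d' w' [h1 h2]] := h y d yn w.
by exists d' => //; split=> //; apply: le_trans rr.
Qed.

Section Body.
Variables (sn sb : nat -> bool) (ky kb : nat -> R) (pr pb : nat -> nat -> Prop) (x : nat).
Hypothesis bc : bicert n m tl hd wt xpredT sn sb ky kb pr pb x.
Hypothesis xn : (x < n)%N.
Local Notation rsnx := (rsn sn sb).
Local Notation rtx := (rt ky kb).

(** The roundtrip key overwrites the forward key of [y]. The backward keys are stored at [n + y],
    outside the range of the loop, and are therefore intact when read. *)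
Lemma near_insert_run s :
  envC s -> pq_ok q s -> (forall v, (v < 2 ^ q)%N -> ~~ queued q s v) ->
  (forall y, (y < n)%N -> sn_ s y = sn y) -> (forall y, (y < n)%N -> sb_ n s y = sb y) ->
  (forall y, (y < n)%N -> ky_ s y = ky y) -> (forall y, (y < n)%N -> kb_ n s y = kb y) ->
  0 <= rvar s r_max <= 2 * (W * n%:R) ->
  run B near_insert s (fun s' T =>
    [/\ pq_ok q s', forall y, (y < 2 ^ q)%N -> queued q s' y = (y < n)%N && rsnx y,
        forall y, (y < n)%N -> rsnx y -> rarr s' x_key y = rtx y /\ rtx y <= rvar s' r_max,
        rvar s r_max <= rvar s' r_max <= 2 * (W * n%:R)
      & (T <= (50 * q + 100) * n + 10)%N]).
Proof.
move=> en pq nq h1 h2 h3 h4 hmax.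
have [b1 b2 b3 b4 b5] := cx_bounds cx.
have /andP[l1 l2] := cx_lf cx.
have [[gs _] _ _] := en; have [[gn glf] _ _ _] := gs.
pose I i (s' : state R) T := [/\ pq_ok q s',
  forall y, (y < 2 ^ q)%N -> queued q s' y = [&& y < i, y < n & rsnx y]%N,
  forall y, (y < n)%N -> (y < i)%N -> rsnx y -> rarr s' x_key y = rtx y /\ rtx y <= rvar s' r_max,
  rvar s r_max <= rvar s' r_max <= 2 * (W * n%:R) &
  (forall y, (i <= y)%N -> rarr s' x_key y = rarr s x_key y) /\ (T <= (50 * q + 100) * i)%N].
apply: (@run_for _ _ _ _ _ _ n I).
- by clear -b1 l1; lia.
- by clear -b5; lia.
- by [].
- by move=> i s' [kw _ _ _] _ _ /=; rewrite (kw v_n isT).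
- split=> //=; first by move=> y yl; apply/negbTE/nq.
  by case/andP: hmax => _ ->; rewrite lexx.
- move=> i s1 T lt_in [kw ka kr kx] si [i1 i2 i3 i4 [i5 hT]].
  have sN : wvar s1 v_n = n by rewrite (kw v_n isT).
  have mod1 : ((n + i) %% B = n + i)%N by rewrite modn_small //; clear -lt_in b1 l1; lia.
  have ilf : (i < 2 ^ q)%N by clear -lt_in l1; lia.
  have seenE v : seen s1 v = seen s v by rewrite /seen (ka a_seen isT).
  apply: run_if => /=.
    rewrite mod0n si sN mod1 -!ltnNge !lt0n => /andP[a1 a2].
    have ri : rsnx i.
      by rewrite /rsn -h1 // -h2 // /sn_ /sb_ -!seenE /seen a1.
    have kE : rarr s1 x_key i + rarr s1 x_key (n + i)%N = rtx i.
      by rewrite !i5 ?leq_addl // /rt -h3 // -h4.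
    have /andP[r0 rb] := rt_bound (cx_tl cx) (cx_hd cx) (cx_W cx) (cx_wt cx) bc lt_in ri.
    apply: (@run_seq _ _ _ _ _ (fun s2 t2 =>
      [/\ rarr s2 x_key = upd (rarr s1 x_key) i (rtx i), rvar s1 r_max <= rvar s2 r_max,
          rtx i <= rvar s2 r_max, rvar s2 r_max <= 2 * (W * n%:R) & (t2 <= 30)%N])).
      apply: wp_run; rewrite /= si sN mod1 kE eqxx; split=> [ler|].
        by split=> //=; clear; lia.
      rewrite -ltNge => /ltW ltr; split=> //=; first by case/andP: i4.
    move=> s2 t2 [kw2 ka2 kr2 kx2] [e1 e2 e3 e4 ht2].
    have Q2 v : queued q s2 v = queued q s1 v by rewrite /queued (ka2 a_tree isT).
    apply: run_weaken.
      apply: run_keep; apply: (@pq_put_run _ q B b1 s2 _ i (rarr s1 x_key)) => //.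
      + by rewrite (kw2 v_lf isT) (kw v_lf isT).
      + by rewrite /= (kw2 v_y isT).
      + by rewrite (ka2 a_tree isT).
      + by move=> u /eqP/negbTE ui; rewrite e1 /= ui.
    move=> s3 t3 [[p1 p2 p3 p4] [kw3 ka3 kr3 kx3]].
    have K3 v : rarr s3 x_key v = if v == i then rtx i else rarr s1 x_key v.
      by rewrite (kx3 x_key isT) e1.
    have M3 : rvar s3 r_max = rvar s2 r_max by rewrite (kr3 r_max isT).
    split=> //.
    + move=> y yl; rewrite -[queued q (set_wvar _ _ _) y]/(queued q s3 y).
      have [->|/eqP yi] := eqVneq y i; first by rewrite p2 ltnSn lt_in ri.
      rewrite p3 // Q2 i2 // ltnS [(y <= i)%N]leq_eqVlt.
      by move/eqP/negbTE: yi => ->.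
    + move=> y yn yi ry; rewrite -[rarr (set_wvar _ _ _)]/(rarr s3) K3.
      rewrite -[rvar (set_wvar _ _ _)]/(rvar s3) M3.
      have [->//|/eqP yi'] := eqVneq y i.
      have [|//|-> h] := i3 y yn; first by clear -yi yi'; lia.
      by split=> //; apply: le_trans h e2.
    + rewrite -[rvar (set_wvar _ _ _)]/(rvar s3) M3 e4 andbT.
      by apply: le_trans e2; case/andP: i4.
    + split.
        move=> y iy; rewrite -[rarr (set_wvar _ _ _)]/(rarr s3) K3 ifF; first by apply: i5; apply: ltnW.
        by apply/eqP; clear -iy; lia.
      by rewrite mulnS; clear -hT ht2 p4; move: p4 => /=; lia.
  rewrite mod0n si sN mod1 -!ltnNge !lt0n => hns.
  have nri : rsnx i = false.
    apply/negbTE; move: hns; rewrite /rsn -h1 // -h2 // /sn_ /sb_ -!seenE /seen.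
    by [].
  apply: wp_run => /=; split=> //.
  + move=> y yl; rewrite -[queued q (set_wvar _ _ _) y]/(queued q s1 y) i2 // ltnS [(y <= i)%N]leq_eqVlt.
    by have [->|] := eqVneq y i; rewrite ?nri ?andbF.
  + move=> y yn; rewrite ltnS leq_eqVlt => /orP[/eqP ->|yi]; first by rewrite nri.
    exact: i3.
  + split; first by move=> y iy; apply: i5; apply: ltnW.
    by rewrite mulnS; clear -hT; lia.
- move=> s1 T ks si [i1 i2 i3 i4 [i5 hT]]; split=> //=.
  + by move=> y yl; rewrite i2 // andbA andbb.
  + by move=> y yn; apply: i3.
  + by clear -hT; lia.
Qed.

(** Vertices leave the queue by increasing roundtrip distance until their number [c] satisfies
    [n <= c * t] or the queue is empty. In the first case [x_rho] holds the distance of the last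
    vertex taken. The open ball of that radius misses this vertex and all queued ones, hence has at
    most c - 1 vertices, and [c.-1 * t < n] since the loop was still running at c - 1. *)
Lemma near_select_run s :
  envC s -> wvar s v_x = x -> pq_ok q s ->
  (forall y, (y < 2 ^ q)%N -> queued q s y = (y < n)%N && rsnx y) ->
  (forall y, (y < n)%N -> rsnx y -> rarr s x_key y = rtx y) ->
  (forall y, (y < n)%N -> warr s a_near (x * n + y)%N = 0%N) ->
  run B near_select s (fun s' T => exists h,
    [/\ near_spec (fun y => warr s' a_near (x * n + y)%N) h (rarr s' x_rho x) x,
        h = (n <= wvar s' v_q * t)%N,
        forall x' y, x' <> x -> (y < n)%N -> warr s' a_near (x' * n + y)%N = warr s a_near (x' * n + y)%N,
        forall x', x' <> x -> rarr s' x_rho x' = rarr s x_rho x'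
      & (wvar s' v_q <= n)%N /\ (T <= (50 * q + 100) * n + 30)%N]).
Proof.
move=> en sx pq hq hk hz.
have [b1 b2 b3 b4 b5] := cx_bounds cx.
have /andP[l1 l2] := cx_lf cx; have /andP[t1 tn] := cx_t cx.
have [[gs st] _ _] := en; have [[gn glf] _ _ _] := gs.
have mod1 : (1 %% B = 1)%N by rewrite modn_small //; clear -b5; lia.
apply: (@run_seq _ _ _ _ _ (fun s1 t1 => s1 = set_wvar s v_q 0%N /\ (t1 <= 2)%N)).
  by apply: wp_run; rewrite /= mod0n.
move=> s1 tm1 _ [-> htm1].
pose X (s' : state R) y := warr s' a_near (x * n + y)%N != 0%N.
pose I mu (s' : state R) T := exists c, [/\ wvar s' v_q = c /\ pq_ok q s',
  forall y, (y < n)%N -> rsnx y = X s' y || queued q s' y /\ ~~ (X s' y && queued q s' y),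
  (\sum_(y < n) X s' y = c)%N /\ (forall y, (y < 2 ^ q)%N -> queued q s' y -> (y < n)%N),
  c = 0%N \/ [/\ exists l, [/\ (l < n)%N, X s' l & rarr s' x_rho x = rtx l],
    (c.-1 * t < n)%N, forall y, (y < n)%N -> X s' y -> rtx y <= rarr s' x_rho x
    & forall y, (y < n)%N -> queued q s' y -> rarr s' x_rho x <= rtx y] &
  [/\ mu = (n - c)%N, (T <= (50 * q + 100) * c)%N,
      forall x' y, x' <> x -> (y < n)%N -> warr s' a_near (x' * n + y)%N = warr s a_near (x' * n + y)%N
    & forall x', x' <> x -> rarr s' x_rho x' = rarr s x_rho x']].
have sumn (P : nat -> bool) : (\sum_(y < n) P y <= n)%N.
  by rewrite -[leqRHS]card_ord -sum1_card; apply: leq_sum => i _; case: (P i).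
have nlf y : (y < n)%N -> (y < 2 ^ q)%N by clear -l1; lia.
apply: (@run_while _ _ _ _ _ I n).
- exists 0%N; split=> //.
  + move=> y yn; rewrite /X /= hz //= -[queued q _ y]/(queued q s y) hq ?nlf // yn.
    by split.
  + split; first by apply: big1 => y _; rewrite /X /= hz.
    by move=> y yl; rewrite -[queued q _ y]/(queued q s y) hq // => /andP[].
  + by left.
  + by rewrite subn0.
- move=> mu s2 T [kw ka kr kx] [c [[sq pq2] hX [hsum hqn] hrho [emu hT hnr hrr]]] /=.
  rewrite mod1 mod0n (kw v_t isT) (kw v_n isT) /= st gn sq.
  have cn : (c <= n)%N by rewrite -hsum sumn.
  have mod2 : ((c * t) %% B = c * t)%N.
    have : (c * t <= n * n)%N by apply: leq_mul.
    by move=> h; rewrite modn_small //; clear -h b4; lia.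
  rewrite mod2 -!ltnNge lt0n => /andP[tr ct].
  have [u [ulf eu qu umin]] := pq_root pq2 tr.
  have un := hqn u ulf qu.
  have [ru nXu] := hX u un; rewrite qu orbT in ru; rewrite qu andbT in nXu.
  have cn' : (c < n)%N.
    by rewrite ltnNge; apply/negP => nc; move: ct; clear -nc t1; nia.
  apply: (@run_seq _ _ _ _ _ (fun s3 t3 => s3 = set_wvar s2 v_u u /\ (t3 <= 5)%N)).
    by apply: wp_run; rewrite /= mod1 eu subn1.
  move=> s3 t3 _ [-> ht3].
  apply: (@run_seq _ _ _ _ _ (fun s4 t4 => [/\ pq_ok q s4, ~~ queued q s4 u,
        forall w, (w < 2 ^ q)%N -> w <> u -> queued q s4 w = queued q s2 w
      & (t4 <= 50 * q + 21)%N])).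
    apply: run_weaken; first apply: (@pq_del_run _ q B b1 _ _ u) => //=.
    + by rewrite (kw v_lf isT).
    + move=> s4 t4 [p1 p2 p3 p4]; split=> //; by move: p4 => /=; clear; lia.
  move=> s4 t4 [kw4 ka4 kr4 kx4] [p1 p2 p3 ht4].
  have key2 : rarr s2 x_key = rarr s x_key by rewrite (kx x_key isT).
  have w1 : wvar s4 v_x = x by rewrite (kw4 v_x isT) /= (kw v_x isT).
  have w2 : wvar s4 v_n = n by rewrite (kw4 v_n isT) /= (kw v_n isT).
  have w3 : wvar s4 v_u = u by rewrite (kw4 v_u isT).
  have w4 : wvar s4 v_q = c by rewrite (kw4 v_q isT).
  have xu := idx_bound xn un.
  have mod3 : ((x * n) %% B = x * n)%N by rewrite modn_small //; clear -xu b4; lia.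
  have mod4 : ((x * n + u) %% B = x * n + u)%N by rewrite modn_small //; clear -xu b4; lia.
  have mod5 : ((c + 1) %% B = c.+1)%N by rewrite addn1 modn_small //; clear -cn' b4; nia.
  have n2 : warr s4 a_near = warr s2 a_near by rewrite (ka4 a_near isT).
  have rh2 : rarr s4 x_rho = rarr s2 x_rho by rewrite (kx4 x_rho isT).
  have ku : rarr s4 x_key u = rtx u by rewrite (kx4 x_key isT) /= key2 hk.
  apply: wp_run; rewrite /= mod1 w1 w2 w3 w4 mod3 mod4 mod5 ku.
  set s5 := set_rarr _ _ _ _.
  have X5 y : (y < n)%N -> X s5 y = (y == u) || X s2 y.
    move=> yn; rewrite /X /s5 /= ?n2 eqn_add2l; by case: (y == u).
  have Q5 y : queued q s5 y = queued q s4 y by [].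
  have rho5 x' : rarr s5 x_rho x' = if x' == x then rtx u else rarr s2 x_rho x'.
    by rewrite /s5 /= ?rh2.
  exists (n - c.+1)%N; first by rewrite emu; clear -cn'; lia.
  exists c.+1; split.
  + by split.
  + move=> y yn; rewrite X5 // Q5; have [->|/eqP yu] := eqVneq y u.
      by rewrite ru (negbTE p2) andbF.
    by rewrite p3 ?nlf //; apply: hX.
  + split.
      have := @sum_upd n (X s2) (X s5) u un; rewrite X5 // eqxx (negbTE nXu) addn0 hsum addn1.
      by apply=> v vn /eqP/negbTE vu; rewrite X5 // vu.
    move=> y yl; rewrite Q5; have [->|/eqP yu] := eqVneq y u; first by [].
    by rewrite p3 //; apply: hqn.
  + right; rewrite rho5 eqxx; split=> //.
    * by exists u; split=> //; rewrite X5 // eqxx.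
    * move=> y yn; rewrite X5 // => /orP[/eqP ->//|Xy].
      case: hrho => [c0|[_ _ hr1 hr2]].
        have := @sum_upd n (fun=> 0%N) (X s2) y yn; rewrite hsum c0 Xy big1 // => h.
        exfalso; move: Xy; apply/negP.
        move: hsum; rewrite c0 (bigD1 (Ordinal yn)) //= => /eqP.
        by rewrite addn_eq0; case: (X s2 y).
      by apply: le_trans (hr1 y yn Xy) (hr2 u un qu).
    * move=> y yn; rewrite Q5; have [->|/eqP yu] := eqVneq y u; first by rewrite lexx.
      rewrite p3 ?nlf // => qy; have := umin y (nlf y yn) qy; rewrite key2 !hk //.
      by have [-> _] := hX y yn; rewrite qy orbT.
  + split=> //.
    * by rewrite mulnS; clear -hT ht3 ht4; lia.
    * by move=> x' y xx yn; rewrite /s5 /= ?n2 (idx_neq yn un xx); apply: hnr.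
    * by move=> x' xx; rewrite rho5; move/eqP/negbTE: (xx) => ->; apply: hrr.
- move=> mu s2 T [kw ka kr kx] [c [[sq pq2] hX [hsum hqn] hrho [emu hT hnr hrr]]] /=.
  rewrite mod1 mod0n (kw v_t isT) (kw v_n isT) /= st gn sq.
  have cn : (c <= n)%N by rewrite -hsum sumn.
  have mod2 : ((c * t) %% B = c * t)%N.
    have : (c * t <= n * n)%N by apply: leq_mul.
    by move=> h; rewrite modn_small //; clear -h b4; lia.
  rewrite mod2 -!ltnNge lt0n negb_and negbK -leqNgt => hend.
  exists (n <= c * t)%N; split=> //; last first.
    split=> //; have : ((50 * q + 100) * c <= (50 * q + 100) * n)%N by rewrite leq_mul2l cn orbT.
    by clear -hT htm1; lia.
  split.
  + move=> y yn Xy; have [ry _] := hX y yn; rewrite -/(X s2 y) in Xy; rewrite Xy in ry.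
    exists (rtx y); first by apply: (rt_walk (cx_tl cx) (cx_hd cx) (cx_W cx) (cx_wt cx) bc).
    case: hrho => [c0|[_ _ hr1 hr2]]; last exact: hr1.
    exfalso; move: hsum; rewrite c0 (bigD1 (Ordinal yn)) //= Xy; clear; lia.
  + case: (leqP n (c * t)) => // h _; rewrite mulnC; move: h.
    by rewrite -hsum /X.
  + move=> P r' hr' hP.
    have PX y : (y < n)%N -> P y -> rsnx y /\ rtx y < r'.
      move=> yn Py; have [d w dr] := hP y yn Py.
      have [r1 r2] := rt_lower bc w.
      by split=> //; apply: le_lt_trans dr.
    case: (leqP n (c * t)) hr' hend => [h hr'|h _].
      have {}hr' : r' <= rarr s2 x_rho x by apply: hr'.
      move=> _; case: hrho => [c0|[[l [ln Xl hl]] hc _ hr2]].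
        by move: h (cx_n cx); rewrite c0; clear; lia.
      suff : (\sum_(y < n) P y <= c.-1)%N.
        by move=> h'; apply: leq_ltn_trans hc; rewrite mulnC leq_mul2r h' orbT.
      have -> : c.-1 = (\sum_(y < n) (X s2 y && (y != l :> nat)))%N.
        have := @sum_upd n (fun y => X s2 y && (y != l)) (X s2) l ln.
        rewrite eqxx andbF Xl hsum addn0 => e.
        rewrite e ?addn1 // => v vn /eqP/negbTE vl; by rewrite vl andbT.
      apply: (@leq_sum_nat n P (fun y => X s2 y && (y != l))) => y yn.
      case: (boolP (P y)) => // Py; have [ry rl] := PX y yn Py.
      have [e _] := hX y yn; rewrite ry in e.
      have yl : y != l.
        apply/eqP => yl; move: rl; rewrite yl -hl => /lt_le_trans/(_ hr').
        by rewrite ltxx.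
      rewrite yl andbT; case: (boolP (queued q s2 y)) => qy; last by rewrite (negbTE qy) orbF in e; rewrite -e.
      have := hr2 y yn qy; rewrite leNgt => /negP[].
      exact: lt_le_trans rl hr'.
    (* The queue ran empty below the threshold: all vertices on a common closed walk with [x] were
       collected, and these are fewer than n/t. *)
    rewrite orbF => /eqP tr.
    suff : (\sum_(y < n) P y <= c)%N.
      by move=> h'; apply: leq_ltn_trans h; rewrite mulnC leq_mul2r h' orbT.
    rewrite -hsum; apply: (@leq_sum_nat n P (X s2)) => y yn.
    case: (boolP (P y)) => // Py; have [ry rl] := PX y yn Py.
    have [e _] := hX y yn; rewrite ry in e.
    by move: e; rewrite (negbTE (pq_empty pq2 tr (nlf y yn))) orbF => <-.
Qed.

End Body.

Definition near_time := (dij_time n m q + 2 * ((50 * q + 100) * n) + 100)%N.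

Lemma near_body_run s x :
  envC s -> wvar s v_x = x -> (x < n)%N -> (forall v, (v < 2 * n)%N -> mask s v) ->
  (forall y, (y < n)%N -> warr s a_near (x * n + y)%N = 0%N) -> warr s a_has x = 0%N ->
  0 <= rvar s r_max <= 2 * (W * n%:R) ->
  run B near_body s (fun s' T =>
    [/\ near_spec (fun y => warr s' a_near (x * n + y)%N) (warr s' a_has x) (rarr s' x_rho x) x,
        max_spec (rvar s' r_max) x,
        rvar s r_max <= rvar s' r_max <= 2 * (W * n%:R),
        forall x', x' <> x -> [/\ rarr s' x_rho x' = rarr s x_rho x', warr s' a_has x' = warr s a_has x'
          & forall y, (y < n)%N -> warr s' a_near (x' * n + y)%N = warr s a_near (x' * n + y)%N]
      & (T <= near_time)%N]).
Proof.
move=> en sx xn hm hz hh hmax.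
have [b1 b2 b3 b4 b5] := cx_bounds cx.
have /andP[l1 l2] := cx_lf cx; have /andP[t1 tn] := cx_t cx.
have mod1 : (1 %% B = 1)%N by rewrite modn_small //; clear -b5; lia.
apply: (@run_seq _ _ _ _ _ (fun s1 tm => s1 = set_wvar s v_c x /\ (tm <= 2)%N)).
  by apply: wp_run; rewrite /= sx.
move=> s1 tm1 _ [-> htm1].
apply: run_seq.
  apply: (dij_correct cx (c := x) (U := xpredT) (s := set_wvar s v_c x)) => //.
  move=> v vn; split; [apply: hm; clear -vn; lia|apply: hm; clear -vn; lia].
move=> s2 tm2 k2 [[bc pq nq] htm2].
have en2 : envC s2 by apply: env_keep k2 en.
have [kw2 ka2 kr2 kx2] := k2.
apply: run_seq.
  by apply: (near_insert_run bc en2) => //; rewrite (kr2 r_max isT).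
move=> s3 tm3 k3 [pq3 q3 kk3 m3 htm3].
have en3 : envC s3 by apply: env_keep k3 en2.
have [kw3 ka3 kr3 kx3] := k3.
apply: run_seq.
  apply: (near_select_run bc xn en3) => //.
  - by rewrite (kw3 v_x isT) (kw2 v_x isT).
  - by move=> y yn ry; have [] := kk3 y yn ry.
  - by move=> y yn; rewrite (ka3 a_near isT) (ka2 a_near isT) /= hz.
move=> s4 tm4 k4 [h [ns hE nr4 rh4 [qn htm4]]].
have en4 : envC s4 by apply: env_keep k4 en3.
have [kw4 ka4 kr4 kx4] := k4.
have [[[[gn _] _ _ _] st] _ _] := en4.
have x4 : wvar s4 v_x = x by rewrite (kw4 v_x isT) (kw3 v_x isT) (kw2 v_x isT).
have mod2 : ((wvar s4 v_q * t) %% B = wvar s4 v_q * t)%N.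
  have hq : (wvar s4 v_q * t <= n * n)%N by apply: leq_mul.
  by rewrite modn_small //; clear -hq b4; lia.
have hs4 x' : warr s4 a_has x' = warr s a_has x'.
  by rewrite (ka4 a_has isT) (ka3 a_has isT) (ka2 a_has isT).
have fin s5 tm5 : rvar s5 = rvar s4 -> rarr s5 = rarr s4 -> warr s5 a_near = warr s4 a_near ->
  warr s5 a_has x = (n <= wvar s4 v_q * t)%N ->
  (forall x', x' <> x -> warr s5 a_has x' = warr s a_has x') -> (tm5 <= 20)%N ->
  [/\ near_spec (fun y => warr s5 a_near (x * n + y)%N) (warr s5 a_has x) (rarr s5 x_rho x) x,
        max_spec (rvar s5 r_max) x,
        rvar s r_max <= rvar s5 r_max <= 2 * (W * n%:R),
        forall x', x' <> x -> [/\ rarr s5 x_rho x' = rarr s x_rho x', warr s5 a_has x' = warr s a_has x'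
          & forall y, (y < n)%N -> warr s5 a_near (x' * n + y)%N = warr s a_near (x' * n + y)%N]
      & (tm1 + (tm2 + (tm3 + (tm4 + tm5))) <= near_time)%N].
  move=> e1 e2 e3 e4 e5 htm5; rewrite e1 e2 e3 e4 -hE.
  have rm : rvar s4 r_max = rvar s3 r_max by rewrite (kr4 r_max isT).
  split=> //.
  - move=> y d yn w; have [r1 r2] := rt_lower bc w; have [_ r3] := kk3 y yn r1.
    rewrite rm; exists (rt (ky_ s2) (kb_ n s2) y); last by [].
    exact: (rt_walk (cx_tl cx) (cx_hd cx) (cx_W cx) (cx_wt cx) bc).
  - by move: m3; rewrite rm (kr2 r_max isT).
  - move=> x' xx; rewrite rh4 // (kx3 x_rho isT) (kx2 x_rho isT) e5 //; split=> //.
    by move=> y yn; rewrite nr4 // (ka3 a_near isT) (ka2 a_near isT).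
  - by rewrite /near_time; move: htm1 htm2 htm3 htm4 htm5; clear; lia.
apply: run_if => /=; rewrite gn st mod2 => hc; apply: wp_run => /=.
- rewrite x4 mod1; apply: (fin (set_warr s4 a_has x 1%N)) => //=; first by rewrite eqxx hc.
  by move=> x' /eqP/negbTE xx; rewrite xx hs4.
- by apply: (fin s4) => //; rewrite hs4 hh (negbTE hc).
Qed.

Definition phase1_ok s :=
  [/\ forall x, (x < n)%N -> active m tl hd x ->
        near_spec (fun y => warr s a_near (x * n + y)%N) (warr s a_has x) (rarr s x_rho x) x
        /\ max_spec (rvar s r_max) x,
      forall x, (x < n)%N -> ~~ active m tl hd x -> warr s a_has x = 0%N
    & 0 <= rvar s r_max <= 2 * (W * n%:R)].

Lemma phase1_run s :
  envC s -> (forall a i, a \in [:: a_near; a_has] -> warr s a i = 0%N) -> rvar s r_max = 0 ->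
  run B phase1 s (fun s' T =>
    [/\ phase1_ok s', forall v, (v < 2 * n)%N -> mask s' v
      & (T <= 50 * n + 50 + (\sum_(x < n) active m tl hd x) * near_time)%N]).
Proof.
move=> en hz hr.
have [b1 b2 b3 b4 b5] := cx_bounds cx.
have /andP[l1 l2] := cx_lf cx.
have mod1 : (1 %% B = 1)%N by rewrite modn_small //; clear -b5; lia.
have mod2 : (2 %% B = 2)%N by rewrite modn_small //; clear -b5; lia.
have [[[[gn _] _ _ _] _] _ _] := en.
apply: (@run_seq _ _ _ _ _ (fun s1 tm => (forall v, (v < 2 * n)%N -> mask s1 v) /\ (tm <= 30 * n + 20)%N)).
  apply: (@run_for _ _ _ _ _ _ (2 * n)%N (fun i s1 T =>
     (forall v, (v < i)%N -> mask s1 v) /\ (T <= 14 * i)%N)) => //.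
  - by clear -b1 l1; lia.
  - by clear -b5; lia.
  - by move=> i s2 [kw _ _ _] _ _; rewrite /= mod2 (kw v_n isT) gn modn_small //; clear -b1 l1; lia.
  - move=> i s2 T iN _ si [h hT]; apply: wp_run; rewrite /= mod1 si; split.
      move=> v vi; rewrite /mask /=; have [//|vi'] := eqVneq v i.
      by apply: h; move/eqP: vi'; clear -vi; lia.
    by clear -hT; lia.
  - by move=> s2 T _ _ [h hT]; split=> //=; clear -hT; lia.
move=> s1 tm1 k1 [hm htm1].
have en1 : envC s1 by apply: env_keep k1 en.
have [kw1 ka1 kr1 kx1] := k1.
have [[[[gn1 _] _ _ _] _] _ _] := en1.
pose I i (s' : state R) T :=
  [/\ forall x, (x < i)%N -> active m tl hd x ->
        near_spec (fun y => warr s' a_near (x * n + y)%N) (warr s' a_has x) (rarr s' x_rho x) x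
        /\ max_spec (rvar s' r_max) x,
      forall x, (i <= x)%N \/ ~~ active m tl hd x -> warr s' a_has x = 0%N,
      forall x y, (i <= x)%N -> (y < n)%N -> warr s' a_near (x * n + y)%N = 0%N,
      0 <= rvar s' r_max <= 2 * (W * n%:R)
    & (T <= 20 * i + (\sum_(x < i) active m tl hd x) * near_time)%N].
apply: (@run_for _ _ _ _ _ _ n I) => //.
- by clear -b1 l1; lia.
- by clear -b5; lia.
- by move=> i s2 [kw _ _ _] _ _; rewrite /= (kw v_n isT).
- have r0 : rvar s1 r_max = 0 by rewrite (kr1 r_max isT).
  split=> //=.
  + by move=> x _; rewrite (ka1 a_has isT) hz.
  + by move=> x y _ _; rewrite (ka1 a_near isT) hz.
  + by rewrite r0 lexx mulr_ge0 // mulr_ge0 // (le_trans ler01 (cx_W cx)).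
- move=> i s2 T lt_in k2 si [i1 i2 i3 i4 hT].
  have en2 : envC s2 by apply: env_keep k2 en1.
  have [kw2 ka2 kr2 kx2] := k2.
  have sumE : (\sum_(x < i.+1) active m tl hd x = \sum_(x < i) active m tl hd x + active m tl hd i)%N.
    by rewrite big_ord_recr.
  have actE : (warr s2 a_act i != 0%N) = active m tl hd i by case: en2 => _ _ ->.
  apply: run_if => /=; rewrite mod0n si -!ltnNge ?lt0n ?actE => act.
    have hx0 : warr s2 a_has i = 0%N by apply: i2; left.
    apply: run_weaken; first apply: (@near_body_run s2 i) => //.
    + by move=> v vN; rewrite /mask (ka2 a_mask isT); apply: hm.
    + by move=> y yn; apply: i3.
    move=> s3 T3 [n1 n2 n3 n4 hT3]; split=> /=.
    + move=> x xi ax; have [->//|/eqP xne] := eqVneq x i.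
      have [|h1 h2] := i1 x _ ax; first by clear -xi xne; lia.
      have [e1 e2 e3] := n4 x xne.
      split; first by apply: near_spec_eq h1.
      by apply: max_spec_le h2; case/andP: n3.
    + move=> x hx; have xne : x <> i by move=> xi; case: hx; rewrite xi ?act // ltnn.
      have [_ -> _] := n4 x xne; apply: i2; case: hx => [hx|]; [left|by right].
      by apply: ltnW.
    + move=> x y ix yn; have xne : x <> i by clear -ix; lia.
      by have [_ _ ->] := n4 x xne => //; apply: i3 => //; apply: ltnW.
    + case/andP: n3 => n3 ->; rewrite andbT; apply: le_trans n3; by case/andP: i4.
    + rewrite sumE act mulnDl mul1n; clear -hT hT3; lia.
  have {}act : ~~ active m tl hd i by rewrite -actE; clear -act; lia.
  apply: wp_run; split=> /=.
  + move=> x xi ax; apply: i1 => //; move: xi; rewrite ltnS leq_eqVlt => /orP[/eqP e|//].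
    by rewrite e (negbTE act) in ax.
  + by move=> x hx; apply: i2; case: hx => [hx|]; [left; apply: ltnW|right].
  + by move=> x y ix yn; apply: i3 => //; apply: ltnW.
  + by [].
  + by rewrite sumE (negbTE act) addn0; clear -hT; lia.
- move=> s2 T k2 _ [i1 i2 i3 i4 hT]; split.
  + split=> //.
    by move=> x xn ax; apply: i2; right.
  + by move=> v vN; have [_ ka2 _ _] := k2; rewrite /mask (ka2 a_mask isT); apply: hm.
  + by move: hT htm1 => /=; clear; lia.
Qed.

End Near.

(** * The hitting set *)

(** A parent entry is one plus an edge number of the doubled graph; the edges [e] and [m + e] there
    both stand for the input edge [e]. *)
Definition mark e :=
  If (BLeW (V v_m) (WSub (G a_par e) (K 1)))
    (WPut a_out (WSub (WSub (G a_par e) (K 1)) (V v_m)) (K 1))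
    (WPut a_out (WSub (G a_par e) (K 1)) (K 1)).

Definition mark_all :=
  For v_y (WMul (K 2) (V v_n))
    (If (BAnd (Nz (G a_seen (V v_y))) (Nz (G a_par (V v_y)))) (mark (V v_y)) Skip).

Definition near_count op :=
  For v_y (V v_n)
    (If (Nz (G a_near (WAdd (WMul (V v_x) (V v_n)) (V v_y))))
       (WPut a_cnt (V v_y) (op (G a_cnt (V v_y)) (K 1))) Skip).

(** The counter of [y] is the number of unhit near sets containing [y]. Where no near set was
    completed, [x_rho] becomes 2 k [r_max], which acts as infinity: it exceeds (k-1) d for all d up
    to 2 [r_max]. *)
Definition hit_init :=
  For v_x (V v_n)
    (If (Nz (G a_has (V v_x))) (near_count WAdd)
       (RPut x_rho (V v_x) (RMul (RMul (RCast (K 2)) (RCast (V v_k))) (RVar r_max)))).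

Definition hit_pick :=
  (WSet v_q (K 0) ;; WSet v_c (K 0)) ;;
  For v_y (V v_n)
    (If (Lt (V v_q) (G a_cnt (V v_y)))
       (WSet v_q (G a_cnt (V v_y)) ;; WSet v_c (V v_y)) Skip).

Definition hit_remove :=
  For v_x (V v_n)
    (If (BAnd (Nz (G a_has (V v_x)))
              (Nz (G a_near (WAdd (WMul (V v_x) (V v_n)) (V v_c)))))
       (WPut a_has (V v_x) (K 0) ;; near_count WSub) Skip).

Definition hit_loop :=
  While (Nz (V v_q)) (dij ;; mark_all ;; hit_remove ;; hit_pick).

Definition phase2 := hit_init ;; hit_pick ;; hit_loop.

Section Hit.
Context {R : realType}.
Variables (n m k t q B : nat) (tl hd : nat -> nat) (wt : nat -> R) (W : R).
Variable adj : nat -> seq nat.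
Hypothesis cx : ctx n m k t q B tl hd wt W adj.
Local Notation envC := (env n m k t q tl hd wt adj).
Local Notation rtwE := (rtw tl hd wt (inside m tl hd xpredT)).
Implicit Types s : state R.

Definition out_edge s : pred nat := fun e => (e < m)%N && (warr s a_out e != 0%N).
Definition marks s := (\sum_(e < m) (warr s a_out e != 0%N))%N.
Definition edge_of p := if (m <= p.-1)%N then (p.-1 - m)%N else p.-1.

Lemma mark_run s e y : wvar s v_m = m -> weval B s e = y -> (wcost e <= 3)%N -> 
  run B (mark e) s (fun s' T =>
    s' = set_warr s a_out (edge_of (warr s a_par y)) 1%N /\ (T <= 30)%N).
Proof.
move=> sm se ce; have [b1 b2 b3 b4 b5] := cx_bounds cx.
have mod1 : (1 %% B = 1)%N by rewrite modn_small //; clear -b5; lia.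
apply: wp_run; rewrite /= mod1 se sm subn1 /edge_of.
split=> [->|/negbTE ->]; split=> //; clear -ce; lia.
Qed.

Lemma marks_upd s i : (marks (set_warr s a_out i 1%N) <= marks s + 1)%N.
Proof.
have [im|mi] := ltnP i m.
  have := @sum_upd m (fun e => warr s a_out e != 0%N)
    (fun e => warr (set_warr s a_out i 1%N) a_out e != 0%N) i im.
  rewrite /= eqxx /= => h.
  rewrite /marks /=.
  have {}h : (\sum_(v < m) ((if v == i :> nat then 1%N else warr s a_out v) != 0%N) +
     (warr s a_out i != 0%N) = \sum_(v < m) (warr s a_out v != 0%N) + 1)%N.
    by apply: h => v vm /eqP/negbTE ->.
  by rewrite -h leq_addr.
rewrite /marks /= (eq_bigr (fun e : 'I_m => (warr s a_out e != 0%N : nat))) ?leq_addr //.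
by move=> e _; rewrite ifF //; apply/eqP => ei; move: (ltn_ord e); rewrite ei ltnNge mi.
Qed.

Lemma mark_all_run s : envC s ->
  run B mark_all s (fun s' T =>
    [/\ forall e, warr s a_out e != 0%N -> warr s' a_out e != 0%N,
        forall v, (v < 2 * n)%N -> seen s v -> warr s a_par v != 0%N ->
          warr s' a_out (edge_of (warr s a_par v)) != 0%N,
        (marks s' <= marks s + 2 * n)%N
      & (T <= 60 * (2 * n) + 20)%N]).
Proof.
move=> en; have [b1 b2 b3 b4 b5] := cx_bounds cx.
have /andP[l1 l2] := cx_lf cx.
have [[[[gn _] _ _ _] _] [gm _] _] := en.
have mod2 : (2 %% B = 2)%N by rewrite modn_small //; clear -b5; lia.
apply: (@run_for _ _ _ _ _ _ (2 * n)%N (fun i s' T =>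
  [/\ forall e, warr s a_out e != 0%N -> warr s' a_out e != 0%N,
        forall v, (v < i)%N -> seen s v -> warr s a_par v != 0%N ->
          warr s' a_out (edge_of (warr s a_par v)) != 0%N,
        (marks s' <= marks s + i)%N
      & (T <= 60 * i)%N])) => //.
- by clear -b1 l1; lia.
- by clear -b5; lia.
- by move=> i s2 [kw _ _ _] _ _; rewrite /= mod2 (kw v_n isT) gn modn_small //; clear -b1 l1; lia.
- by split=> //=; rewrite /marks /= addn0.
- move=> i s1 T iN [kw ka kr kx] si [i1 i2 i3 hT].
  have pE : warr s1 a_par = warr s a_par by rewrite (ka a_par isT).
  have sE v : (warr s1 a_seen v != 0%N) = seen s v by rewrite /seen (ka a_seen isT).
  apply: run_if => /=; rewrite mod0n si pE -!ltnNge !lt0n ?sE.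
    move=> /andP[sv pv]; apply: run_weaken.
      by apply: (@mark_run s1 _ i); [rewrite (kw v_m isT)|rewrite /= si|].
    move=> s2 T2 [-> hT2]; rewrite pE; set s3 := set_warr _ _ _ _.
    have w3 e : warr s1 a_out e != 0%N -> warr s3 a_out e != 0%N.
      by move=> h /=; case: ifP.
    split.
    + by move=> e he; apply: w3; apply: i1.
    + move=> v; rewrite ltnS leq_eqVlt => /orP[/eqP -> _ _|vi v1 v2]; first by rewrite /= eqxx.
      by apply: w3; apply: i2.
    + rewrite -[marks (set_wvar _ _ _)]/(marks s3).
      by have := marks_upd s1 (edge_of (warr s a_par i)); rewrite -/s3; clear -i3; lia.
    + by clear -hT hT2; lia.
  move=> hn; apply: wp_run; split=> //=.
  + move=> v; rewrite ltnS leq_eqVlt => /orP[/eqP -> v1 v2|]; last exact: i2.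
    by move: hn; rewrite -leqn0 -ltnNge lt0n ?sE v1 v2.
  + by rewrite -[marks (set_wvar _ _ _)]/(marks s1); clear -i3; lia.
  + by clear -hT; lia.
- by move=> s1 T _ _ [i1 i2 i3 hT]; split=> //=; clear -hT; lia.
Qed.

(** The output so far preserves the roundtrip distances from [h] exactly. *)
Definition full_tree s h :=
  forall y d, (y < n)%N -> rtwE h y d -> exists2 d', rtw tl hd wt (out_edge s) h y d' & d' <= d.

Lemma full_tree_mono s s' h : (forall e, warr s a_out e != 0%N -> warr s' a_out e != 0%N) ->
  full_tree s h -> full_tree s' h.
Proof.
move=> hs f y d yn w; have [d' w' dd] := f y d yn w; exists d' => //.
by apply: rtw_mono w' => e; rewrite /out_edge => /andP[-> /hs].
Qed.

Lemma full_tree_dij s s' c : dij_post n m q tl hd wt xpredT c s -> (c < n)%N ->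
  (forall v, (v < 2 * n)%N -> seen s v -> warr s a_par v != 0%N ->
          warr s' a_out (edge_of (warr s a_par v)) != 0%N) ->
  full_tree s' c.
Proof.
move=> [bc _ _] cn hm y d yn w.
have [ry rd] := rt_lower bc w.
exists (rt (ky_ s) (kb_ n s) y) => //.
apply: (rt_tree (cx_tl cx) (cx_hd cx) (cx_W cx) (cx_wt cx) bc) => //.
- move=> v e vn sv em; rewrite /pr_ => pe.
  have := hm v; rewrite pe /edge_of /= [(m <= e)%N]leqNgt em /= /out_edge em; apply => //.
  by clear -vn; lia.
- move=> v e vn sv em; rewrite /pb_ => pe.
  have := hm (n + v)%N; rewrite pe /edge_of /= leq_addr addKn /out_edge em; apply => //.
  by clear -vn; lia.
Qed.

(** Used with successor when a near set is registered and with predecessor when it has been hit. *)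
Lemma near_count_run s x op (f : nat -> nat) :
  envC s -> wvar s v_x = x -> (x < n)%N -> (wcost (op (G a_cnt (V v_y)) (K 1)) <= 10)%N ->
  (forall s' : state R, (warr s' a_cnt (wvar s' v_y) <= n)%N ->
     weval B s' (op (G a_cnt (V v_y)) (K 1)) = f (warr s' a_cnt (wvar s' v_y))) ->
  (forall y, (y < n)%N -> (warr s a_cnt y <= n)%N) ->
  run B (near_count op) s (fun s' T =>
    (forall y, (y < n)%N -> warr s' a_cnt y =
       if warr s a_near (x * n + y)%N != 0%N then f (warr s a_cnt y) else warr s a_cnt y)
    /\ (T <= 40 * n + 10)%N).
Proof.
move=> en sx xn cop fop hc; have [b1 b2 b3 b4 b5] := cx_bounds cx.
have /andP[l1 l2] := cx_lf cx.
have [[[[gn _] _ _ _] _] [gm _] _] := en.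
apply: (@run_for _ _ _ _ _ _ n (fun i s' T =>
  [/\ forall y, (y < i)%N -> warr s' a_cnt y =
       if warr s a_near (x * n + y)%N != 0%N then f (warr s a_cnt y) else warr s a_cnt y,
      forall y, (i <= y)%N -> warr s' a_cnt y = warr s a_cnt y & (T <= 40 * i)%N])) => //.
- by clear -b1 l1; lia.
- by clear -b5; lia.
- by move=> i s2 [kw _ _ _] _ _; rewrite /= (kw v_n isT).
- move=> i s1 T lt_in [kw ka kr kx] si [i1 i2 hT].
  have idx := idx_bound xn lt_in.
  have mod3 : ((x * n) %% B = x * n)%N by rewrite modn_small //; clear -idx b4; lia.
  have mod4 : ((x * n + i) %% B = x * n + i)%N by rewrite modn_small //; clear -idx b4; lia.
  apply: run_if; rewrite /= mod0n (kw v_x isT) (kw v_n isT) sx gn si mod3 mod4 -?ltnNge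
    (ka a_near isT) => hx.
    apply: wp_run; cbn [wp]; rewrite fop si ?i2 ?hc //= si.
    split.
    + move=> y /=; rewrite ltnS leq_eqVlt => /orP[/eqP ->|yi]; first by rewrite eqxx -lt0n hx.
      by rewrite ifF; [apply: i1|apply/eqP; clear -yi; lia].
    + by move=> y iy /=; rewrite ifF; [apply: i2; apply: ltnW|apply/eqP; clear -iy; lia].
    + by move: cop; rewrite /=; clear -hT; lia.
  apply: wp_run => /=; split.
  + move=> y; rewrite ltnS leq_eqVlt => /orP[/eqP ->|yi]; last exact: i1.
    by rewrite i2 // -lt0n ltnNge -ltnS hx.
  + by move=> y iy; apply: i2; apply: ltnW.
  + by clear -hT; lia.
- by move=> s1 T _ _ [i1 i2 hT]; split=> //=; clear -hT; lia.
Qed.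

Lemma hit_pick_run s : envC s ->
  run B hit_pick s (fun s' T =>
    [/\ forall y, (y < n)%N -> (warr s a_cnt y <= wvar s' v_q)%N,
        wvar s' v_q != 0%N -> (wvar s' v_c < n)%N /\ warr s a_cnt (wvar s' v_c) = wvar s' v_q
      & (T <= 40 * n + 20)%N]).
Proof.
move=> en; have [b1 b2 b3 b4 b5] := cx_bounds cx.
have /andP[l1 l2] := cx_lf cx.
have [[[[gn _] _ _ _] _] _ _] := en.
apply: (@run_seq _ _ _ _ _ (fun s1 tm => s1 = set_wvar (set_wvar s v_q 0%N) v_c 0%N /\ (tm <= 4)%N)).
  by apply: wp_run; rewrite /= mod0n.
move=> s1 tm1 _ [-> htm1].
apply: (@run_for _ _ _ _ _ _ n (fun i s' T =>
  [/\ forall y, (y < i)%N -> (warr s a_cnt y <= wvar s' v_q)%N,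
        wvar s' v_q != 0%N -> (wvar s' v_c < n)%N /\ warr s a_cnt (wvar s' v_c) = wvar s' v_q
      & (T <= 40 * i)%N])) => //.
- by clear -b1 l1; lia.
- by clear -b5; lia.
- by move=> i s2 [kw _ _ _] _ _; rewrite /= (kw v_n isT).
- move=> i s2 T lt_in [kw ka kr kx] si [i1 i2 hT].
  apply: wp_run; rewrite /= si (ka a_cnt isT) /= -ltnNge; split=> [lt1|].
    split=> //=; last by clear -hT; lia.
    move=> y; rewrite ltnS leq_eqVlt => /orP[/eqP -> //|yi].
    by apply: leq_trans (i1 y yi) (ltnW lt1).
  rewrite -leqNgt => le1; split=> //=; last by clear -hT; lia.
  by move=> y; rewrite ltnS leq_eqVlt => /orP[/eqP -> //|]; apply: i1.
- by move=> s2 T _ _ [i1 i2 hT]; split=> //=; clear -hT htm1; lia.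
Qed.

Lemma sum_bool_le (P : nat -> bool) i : (\sum_(x < i) P x <= i)%N.
Proof. by rewrite -[leqRHS]card_ord -sum1_card; apply: leq_sum => x _; case: (P x). Qed.

Local Notation hasB s x := (warr s a_has x != 0%N).
Local Notation nearB s x y := (warr s a_near (x * n + y)%N != 0%N).

Lemma hit_init_run s : envC s -> (forall y, (y < n)%N -> warr s a_cnt y = 0%N) ->
  run B hit_init s (fun s' T =>
    [/\ forall y, (y < n)%N -> warr s' a_cnt y = (\sum_(x < n) (hasB s x && nearB s x y))%N,
        forall x, (x < n)%N -> rarr s' x_rho x =
          if hasB s x then rarr s x_rho x else 2 * k%:R * rvar s r_max
      & (T <= 60 * n + 20 + (\sum_(x < n) hasB s x) * (40 * n + 40))%N]).
Proof.
move=> en hz; have [b1 b2 b3 b4 b5] := cx_bounds cx.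
have /andP[l1 l2] := cx_lf cx.
have [[[[gn _] _ _ _] _] [gm gk] _] := en.
have mod1 : (1 %% B = 1)%N by rewrite modn_small //; clear -b5; lia.
have mod2 : (2 %% B = 2)%N by rewrite modn_small //; clear -b5; lia.
apply: (@run_for _ _ _ _ _ _ n (fun i s' T =>
    [/\ forall y, (y < n)%N -> warr s' a_cnt y = (\sum_(x < i) (hasB s x && nearB s x y))%N,
        forall x, (x < i)%N -> rarr s' x_rho x =
          if hasB s x then rarr s x_rho x else 2 * k%:R * rvar s r_max,
        forall x, (i <= x)%N -> rarr s' x_rho x = rarr s x_rho x
      & (T <= 60 * i + (\sum_(x < i) hasB s x) * (40 * n + 40))%N])) => //.
- by clear -b1 l1; lia.
- by clear -b5; lia.
- by move=> i s2 [kw _ _ _] _ _; rewrite /= (kw v_n isT).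
- by split=> //= y yn; rewrite big_ord0 hz.
- move=> i s1 T lt_in k1 si [i1 i2 i3 hT].
  have en1 : envC s1 by apply: env_keep k1 en.
  have [kw ka kr kx] := k1.
  have sumE : (\sum_(x < i.+1) hasB s x = \sum_(x < i) hasB s x + hasB s i)%N.
    by rewrite big_ord_recr.
  have sumE' y : (\sum_(x < i.+1) (hasB s x && nearB s x y) =
      \sum_(x < i) (hasB s x && nearB s x y) + (hasB s i && nearB s i y))%N.
    by rewrite big_ord_recr.
  have hE : warr s1 a_has = warr s a_has by rewrite (ka a_has isT).
  have nE : warr s1 a_near = warr s a_near by rewrite (ka a_near isT).
  have leI y : (y < n)%N -> (warr s1 a_cnt y <= i)%N.
    by move=> yn; rewrite i1 // (sum_bool_le (fun x => hasB s x && nearB s x y)).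
  apply: run_if => /=; rewrite mod0n si hE -ltnNge lt0n => hi.
    apply: run_weaken.
      apply: run_keep; apply: (@near_count_run s1 i WAdd succn) => //.
        by move=> s' h /=; rewrite mod1 addn1 modn_small //; clear -h b1 l1; lia.
      by move=> y yn; apply: leq_trans (leI y yn) (ltnW lt_in).
    move=> s2 T2 [[h1 hT2] [kw2 ka2 kr2 kx2]]; split=> /=.
    + move=> y yn; rewrite h1 // nE sumE' hi i1 //=.
      by case: (nearB s i y); rewrite ?addn1 ?addn0.
    + move=> x; rewrite (kx2 x_rho isT) ltnS leq_eqVlt => /orP[/eqP ->|xi]; last exact: i2.
      by rewrite hi i3.
    + by move=> x ix; rewrite (kx2 x_rho isT); apply: i3; apply: ltnW.
    + by rewrite sumE hi mulnDl mul1n; clear -hT hT2; lia.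
  apply: wp_run; rewrite /= mod2 si (kw v_k isT) (kr r_max isT) gk.
  have hi' : hasB s i = false by clear -hi; lia.
  split=> /=.
  + by move=> y yn; rewrite sumE' hi' addn0 i1.
  + move=> x; rewrite ltnS leq_eqVlt => /orP[/eqP ->|xi]; first by rewrite eqxx hi'.
    by rewrite ifF; [apply: i2|apply/eqP; clear -xi; lia].
  + by move=> x ix; rewrite ifF; [apply: i3; apply: ltnW|apply/eqP; clear -ix; lia].
  + by rewrite sumE hi' addn0; clear -hT; lia.
- move=> s1 T _ _ [i1 i2 i3 hT]; split=> //.
  by move: (\sum_(x < n) hasB s x)%N hT => S hT /=; clear -hT; lia.
Qed.

Lemma hit_remove_run s c : envC s -> wvar s v_c = c -> (c < n)%N ->
  (forall y, (y < n)%N -> warr s a_cnt y = (\sum_(x < n) (hasB s x && nearB s x y))%N) ->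
  run B hit_remove s (fun s' T =>
    [/\ forall y, (y < n)%N -> warr s' a_cnt y = (\sum_(x < n) (hasB s' x && nearB s x y))%N,
        forall x, (x < n)%N -> hasB s' x = hasB s x && ~~ nearB s x c
      & (T <= 60 * n + 20 + (\sum_(x < n) (hasB s x && nearB s x c)) * (40 * n + 40))%N]).
Proof.
move=> en sc cn hc; have [b1 b2 b3 b4 b5] := cx_bounds cx.
have /andP[l1 l2] := cx_lf cx.
have [[[[gn _] _ _ _] _] [gm gk] _] := en.
have mod1 : (1 %% B = 1)%N by rewrite modn_small //; clear -b5; lia.
apply: (@run_for _ _ _ _ _ _ n (fun i s' T =>
    [/\ forall y, (y < n)%N -> warr s' a_cnt y = (\sum_(x < n) (hasB s' x && nearB s x y))%N,
        forall x, (x < i)%N -> hasB s' x = hasB s x && ~~ nearB s x c,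
        forall x, (i <= x)%N -> hasB s' x = hasB s x
      & (T <= 60 * i + (\sum_(x < i) (hasB s x && nearB s x c)) * (40 * n + 40))%N])) => //.
- by clear -b1 l1; lia.
- by clear -b5; lia.
- by move=> i s2 [kw _ _ _] _ _; rewrite /= (kw v_n isT).
- move=> i s1 T lt_in k1 si [i1 i2 i3 hT].
  have en1 : envC s1 by apply: env_keep k1 en.
  have [kw ka kr kx] := k1.
  have sumE : (\sum_(x < i.+1) (hasB s x && nearB s x c) =
      \sum_(x < i) (hasB s x && nearB s x c) + (hasB s i && nearB s i c))%N.
    by rewrite big_ord_recr.
  have nE : warr s1 a_near = warr s a_near by rewrite (ka a_near isT).
  have idx := idx_bound lt_in cn.
  have mod3 : ((i * n) %% B = i * n)%N by rewrite modn_small //; clear -idx b4; lia.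
  have mod4 : ((i * n + c) %% B = i * n + c)%N by rewrite modn_small //; clear -idx b4; lia.
  apply: run_if => /=; rewrite mod0n si (kw v_n isT) gn (kw v_c isT) sc mod3 mod4 nE -!ltnNge !lt0n.
    rewrite i3 // => /andP[hi ni].
    apply: (@run_seq _ _ _ _ _ (fun s2 t2 => s2 = set_warr s1 a_has i 0%N /\ (t2 <= 3)%N)).
      by apply: wp_run; rewrite /= mod0n si.
    move=> s2 t2 _ [-> ht2]; set s3 := set_warr _ _ _ _.
    have h3 x : hasB s3 x = (x != i) && hasB s1 x by rewrite /=; case: (x == i).
    apply: run_weaken.
      apply: run_keep; apply: (@near_count_run s3 i WSub predn) => //.
        by move=> s' _ /=; rewrite mod1 subn1.
      by move=> y yn; rewrite /= i1 // (sum_bool_le (fun x => hasB s1 x && nearB s x y)).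
    move=> s4 T4 [[h1 hT4] [kw4 ka4 kr4 kx4]].
    have h4 x : hasB s4 x = (x != i) && hasB s1 x by rewrite (ka4 a_has isT) h3.
    split.
    + move=> y yn; rewrite -[warr (set_wvar _ _ _)]/(warr s4) h1 //= nE i1 //.
      have := @sum_upd n (fun x => hasB s1 x && nearB s x y) (fun x => hasB s4 x && nearB s x y) i lt_in.
      rewrite h4 eqxx /= addn0 i3 // hi /=.
      case: (nearB s i y) => /= e.
        rewrite -e ?addn1 //= => v vn /eqP vi; by rewrite h4 vi.
      rewrite -e ?addn0 // => v vn /eqP vi; by rewrite h4 vi.
    + move=> x; rewrite -[warr (set_wvar _ _ _)]/(warr s4) h4 ltnS leq_eqVlt => /orP[/eqP ->|xi].
        by rewrite eqxx ni andbF.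
      by rewrite i2 //; case: eqP => // xi'; move: xi; rewrite xi' ltnn.
    + move=> x ix; rewrite -[warr (set_wvar _ _ _)]/(warr s4) h4 i3 ?(ltnW ix) //.
      by case: eqP => // xi; move: ix; rewrite xi ltnn.
    + rewrite sumE hi ni; move: (\sum_(x < i) (hasB s x && nearB s x c))%N hT => S hT.
      by rewrite /= mulnDl mul1n; clear -hT ht2 hT4; lia.
  rewrite i3 // => hn; have {}hn : hasB s i && nearB s i c = false.
    by apply/negbTE.
  apply: wp_run; split=> //=.
  + move=> x; rewrite ltnS leq_eqVlt => /orP[/eqP ->|xi]; last exact: i2.
    by rewrite i3 //; move: hn; case: (hasB s i) => //= ->.
  + by move=> x ix; apply: i3; apply: ltnW.
  + rewrite sumE hn addn0; move: (\sum_(x < i) (hasB s x && nearB s x c))%N hT => S hT.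
    by clear -hT; lia.
- move=> s1 T _ _ [i1 i2 i3 hT]; split=> //.
  by move: (\sum_(x < n) (hasB s x && nearB s x c))%N hT => S hT /=; clear -hT; lia.
Qed.

Definition hit_time := (dij_time n m q + 400 * n + 200)%N.

(** Greedy hitting set. Every round hits at least a 1/t fraction of the remaining sets, and its
    search is charged to the sets that it removes, so the total time is at most the number of sets
    times [hit_time]. *)
Lemma hit_loop_run s :
  envC s -> (forall v, (v < 2 * n)%N -> mask s v) ->
  (forall x, (x < n)%N -> hasB s x -> (n <= t * \sum_(y < n) nearB s x y)%N) ->
  (forall y, (y < n)%N -> warr s a_cnt y = (\sum_(x < n) (hasB s x && nearB s x y))%N) ->
  (forall y, (y < n)%N -> (warr s a_cnt y <= wvar s v_q)%N) ->
  (wvar s v_q != 0%N -> (wvar s v_c < n)%N /\ warr s a_cnt (wvar s v_c) = wvar s v_q) ->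
  run B hit_loop s (fun s' T => exists j,
    [/\ forall x, (x < n)%N -> hasB s x -> exists h, [/\ (h < n)%N, nearB s x h & full_tree s' h],
        (marks s' <= marks s + 2 * n * j)%N,
        j = 0%N \/ (t ^ j.-1 <= n * t.-1 ^ j.-1)%N
      & (T <= (\sum_(x < n) hasB s x) * hit_time + 10)%N]).
Proof.
move=> en hm hbig hcnt hmaxq hargq.
have [b1 b2 b3 b4 b5] := cx_bounds cx.
have /andP[t1 tn] := cx_t cx; have n1 := cx_n cx.
set u0 := (\sum_(x < n) hasB s x)%N.
pose un (s1 : state R) := (\sum_(x < n) hasB s1 x)%N.
(* The last conjunct is the decay by (1 - 1/t)^j, written without division; [j] counts the picks. *)
pose J mu (s1 : state R) T := exists j,
  [/\ mu = un s1 /\ (T + mu * hit_time <= u0 * hit_time)%N,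
      (forall y, (y < n)%N -> warr s1 a_cnt y = (\sum_(x < n) (hasB s1 x && nearB s x y))%N) /\
      (forall y, (y < n)%N -> (warr s1 a_cnt y <= wvar s1 v_q)%N),
      (wvar s1 v_q != 0%N -> (wvar s1 v_c < n)%N /\ warr s1 a_cnt (wvar s1 v_c) = wvar s1 v_q),
      (forall x, (x < n)%N -> hasB s1 x -> hasB s x) /\
      (forall x, (x < n)%N -> hasB s x -> hasB s1 x \/
         exists h, [/\ (h < n)%N, nearB s x h & full_tree s1 h]) &
      [/\ (marks s1 <= marks s + 2 * n * j)%N, j = 0%N \/ (t ^ j.-1 <= n * t.-1 ^ j.-1)%N
        & (un s1 * t ^ j <= n * t.-1 ^ j)%N]].
apply: (@run_while _ _ _ _ _ J u0).
- exists 0%N; split=> //.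
  + by split=> // x xn hx; left.
  + split; [by rewrite muln0 addn0|by left|].
    by rewrite !expn0 !muln1; apply: (sum_bool_le (fun x => hasB s x)).
- move=> mu s1 T k1 [j [[emu hT] [c1 c2] c3 [h1 h2] [m1 m2 m3]]] /=.
  rewrite mod0n -ltnNge lt0n => vq.
  have en1 : envC s1 by apply: env_keep k1 en.
  have [kw ka kr kx] := k1.
  have nE : warr s1 a_near = warr s a_near by rewrite (ka a_near isT).
  have [cn cq] := c3 vq; set c := wvar s1 v_c in cn cq.
  apply: run_seq.
    apply: (dij_correct cx (c := c) (U := xpredT) (s := s1)) => //.
    by move=> v vn; rewrite /mask (ka a_mask isT); split; apply: hm; clear -vn; lia.
  move=> s2 T2 k2 [D2 hT2].
  have en2 : envC s2 by apply: env_keep k2 en1.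
  have [kw2 ka2 kr2 kx2] := k2.
  apply: (run_seq (mark_all_run en2)) => s3 T3 k3 [w1 w2 w3 hT3].
  have en3 : envC s3 by apply: env_keep k3 en2.
  have [kw3 ka3 kr3 kx3] := k3.
  have H3 : warr s3 a_has = warr s1 a_has by rewrite (ka3 a_has isT) (ka2 a_has isT).
  have N3 : warr s3 a_near = warr s a_near by rewrite (ka3 a_near isT) (ka2 a_near isT).
  have C3 : warr s3 a_cnt = warr s1 a_cnt by rewrite (ka3 a_cnt isT) (ka2 a_cnt isT).
  apply: run_seq.
    apply: (@hit_remove_run s3 c en3) => //.
      by rewrite (kw3 v_c isT) (kw2 v_c isT).
    by move=> y yn; rewrite C3 H3 N3 c1.
  move=> s4 T4 k4 [r1 r2 hT4].
  have en4 : envC s4 by apply: env_keep k4 en3.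
  have [kw4 ka4 kr4 kx4] := k4.
  apply: run_weaken; first by apply: run_keep; exact: (hit_pick_run en4).
  move=> s5 T5 [[p1 p2 hT5] [kw5 ka5 kr5 kx5]].
  have H5 : warr s5 a_has = warr s4 a_has by rewrite (ka5 a_has isT).
  have C5 : warr s5 a_cnt = warr s4 a_cnt by rewrite (ka5 a_cnt isT).
  have O5 : warr s5 a_out = warr s3 a_out by rewrite (ka5 a_out isT) (ka4 a_out isT).
  have oo e : warr s1 a_out e != 0%N -> warr s5 a_out e != 0%N.
    by rewrite O5 -(ka2 a_out isT); apply: w1.
  rewrite H3 N3 in r2; rewrite N3 in r1; rewrite H3 N3 -c1 // cq in hT4.
  have uE : (un s5 + wvar s1 v_q = un s1)%N.
    rewrite -cq c1 // /un H5 -big_split /=; apply: eq_bigr => x _; rewrite r2 //.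
    by case: (hasB s1 x) => //=; case: (nearB s x c).
  (* Double counting of incidences: [n * un <= t * sum_x |near x| = t * sum_y cnt y <= t * n * v_q],
     with sums over the unhit sets. *)
  have ub : (un s1 <= t * wvar s1 v_q)%N.
    have : (un s1 * n <= t * wvar s1 v_q * n)%N.
      apply: (@leq_trans (\sum_(x < n) t * \sum_(y < n) (hasB s1 x && nearB s x y))%N).
        rewrite /un big_distrl /=; apply: leq_sum => x _.
        case: (boolP (hasB s1 x)) => hx; last by rewrite mul0n.
        by rewrite mul1n; apply: hbig => //; apply: h1.
      rewrite -big_distrr /= exchange_big /= -mulnA leq_mul2l.
      apply/orP; right; apply: (@leq_trans (\sum_(y < n) wvar s1 v_q)%N).
        by apply: leq_sum => y _; rewrite -c1 // c2.
      by rewrite sum_nat_const card_ord mulnC.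
    by rewrite leq_mul2r; case: (n) n1.
  have u1 : (0 < un s1)%N by rewrite -uE lt0n addn_eq0 negb_and vq orbT.
  exists (un s5); first by rewrite emu -uE; clear -vq; lia.
  exists j.+1; split.
  + split=> //; apply: leq_trans hT; rewrite emu -uE mulnDl.
    have : (hit_time <= wvar s1 v_q * hit_time)%N by rewrite leq_pmull // lt0n.
    have : (T2 + T3 + T4 + T5 + 20 <= wvar s1 v_q * hit_time)%N.
      (* [hit_time] consists of the update cost of one removed set and of the fixed cost of a round;
         the latter is covered because at least one set is removed. *)
      have h40 : (wvar s1 v_q * hit_time = wvar s1 v_q * (40 * n + 40) +
         wvar s1 v_q * (dij_time n m q + 360 * n + 160))%N.
        by rewrite -mulnDr /hit_time; congr (_ * _)%N; clear; lia.
      have : (dij_time n m q + 360 * n + 160 <=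
         wvar s1 v_q * (dij_time n m q + 360 * n + 160))%N by rewrite leq_pmull // lt0n.
      by rewrite h40; clear -hT2 hT3 hT4 hT5; lia.
    by clear; lia.
  + split; first by move=> y yn; rewrite C5 r1 // H5.
    by move=> y yn; rewrite C5; apply: p1.
  + by move=> h; have [p21 p22] := p2 h; rewrite C5.
  + split.
      by move=> x xn; rewrite H5 r2 // => /andP[hx _]; apply: h1.
    move=> x xn hx; case: (h2 x xn hx) => [hx1|[h [hn nh fh]]]; last first.
      right; exists h; split=> //; apply: full_tree_mono fh; exact: oo.
    case: (boolP (nearB s x c)) => nc; last by left; rewrite H5 r2 // hx1.
    right; exists c; split=> //.
    apply: (full_tree_dij D2 cn) => v vN sv pv; rewrite O5; exact: w2.
  + split.
    * have -> : marks s5 = marks s3 by rewrite /marks O5.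
      have e2 : marks s2 = marks s1 by rewrite /marks (ka2 a_out isT).
      by rewrite e2 in w3; rewrite mulnS; clear -w3 m1; lia.
    (* An unhit set was still present before this pick, so the decay bound applies with a left side
       of at least [t ^ j]. *)
    * by right; rewrite /=; apply: leq_trans m3; rewrite leq_pmull.
    * have ut : (un s5 * t <= un s1 * t.-1)%N by move: uE ub t1; clear; nia.
      apply: (@leq_trans (un s1 * t ^ j * t.-1)).
        by rewrite expnS mulnA [(un s1 * t ^ j * t.-1)%N]mulnAC leq_mul2r ut orbT.
      by rewrite expnSr mulnA leq_mul2r m3 orbT.
- move=> mu s1 T k1 [j [[emu hT] [c1 c2] c3 [h1 h2] [m1 m2 m3]]] /=.
  rewrite mod0n -ltnNge lt0n negbK => /eqP vq.
  exists j; split=> //; last by clear -hT; lia.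
  move=> x xn hx; case: (h2 x xn hx) => // hx1.
  (* All counters are 0, so a set still unhit would be empty, against its size of at least n/t. *)
  exfalso; have := hbig x xn hx; rewrite leqNgt => /negP[].
  rewrite big1 ?muln0 //; first exact: ltnW.
  move=> y _; have := c2 y (ltn_ord y); rewrite vq leqn0 c1 // (bigD1 (Ordinal xn)) //= hx1.
  by case: (nearB s x y).
Qed.

Lemma phase2_run s :
  envC s -> (forall v, (v < 2 * n)%N -> mask s v) ->
  (forall x, (x < n)%N -> hasB s x -> (n <= t * \sum_(y < n) nearB s x y)%N) ->
  (forall y, (y < n)%N -> warr s a_cnt y = 0%N) ->
  run B phase2 s (fun s' T => exists j,
    [/\ forall x, (x < n)%N -> hasB s x -> exists h, [/\ (h < n)%N, nearB s x h & full_tree s' h],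
        forall x, (x < n)%N -> rarr s' x_rho x =
          if hasB s x then rarr s x_rho x else 2 * k%:R * rvar s r_max,
        (marks s' <= marks s + 2 * n * j)%N,
        j = 0%N \/ (t ^ j.-1 <= n * t.-1 ^ j.-1)%N
      & (T <= 150 * n + 100 + (\sum_(x < n) hasB s x) * (2 * hit_time))%N]).
Proof.
move=> en hm hbig hz.
apply: (run_seq (hit_init_run en hz)) => s1 T1 k1 [i1 i2 hT1].
have en1 : envC s1 by apply: env_keep k1 en.
have [kw1 ka1 kr1 kx1] := k1.
apply: (run_seq (hit_pick_run en1)) => s2 T2 k2 [p1 p2 hT2].
have en2 : envC s2 by apply: env_keep k2 en1.
have [kw2 ka2 kr2 kx2] := k2.
have H2 : warr s2 a_has = warr s a_has by rewrite (ka2 a_has isT) (ka1 a_has isT).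
have N2 : warr s2 a_near = warr s a_near by rewrite (ka2 a_near isT) (ka1 a_near isT).
have C2 : warr s2 a_cnt = warr s1 a_cnt by rewrite (ka2 a_cnt isT).
have M2 : marks s2 = marks s by rewrite /marks (ka2 a_out isT) (ka1 a_out isT).
apply: run_weaken.
  apply: run_keep; apply: (@hit_loop_run s2 en2).
  - by move=> v vN; rewrite /mask (ka2 a_mask isT) (ka1 a_mask isT); apply: hm.
  - by rewrite H2 N2.
  - by move=> y yn; rewrite C2 H2 N2 i1.
  - by move=> y yn; rewrite C2; apply: p1.
  - by rewrite C2.
move=> s3 T3 [[j [a1 a2 a3 hT3]] [kw3 ka3 kr3 kx3]]; exists j.
rewrite H2 N2 in a1; rewrite M2 in a2; rewrite H2 in hT3.
split=> //.
  by move=> x xn; rewrite (kx3 x_rho isT) (kx2 x_rho isT) i2.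
have : (40 * n + 40 <= hit_time)%N by rewrite /hit_time; clear; lia.
move=> hh; have : ((\sum_(x < n) hasB s x) * (40 * n + 40) <= (\sum_(x < n) hasB s x) * hit_time)%N.
  by rewrite leq_mul2l hh orbT.
rewrite mulnCA [X in (_ <= _ + X)%N]mul2n -addnn; clear -hT1 hT2 hT3; lia.
Qed.

End Hit.

(** * Ball growing at one scale *)

Definition roundtrip_key := RAdd (RGet x_key (V v_y)) (RGet x_key (WAdd (V v_n) (V v_y))).

Definition in_ball :=
  BAnd (BAnd (Nz (G a_seen (V v_y))) (Nz (G a_seen (WAdd (V v_n) (V v_y)))))
    (BNot (BLeR (RAdd (RVar r_rad) (RVar r_step)) roundtrip_key)).

Definition ball_count :=
  WSet v_o (K 0) ;;
  For v_y (V v_n) (If in_ball (WSet v_o (WAdd (V v_o) (K 1))) Skip).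

(** [v_o] is the size of the ball of radius [r_rad + r_step], and [v_p] the number of vertices that
    will pay for it. [v_p] starts at 1 although the open ball of radius 0 is empty, since the centre
    is removed in any case. *)
Definition ball_grow :=
  ((RSet r_rad (RCast (K 0)) ;; WSet v_p (K 1)) ;; ball_count) ;;
  While (Lt (WMul (V v_t) (V v_p)) (V v_o))
    ((RSet r_rad (RAdd (RVar r_rad) (RVar r_step)) ;; WSet v_p (V v_o)) ;; ball_count).

Definition unmask e := WPut a_mask e (K 0) ;; WPut a_mask (WAdd (V v_n) e) (K 0).

Definition ball_remove :=
  unmask (V v_c) ;;
  For v_y (V v_n)
    (If in_ball
       (If (Nz (G a_par (V v_y))) (mark (V v_y)) Skip ;;
        If (Nz (G a_par (WAdd (V v_n) (V v_y)))) (mark (WAdd (V v_n) (V v_y))) Skip ;;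
        If (BNot (BLeR (RVar r_rad) roundtrip_key)) (unmask (V v_y)) Skip)
       Skip).

(** The largest rho is chosen so that every remaining vertex x has rho(x) <= rho(c), which pairs at
    distance at least the step rely on. [v_q] holds one plus the choice, and 0 if nothing
    remains. *)
Definition scale_pick :=
  WSet v_q (K 0) ;;
  For v_y (V v_n)
    (If (BAnd (Nz (G a_mask (V v_y)))
           (BNot (BAnd (Nz (V v_q))
              (BLeR (RGet x_rho (V v_y)) (RGet x_rho (WSub (V v_q) (K 1)))))))
       (WSet v_q (WAdd (V v_y) (K 1))) Skip).

Definition k_pred := RSub (RCast (V v_k)) (RCast (K 1)).

(** The minimum of hi and rho(c)/(k-1): then k - 1 steps stay within rho(c), and a step never
    exceeds the scale. *)
Definition step_size :=
  RSet r_step (RVar r_hi) ;;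
  If (BLeR (RGet x_rho (V v_c)) (RMul k_pred (RVar r_hi)))
    (RSet r_step (RDiv (RGet x_rho (V v_c)) k_pred)) Skip.

Definition scale_step :=
  (WSet v_c (WSub (V v_q) (K 1)) ;; step_size) ;; dij ;; ball_grow ;; ball_remove.

Definition scale :=
  For v_y (V v_n)
    (WPut a_mask (V v_y) (G a_act (V v_y)) ;;
     WPut a_mask (WAdd (V v_n) (V v_y)) (G a_act (V v_y))) ;;
  scale_pick ;;
  While (Nz (V v_q)) (scale_step ;; scale_pick).

Section Scale.
Context {R : realType}.
Variables (n m k t q B : nat) (tl hd : nat -> nat) (wt : nat -> R) (W : R).
Variable adj : nat -> seq nat.
Hypothesis cx : ctx n m k t q B tl hd wt W adj.
Local Notation envC := (env n m k t q tl hd wt adj).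
Local Notation rtwE := (rtw tl hd wt (inside m tl hd xpredT)).
Implicit Types s : state R.

Definition rsn_ s := rsn (sn_ s) (sb_ n s).
Definition rt_ s := rt (ky_ s) (kb_ n s).
Definition ball_size s (r : R) := (\sum_(y < n) (rsn_ s y && (rt_ s y < r)%R))%N.

Lemma in_ball_eval s y : envC s -> wvar s v_y = y -> (y < n)%N ->
  beval B s in_ball = rsn_ s y && (rt_ s y < rvar s r_rad + rvar s r_step).
Proof.
move=> en sy yn; have [b1 b2 b3 b4 b5] := cx_bounds cx.
have /andP[l1 l2] := cx_lf cx.
have [[[[gn _] _ _ _] _] _ _] := en.
have mod1 : ((n + y) %% B = n + y)%N by rewrite modn_small //; clear -yn b1 l1; lia.
by rewrite /= mod0n sy gn mod1 -!ltnNge !lt0n -ltNge.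
Qed.

Lemma ball_count_run s : envC s ->
  run B ball_count s (fun s' T =>
    wvar s' v_o = ball_size s (rvar s r_rad + rvar s r_step) /\ (T <= 60 * n + 20)%N).
Proof.
move=> en; have [b1 b2 b3 b4 b5] := cx_bounds cx.
have /andP[l1 l2] := cx_lf cx.
have [[[[gn _] _ _ _] _] _ _] := en.
have mod1 : (1 %% B = 1)%N by rewrite modn_small //; clear -b5; lia.
apply: (@run_seq _ _ _ _ _ (fun s1 tm => s1 = set_wvar s v_o 0%N /\ (tm <= 2)%N)).
  by apply: wp_run; rewrite /= mod0n.
move=> s1 tm1 _ [-> htm1].
set r := (rvar s r_rad + rvar s r_step)%R.
apply: (@run_for _ _ _ _ _ _ n (fun i s' T =>
  wvar s' v_o = (\sum_(y < i) (rsn_ s y && (rt_ s y < r)%R))%N /\ (T <= 60 * i)%N)) => //.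
- by clear -b1 l1; lia.
- by clear -b5; lia.
- by move=> i s2 [kw _ _ _] _ _; rewrite /= (kw v_n isT).
- by rewrite big_ord0.
- move=> i s2 T lt_in k2 si [oE hT].
  have en2 : envC s2 by apply: env_keep k2 en.
  have [kw ka kr kx] := k2.
  have le_i : (wvar s2 v_o <= i)%N by rewrite oE (sum_bool_le (fun y => rsn_ s y && (rt_ s y < r)%R)).
  have bE : beval B s2 in_ball = rsn_ s i && (rt_ s i < r)%R.
    rewrite (in_ball_eval en2 si lt_in) (kr r_rad isT) (kr r_step isT).
    rewrite /rsn_ /rt_ /rsn /rt /sn_ /sb_ /ky_ /kb_ /seen.
    by rewrite (ka a_seen isT) (kx x_key isT).
  apply: run_if => hb; apply: wp_run; rewrite /= big_ord_recr /= -oE -bE.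
    rewrite hb mod1 modn_small; last by clear -le_i lt_in b1 l1; lia.
    by split=> //; clear -hT; lia.
  by rewrite (negbTE hb) addn0; split=> //; clear -hT; lia.
- by move=> s2 T _ _ [oE hT]; split=> //=; clear -hT htm1; lia.
Qed.

Lemma ball_size_eq s s' r : warr s' a_seen = warr s a_seen -> rarr s' x_key = rarr s x_key ->
  ball_size s' r = ball_size s r.
Proof.
by move=> e1 e2; rewrite /ball_size /rsn_ /rt_ /rsn /rt /sn_ /sb_ /ky_ /kb_ /seen e1 e2.
Qed.

(* The number of growth steps is at most [q], since the ball is multiplied by
   [t >= 2] in each step, and at most [k - 2], since otherwise the ball of
   radius [(k - 1) * step] would contain more than [t ^ (k - 1)] vertices. *)
Lemma ball_grow_run s (st := rvar s r_step) :
  envC s -> (2 <= k)%N ->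
  (t * ball_size s ((k.-1)%:R * st) < n)%N ->
  run B ball_grow s (fun s' T => exists i,
    [/\ (i + 2 <= k)%N, rvar s' r_rad = i%:R * st,
        if i == 0%N then wvar s' v_p = 1%N else wvar s' v_p = ball_size s (i%:R * st),
        (ball_size s (i%:R * st + st) <= t * wvar s' v_p)%N
      & (T <= (q + 2) * (60 * n + 100))%N]).
Proof.
move=> en k2 hbig; have [b1 b2 b3 b4 b5] := cx_bounds cx.
have /andP[l1 l2] := cx_lf cx; have /andP[t1 tn] := cx_t cx; have n1 := cx_n cx.
have [[[[gn _] _ _ _] gt] _ _] := en.
have mod1 : (1 %% B = 1)%N by rewrite modn_small //; clear -b5; lia.
have szn r : (ball_size s r <= n)%N by apply: (sum_bool_le (fun y => rsn_ s y && (rt_ s y < r)%R)).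
apply: (@run_seq _ _ _ _ _ (fun s1 tm =>
   [/\ rvar s1 r_rad = 0, wvar s1 v_p = 1%N, wvar s1 v_o = ball_size s st & (tm <= 60 * n + 30)%N])).
  apply: (@run_seq _ _ _ _ _ (fun s1 tm => s1 = set_wvar (set_rvar s r_rad 0) v_p 1%N /\ (tm <= 5)%N)).
    by apply: wp_run; rewrite /= mod0n mod1.
  move=> s1 tm1 _ [-> htm1].
  apply: run_weaken; first by apply: run_keep; exact: ball_count_run.
  move=> s2 tm2 [[oE htm2] [kw ka kr kx]]; split.
  - by rewrite (kr r_rad isT).
  - by rewrite (kw v_p isT).
  - by rewrite oE /= add0r; apply: ball_size_eq.
  - by clear -htm1 htm2; lia.
move=> s1 tm1 k1 [r1 p1 o1' htm1].
have en1 : envC s1 by apply: env_keep k1 en.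
have [kw1 ka1 kr1 kx1] := k1.
pose J mu (s' : state R) T := exists i, [/\ (i + 2 <= k)%N /\ mu = (k - i)%N, rvar s' r_rad = i%:R * st,
  (t ^ i <= wvar s' v_p <= n)%N /\ (if i == 0%N then wvar s' v_p = 1%N else wvar s' v_p = ball_size s (i%:R * st)),
  wvar s' v_o = ball_size s (i%:R * st + st) & (T <= i * (60 * n + 100))%N].
apply: (@run_while _ _ _ _ _ J k).
- exists 0%N; rewrite subn0 mul0r add0r p1 expn0; split=> //.
  by split=> //; rewrite leqnn ltnW.
- move=> mu s2 T ks2 [i [[ik emu] rE [/andP[p2 pn] pE] oE hT]] /=.
  have en2 : envC s2 by apply: env_keep ks2 en1.
  have [kw2 ka2 kr2 kx2] := ks2.
  rewrite (kw2 v_t isT) (kw1 v_t isT) gt.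
  have tp : (t * wvar s2 v_p <= n * n)%N by apply: leq_mul.
  rewrite [((t * _) %% B)%N]modn_small; last by clear -tp b4; lia.
  rewrite -ltnNge => lt_tp.
  have ik3 : (i.+1 + 2 <= k)%N.
    have [//|ki] := leqP (i.+1 + 2)%N k; exfalso; have ek : k = i.+2 by clear -ik ki; lia.
    move: hbig; rewrite ek /= -natr1 mulrDl mul1r -oE ltnNge => /negP[].
    apply: leq_trans (cx_tk cx) _; rewrite ek expnS leq_mul2l; apply/orP; right.
    by apply: leq_trans (ltnW lt_tp); rewrite expnS leq_mul2l p2 orbT.
  have stE : rvar s2 r_step = st by rewrite (kr2 r_step isT) (kr1 r_step isT).
  apply: (@run_seq _ _ _ _ _ (fun s3 tm =>
      s3 = set_wvar (set_rvar s2 r_rad (i.+1%:R * st)) v_p (wvar s2 v_o) /\ (tm <= 6)%N)).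
    by apply: wp_run; rewrite /= rE stE -natr1 mulrDl mul1r.
  move=> s3 tm3 _ [-> htm3].
  apply: run_weaken; first by apply: run_keep; exact: ball_count_run.
  move=> s4 tm4 [[oE4 htm4] [kw4 ka4 kr4 kx4]].
  have iE : i.+1%:R * st = i%:R * st + st by rewrite -natr1 mulrDl mul1r.
  exists (k - i.+1)%N; first by rewrite emu; clear -ik3; lia.
  exists i.+1; split=> //.
  + by rewrite (kr4 r_rad isT).
  + rewrite (kw4 v_p isT) /= oE iE; split=> //; rewrite szn andbT -oE.
    by apply: leq_trans (ltnW lt_tp); rewrite expnS leq_mul2l p2 orbT.
  + rewrite oE4 /= stE; apply: ball_size_eq => /=.
      by rewrite (ka2 a_seen isT) (ka1 a_seen isT).
    by rewrite (kx2 x_key isT) (kx1 x_key isT).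
  + by rewrite mulSn; clear -hT htm3 htm4; lia.
- move=> mu s2 T ks2 [i [[ik emu] rE [/andP[p2 pn] pE] oE hT]] /=.
  have [kw2 ka2 kr2 kx2] := ks2.
  rewrite (kw2 v_t isT) (kw1 v_t isT) gt.
  have tp : (t * wvar s2 v_p <= n * n)%N by apply: leq_mul.
  rewrite [((t * _) %% B)%N]modn_small; last by clear -tp b4; lia.
  rewrite -ltnNge -leqNgt oE => le_tp.
  exists i; split=> //.
  have iq : (i <= q)%N.
    rewrite -(@leq_exp2l 2) //; apply: (@leq_trans (t ^ i)).
      by case: (i) => // i'; rewrite leq_exp2r.
    by apply: leq_trans p2 _; clear -pn l1; lia.
  have : (i * (60 * n + 100) <= q * (60 * n + 100))%N by rewrite leq_mul2r iq orbT.
  by rewrite mulnDl; clear -hT htm1; lia.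
Qed.

Lemma unmask_run s e y : wvar s v_n = n -> (y < n)%N -> (forall a b, weval B (set_warr s a_mask a b) e = y) ->
  weval B s e = y -> (wcost e <= 3)%N ->
  run B (unmask e) s (fun s' T =>
    s' = set_warr (set_warr s a_mask y 0%N) a_mask (n + y)%N 0%N /\ (T <= 20)%N).
Proof.
move=> sn yn he' he ce; have [b1 b2 b3 b4 b5] := cx_bounds cx.
have /andP[l1 l2] := cx_lf cx.
have mod1 : ((n + y) %% B = n + y)%N by rewrite modn_small //; clear -yn b1 l1; lia.
apply: wp_run; rewrite /= mod0n he he' sn mod1; split=> //; clear -ce; lia.
Qed.

(** A vertex of the outer ball marks at most its two parent edges, one for each direction, whence
    the factor 2. *)
Lemma ball_remove_run s c (r := rvar s r_rad) (rs := r + rvar s r_step) : envC s -> wvar s v_c = c -> (c < n)%N ->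
  (forall v, (v < n)%N -> mask s (n + v)%N = mask s v) ->
  run B ball_remove s (fun s' T =>
    [/\ forall e, warr s a_out e != 0%N -> warr s' a_out e != 0%N,
        forall v w, (v < n)%N -> rsn_ s v -> rt_ s v < rs -> w = v \/ w = (n + v)%N ->
          warr s a_par w != 0%N -> warr s' a_out (edge_of m (warr s a_par w)) != 0%N,
        forall v, (v < n)%N -> mask s' v = [&& mask s v, v != c & ~~ [&& rsn_ s v, rt_ s v < rs & rt_ s v < r]]
          /\ mask s' (n + v)%N = mask s' v,
        (marks m s' <= marks m s + 2 * ball_size s rs)%N
      & (T <= 200 * n + 60)%N]).
Proof.
move=> en sc cn hmm; have [b1 b2 b3 b4 b5] := cx_bounds cx.
have /andP[l1 l2] := cx_lf cx.
have [[[[gn _] _ _ _] _] [gm _] _] := en.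
apply: (@run_seq _ _ _ _ _ (fun s1 tm =>
   s1 = set_warr (set_warr s a_mask c 0%N) a_mask (n + c)%N 0%N /\ (tm <= 20)%N)).
  exact: unmask_run.
move=> s1 tm1 _ [-> htm1]; set s2 := set_warr _ _ _ _.
have en2 : envC s2 by [].
have nv v w : (v < n)%N -> (w < n)%N -> (v == n + w)%N = false.
  by move=> vn wn; apply/eqP; clear -vn wn; lia.
pose gone i v := [&& (v < i)%N, rsn_ s v, rt_ s v < rs & rt_ s v < r].
apply: (@run_for _ _ _ _ _ _ n (fun i s' T =>
    [/\ forall e, warr s a_out e != 0%N -> warr s' a_out e != 0%N,
        forall v w, (v < i)%N -> rsn_ s v -> rt_ s v < rs -> w = v \/ w = (n + v)%N ->
          warr s a_par w != 0%N -> warr s' a_out (edge_of m (warr s a_par w)) != 0%N,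
        forall v, (v < n)%N -> mask s' v = [&& mask s v, v != c & ~~ gone i v]
          /\ mask s' (n + v)%N = mask s' v,
        (marks m s' <= marks m s + 2 * \sum_(y < i) (rsn_ s y && (rt_ s y < rs)%R))%N
      & (T <= 180 * i)%N])).
- by clear -b1 l1; lia.
- by clear -b5; lia.
- by [].
- by move=> i s3 [kw _ _ _] _ _; rewrite /= (kw v_n isT).
- split=> //.
  + move=> v vn; rewrite /mask /= nv // eqn_add2l [(n + v == c)%N]eq_sym nv //.
    have h := hmm v vn; rewrite /mask in h.
    by case: (v == c); rewrite /= ?andbF ?andbT.
  + by rewrite big_ord0 muln0 addn0.
- move=> i s3 T lt_in k3 si [w1 w2 w3 w4 hT].
  have en3 : envC s3 by apply: env_keep k3 en2.
  have [kw ka kr kx] := k3.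
  have [[[[gn3 _] _ _ _] _] [gm3 _] _] := en3.
  have sumE : (\sum_(y < i.+1) (rsn_ s y && (rt_ s y < rs)%R) =
     \sum_(y < i) (rsn_ s y && (rt_ s y < rs)%R) + (rsn_ s i && (rt_ s i < rs)%R))%N.
    by rewrite big_ord_recr.
  have rsE : rsn_ s3 i = rsn_ s i by rewrite /rsn_ /rsn /sn_ /sb_ /seen (ka a_seen isT).
  have rtE : rt_ s3 i = rt_ s i by rewrite /rt_ /rt /ky_ /kb_ (kx x_key isT).
  have pE : warr s3 a_par = warr s a_par by rewrite (ka a_par isT).
  have bE : beval B s3 in_ball = rsn_ s i && (rt_ s i < rs)%R.
    by rewrite (in_ball_eval en3 si lt_in) (kr r_rad isT) (kr r_step isT) rsE rtE.
  have mod1 : ((n + i) %% B = n + i)%N by rewrite modn_small //; clear -lt_in b1 l1; lia.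
  apply: run_if => hb; last first.
    rewrite bE in hb; apply: wp_run; rewrite sumE (negbTE hb) addn0; split=> //.
    + move=> v w; rewrite ltnS leq_eqVlt => /orP[/eqP ->|]; last exact: w2.
      by move=> a1 a2; rewrite a1 a2 in hb.
    + move=> v vn; have [e1 e2] := w3 v vn; split=> //.
      rewrite -[mask (set_wvar _ _ _) v]/(mask s3 v) e1 /gone ltnS [(v <= i)%N]leq_eqVlt.
      have [->|//] := eqVneq v i; rewrite ltnn /=.
      by move: hb; case: (rsn_ s i) => //= /negbTE ->.
    + by clear -hT; rewrite /=; lia.
  rewrite bE in hb; have /andP[ri rti] := hb.
  have mk s4 e y : wvar s4 v_n = n -> wvar s4 v_m = m -> warr s4 a_par = warr s a_par -> weval B s4 e = y -> (wcost e <= 3)%N ->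
      run B (If (Nz (G a_par e)) (mark e) Skip) s4 (fun s5 T =>
        [/\ exists o, s5 = State (wvar s4) (upd (warr s4) a_out o) (rvar s4) (rarr s4) /\
              (forall e, warr s4 a_out e != 0%N -> o e != 0%N),
            warr s a_par y != 0%N -> warr s5 a_out (edge_of m (warr s a_par y)) != 0%N,
            (marks m s5 <= marks m s4 + 1)%N & (T <= 45)%N]).
    move=> g1 g2 g3 he ce; apply: run_if => /=; rewrite mod0n he g3 -ltnNge lt0n => hp.
      apply: run_weaken; first exact: (mark_run cx g2 he ce).
      move=> s5 T5 [-> hT5]; rewrite g3; split.
      - exists (upd (warr s4 a_out) (edge_of m (warr s a_par y)) 1%N); split=> // e' h /=.
        by case: ifP.
      - by rewrite /= eqxx.
      - exact: marks_upd.
      - by clear -hT5 ce; lia.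
    apply: wp_run => /=; split=> //.
    - exists (warr s4 a_out); split=> //; case: (s4) => a b c' d' /=; congr State.
      by apply: funext => a'; rewrite /=; case: eqP => // ->.
    - by move=> h; rewrite h in hp.
    - by rewrite leq_addr.
    - by clear -ce; lia.
  apply: run_seq.
    by apply: (mk s3 (V v_y) i) => //=.
  move=> s4 T4 _ [[p4 [e4 o4]] m4 q4 hT4].
  apply: run_seq.
    apply: (mk s4 (WAdd (V v_n) (V v_y)) (n + i)%N); rewrite ?e4 //=.
    by rewrite gn3 si mod1.
  move=> s5 T5 _ [[p5 [e5 o5]] m5 q5 hT5].
  have oo e : warr s3 a_out e != 0%N -> warr s5 a_out e != 0%N.
    by move=> h; rewrite e5 /=; apply: o5; rewrite e4 /=; apply: o4.
  have o45 e : warr s4 a_out e != 0%N -> warr s5 a_out e != 0%N.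
    by move=> h; rewrite e5 /=; apply: o5.
  have q35 : (marks m s5 <= marks m s + 2 * \sum_(y < i.+1) (rsn_ s y && (rt_ s y < rs)%R))%N.
    rewrite sumE hb; move: (\sum_(y < i) _)%N w4 => S w4; clear -w4 q4 q5; rewrite /=; lia.
  have fin s6 T6 : warr s6 a_out = warr s5 a_out ->
    (forall v, (v < n)%N -> mask s6 v = [&& mask s3 v & ~~ ((v == i) && (rt_ s i < r))]
        /\ mask s6 (n + v)%N = mask s6 v) -> (T6 <= 40)%N ->
    [/\ forall e, warr s a_out e != 0%N -> warr s6 a_out e != 0%N,
        forall v w, (v < i.+1)%N -> rsn_ s v -> rt_ s v < rs -> w = v \/ w = (n + v)%N ->
          warr s a_par w != 0%N -> warr s6 a_out (edge_of m (warr s a_par w)) != 0%N,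
        forall v, (v < n)%N -> mask s6 v = [&& mask s v, v != c & ~~ gone i.+1 v]
          /\ mask s6 (n + v)%N = mask s6 v,
        (marks m s6 <= marks m s + 2 * \sum_(y < i.+1) (rsn_ s y && (rt_ s y < rs)%R))%N
      & (T + (bcost in_ball + (T4 + (T5 + T6))).+1 + (wcost (V v_n) + 8) <= 180 * i.+1)%N].
    move=> e6 h6 hT6; split.
    - by move=> e h; rewrite e6; apply: oo; apply: w1.
    - move=> v w; rewrite ltnS leq_eqVlt e6 => /orP[/eqP ->|vi] a1 a2 a3 a4; last first.
        by apply: oo; apply: (w2 v w).
      by case: a3 => ea; rewrite ea in a4 *; [apply: o45; apply: m4|apply: m5].
    - move=> v vn; have [a1 a2] := h6 v vn; split=> //; have [-> _] := w3 v vn.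
      move: a1 => ->; have [-> _] := w3 v vn; rewrite -!andbA; congr [&& _, _ & _].
      rewrite -negb_or; congr (~~ _); rewrite /gone ltnS [(v <= i)%N]leq_eqVlt.
      have [->|] := eqVneq v i; last by rewrite orbF.
      by rewrite ltnn /= ri rti.
    - by rewrite /marks e6 -/(marks m s5).
    - by clear -hT hT4 hT5 hT6; rewrite /=; lia.
  have w5 : wvar s5 = wvar s3 by rewrite e5 e4.
  have r5 : rvar s5 = rvar s3 by rewrite e5 e4.
  have x5 : rarr s5 = rarr s3 by rewrite e5 e4.
  have k5 : warr s5 a_mask = warr s3 a_mask by rewrite e5 e4.
  have kE : rarr s3 x_key i + rarr s3 x_key (n + i)%N = rt_ s i by rewrite -rtE.
  have hmm3 v : (v < n)%N -> mask s3 (n + v)%N = mask s3 v by move=> vn; have [] := w3 v vn.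
  apply: run_if => /=; rewrite w5 r5 x5 gn3 si mod1 kE (kr r_rad isT) -?ltNge => hr.
    apply: run_weaken.
      by apply: (@unmask_run s5 (V v_y) i) => //; rewrite /= w5.
    move=> s6 T6 [-> hT6].
    apply: (fin (set_warr (set_warr s5 a_mask i 0%N) a_mask (n + i)%N 0%N)) => //; last first.
      by clear -hT6; lia.
    move=> v vn; rewrite /mask /= nv // eqn_add2l [(n + v == i)%N]eq_sym nv // k5 hr andbT.
    have h := hmm3 v vn; rewrite /mask in h.
    by case: (v == i); rewrite /= ?andbF ?andbT.
  apply: wp_run; apply: (fin s5) => // v vn.
  rewrite /mask k5 (negbTE hr) andbF andbT; split=> //; exact: hmm3.
- move=> s3 T _ _ [w1 w2 w3 w4 hT]; split=> //.
  + by move=> v vn; have [-> ->] := w3 v vn; rewrite /gone vn.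
  + by clear -hT htm1; rewrite /=; lia.
Qed.

Lemma scale_pick_run s : envC s ->
  run B scale_pick s (fun s' T =>
    [/\ wvar s' v_q = 0%N -> forall v, (v < n)%N -> ~~ mask s v,
        forall c, wvar s' v_q = c.+1 -> [/\ (c < n)%N, mask s c &
          forall v, (v < n)%N -> mask s v -> rarr s x_rho v <= rarr s x_rho c]
      & (T <= 60 * n + 20)%N]).
Proof.
move=> en; have [b1 b2 b3 b4 b5] := cx_bounds cx.
have /andP[l1 l2] := cx_lf cx.
have [[[[gn _] _ _ _] _] _ _] := en.
have mod1 : (1 %% B = 1)%N by rewrite modn_small //; clear -b5; lia.
apply: (@run_seq _ _ _ _ _ (fun s1 tm => s1 = set_wvar s v_q 0%N /\ (tm <= 2)%N)).
  by apply: wp_run; rewrite /= mod0n.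
move=> s1 tm1 _ [-> htm1].
apply: (@run_for _ _ _ _ _ _ n (fun i s' T =>
    [/\ wvar s' v_q = 0%N -> forall v, (v < i)%N -> ~~ mask s v,
        forall c, wvar s' v_q = c.+1 -> [/\ (c < n)%N, mask s c &
          forall v, (v < i)%N -> mask s v -> rarr s x_rho v <= rarr s x_rho c]
      & (T <= 60 * i)%N])) => //.
- by clear -b1 l1; lia.
- by clear -b5; lia.
- by move=> i s2 [kw _ _ _] _ _; rewrite /= (kw v_n isT).
- move=> i s2 T lt_in [kw ka kr kx] si [i1 i2 hT].
  have mod3 : ((i + 1) %% B = i.+1)%N by rewrite addn1 modn_small //; clear -lt_in b1 l1; lia.
  have mE v : (warr s2 a_mask v != 0%N) = mask s v by rewrite /mask (ka a_mask isT).
  have rE : rarr s2 x_rho = rarr s x_rho by rewrite (kx x_rho isT).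
  apply: wp_run; rewrite /= si mod1 mod0n mod3 rE subn1 -!ltnNge !lt0n mE.
  split=> h; split=> //=; try (clear -hT; lia).
  + have /andP[mi better] := h.
    move=> c [<-]; split=> // v; rewrite ltnS leq_eqVlt => /orP[/eqP ->|vi] mv; first by rewrite lexx.
    case e: (wvar s2 v_q) better => [|c'] better; first by have := i1 e v vi; rewrite mv.
    have [_ _ h3] := i2 c' e; apply: le_trans (h3 v vi mv) _.
    by move: better; rewrite /= -ltNge => /ltW.
  + move=> e v; rewrite ltnS leq_eqVlt => /orP[/eqP ->|]; last exact: i1.
    by move: h; rewrite e eqxx /= andbT.
  + move=> c e; have [h1 h2 h3] := i2 c e; split=> // v.
    rewrite ltnS leq_eqVlt => /orP[/eqP -> mi|]; last exact: h3.
    by move: h; rewrite e mi /= negbK.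
- by move=> s2 T _ _ [i1 i2 hT]; split=> //=; clear -hT htm1; lia.
Qed.

Lemma step_size_run s c : envC s -> wvar s v_c = c ->
  run B step_size s (fun s' T =>
    rvar s' r_step = (if rarr s x_rho c <= (k%:R - 1) * rvar s r_hi
      then rarr s x_rho c / (k%:R - 1) else rvar s r_hi) /\ (T <= 40)%N).
Proof.
move=> en sc; have [b1 b2 b3 b4 b5] := cx_bounds cx.
have [_ [_ gk] _] := en.
have mod1 : (1 %% B = 1)%N by rewrite modn_small //; clear -b5; lia.
by apply: wp_run; rewrite /= sc mod1 gk; split=> [->|/negbTE ->].
Qed.

Variable rho : nat -> R.
Hypothesis rho_ge0 : forall x, (x < n)%N -> active m tl hd x -> 0 <= rho x.
Hypothesis rho_small : forall x, (x < n)%N -> active m tl hd x ->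
  forall (P : pred nat) r, r <= rho x ->
    (forall y, (y < n)%N -> P y -> exists2 d, rtwE x y d & d < r) ->
    (t * (\sum_(y < n) P y) < n)%N.

Definition good s x y d :=
  exists2 d', rtw tl hd wt (out_edge m s) x y d' & d' <= (2 * k%:R - 1) * d.

(** The pairs served by the hitting set. It is applied with [dmax] equal to twice [r_max], the range
    in which the substitute for an infinite rho is large enough. *)
Definition far_good (dmax : R) s := forall x y d, (x < n)%N -> (y < n)%N -> active m tl hd x ->
  rtwE x y d -> d <= dmax -> rho x <= (k%:R - 1) * d -> good s x y d.

Definition unmasked s v := (v < n)%N && mask s v.

(** A pair of this scale not yet served still has a closed walk of the given length among the
    remaining vertices, so later searches in the induced subgraph see it. *)
Definition scale_inv s (lo hi : R) := forall x y d, (x < n)%N -> (y < n)%N -> x <> y ->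
  rtwE x y d -> lo <= d < hi ->
  good s x y d \/
  [/\ rtw tl hd wt (inside m tl hd (unmasked s)) x y d, unmasked s x & unmasked s y].

Lemma good_mono s s' x y d : (forall e, warr s a_out e != 0%N -> warr s' a_out e != 0%N) ->
  good s x y d -> good s' x y d.
Proof.
move=> h [d' w dd]; exists d' => //; apply: rtw_mono w => e.
by rewrite /out_edge => /andP[-> /h].
Qed.

Lemma inside_all U x y d : rtw tl hd wt (inside m tl hd U) x y d -> rtwE x y d.
Proof. by apply: rtw_mono => e; rewrite /inside !andbT => /andP[]. Qed.

Definition mask_size s := (\sum_(v < n) mask s v)%N.

(** With e = 1/(2k), the ratio of scales, k e = 1/2 gives (k-2)(1+e) = k - 3/2 - 2e <= k - 3/2. So r
    <= (k - 3/2) d and 2 (r + d) <= (2k-1) d. *)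
Lemma stretch_bound (lo d r st : R) i : (i + 2 <= k)%N -> 0 < lo -> lo <= d ->
  st <= lo * (1 + (2 * k%:R)^-1) -> r = i%:R * st -> 2 * (r + d) <= (2 * k%:R - 1) * d.
Proof.
move=> ik lo0 lod sth ->.
have k2 : 2 <= k%:R :> R by rewrite ler_nat; clear -ik; lia.
have k0 : 0 < k%:R :> R by apply: lt_le_trans k2.
have ikR : i%:R <= k%:R - 2 :> R by rewrite lerBrDr -natrD ler_nat.
have i0 : 0 <= i%:R :> R by [].
have inv0 : 0 < (2 * k%:R : R)^-1 by rewrite invr_gt0 mulr_gt0.
have e0 : k%:R * (2 * k%:R)^-1 = 2^-1 :> R by rewrite invfM mulrCA divff ?mulr1 // gt_eqF.
set e := (2 * k%:R)^-1 in sth inv0 e0.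
have s1 : i%:R * st <= i%:R * (lo * (1 + e)) by rewrite ler_wpM2l.
have s2 : i%:R * (lo * (1 + e)) <= (k%:R - 2) * (lo * (1 + e)).
  by rewrite ler_wpM2r // mulr_ge0 // ?ltW // addr_gt0.
have s3 : (k%:R - 2) * (lo * (1 + e)) = lo * (k%:R - 2 + 2^-1 - 2 * e).
  by rewrite -e0; ring.
have s4 : lo * (k%:R - 2 + 2^-1 - 2 * e) <= lo * (k%:R - 3 / 2).
  rewrite ler_pM2l //; lra.
have s5 : lo * (k%:R - 3 / 2) <= d * (k%:R - 3 / 2) by rewrite ler_pM2r //; lra.
nra.
Qed.

Definition step_time := (dij_time n m q + (q + 2) * (60 * n + 100) + 200 * n + 200)%N.

(** The quantity [marks + 2 * t * mask_size] does not grow: at most 2 [ball_size (r + st)], hence at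
    most 2 t [v_p], edges are new, and at least [v_p] vertices leave the mask. *)
Lemma scale_step_run s c lo hi dmax :
  envC s -> (2 <= k)%N -> wvar s v_q = c.+1 -> (c < n)%N -> mask s c ->
  (forall v, (v < n)%N -> mask s v -> active m tl hd v /\ rho v <= rho c) ->
  (forall v, (v < n)%N -> mask s (n + v)%N = mask s v) ->
  (forall v, (v < n)%N -> rarr s x_rho v = rho v) -> rvar s r_hi = hi ->
  0 < lo -> hi = lo * (1 + (2 * k%:R)^-1) -> hi <= dmax -> far_good dmax s -> scale_inv s lo hi ->
  run B scale_step s (fun s' T =>
    [/\ scale_inv s' lo hi,
        forall e, warr s a_out e != 0%N -> warr s' a_out e != 0%N,
        forall v, (v < n)%N -> (mask s' v -> mask s v) /\ mask s' (n + v)%N = mask s' v,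
        (mask_size s' < mask_size s)%N /\
          (marks m s' + 2 * t * mask_size s' <= marks m s + 2 * t * mask_size s)%N
      & (T <= step_time)%N]).
Proof.
move=> en k2 sq cn mc hact hmm hrho shi lo0 ehi hidm far inv.
have [b1 b2 b3 b4 b5] := cx_bounds cx.
have mod1 : (1 %% B = 1)%N by rewrite modn_small //; clear -b5; lia.
have [ac _] := hact c cn mc.
have k1 : 0 < k%:R - 1 :> R by rewrite subr_gt0 ltr1n.
have kp : k%:R - 1 = k.-1%:R :> R.
  by have := prednK (cx_k cx) => e; rewrite -{1}e -natr1 addrK.
have hi0 : 0 < hi by rewrite ehi mulr_gt0 // addr_gt0 // invr_gt0 mulr_gt0 // ltr0n (cx_k cx).
pose st := if rho c <= (k%:R - 1) * hi then rho c / (k%:R - 1) else hi.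
have st0 : 0 <= st.
  by rewrite /st; case: ifP => _; rewrite ?(ltW hi0) // divr_ge0 ?rho_ge0 // ltW.
have sthi : st <= hi by rewrite /st; case: ifP => // h; rewrite ler_pdivrMr // mulrC.
have strho : k.-1%:R * st <= rho c.
  rewrite -kp /st; case: ifP => [_|/negbT]; first by rewrite mulrC divfK // gt_eqF.
  by rewrite -ltNge => /ltW.
apply: (@run_seq _ _ _ _ _ (fun s1 tm => [/\ wvar s1 v_c = c, rvar s1 r_step = st & (tm <= 50)%N])).
  apply: (@run_seq _ _ _ _ _ (fun s1 tm => s1 = set_wvar s v_c c /\ (tm <= 4)%N)).
    by apply: wp_run; rewrite /= mod1 sq subn1.
  move=> s1 tm1 _ [-> htm1]; apply: run_weaken.
    by apply: run_keep; apply: (@step_size_run _ c).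
  move=> s2 tm2 [[h htm2] [kw _ _ _]]; split.
  - by rewrite (kw v_c isT).
  - by rewrite h /= hrho // shi.
  - by clear -htm1 htm2; lia.
move=> s1 tm1 ks1 [c1 st1 htm1].
have en1 : envC s1 by apply: env_keep ks1 en.
have [kw1 ka1 kr1 kx1] := ks1.
have M1 v : mask s1 v = mask s v by rewrite /mask (ka1 a_mask isT).
apply: run_seq.
  apply: (dij_correct cx (c := c) (U := unmasked s) (s := s1)) => //.
    by rewrite /unmasked cn.
  by move=> v vn; rewrite !M1 /unmasked vn hmm.
move=> s2 tm2 ks2 [[bc pq nq] htm2].
have en2 : envC s2 by apply: env_keep ks2 en1.
have [kw2 ka2 kr2 kx2] := ks2.
have st2 : rvar s2 r_step = st by rewrite (kr2 r_step isT).
have rtE y : (y < n)%N -> rsn_ s2 y -> rtwE c y (rt_ s2 y).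
  move=> yn ry; apply: inside_all.
  exact: (rt_walk (cx_tl cx) (cx_hd cx) (cx_W cx) (cx_wt cx) bc).
apply: run_seq.
  apply: (@ball_grow_run s2 en2 k2); rewrite st2.
  (* Distances in the induced subgraph are attained by walks of the whole graph, so the size bound
     for balls of radius up to [rho c] carries over. *)
  apply: (rho_small cn ac (r := k.-1%:R * st) (P := fun y => rsn_ s2 y && (rt_ s2 y < k.-1%:R * st))) => //.
  by move=> y yn /andP[ry rty]; exists (rt_ s2 y) => //; apply: rtE.
rewrite st2; move=> s3 tm3 ks3 [i [ik rad3 p3 out3 htm3]].
have en3 : envC s3 by apply: env_keep ks3 en2.
have [kw3 ka3 kr3 kx3] := ks3.
have st3 : rvar s3 r_step = st by rewrite (kr3 r_step isT).
have M3 v : mask s3 v = mask s v by rewrite -M1 /mask (ka3 a_mask isT) (ka2 a_mask isT).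
have rsn3 : rsn_ s3 = rsn_ s2 by rewrite /rsn_ /rsn /sn_ /sb_ /seen (ka3 a_seen isT).
have rt3 : rt_ s3 = rt_ s2 by rewrite /rt_ /rt /ky_ /kb_ (kx3 x_key isT).
have par3 : warr s3 a_par = warr s2 a_par by rewrite (ka3 a_par isT).
have out30 : warr s3 a_out = warr s a_out.
  by rewrite (ka3 a_out isT) (ka2 a_out isT) (ka1 a_out isT).
set r := i%:R * st in rad3 out3 p3.
have r0 : 0 <= r by rewrite mulr_ge0.
apply: run_weaken.
  apply: (@ball_remove_run s3 c en3) => //.
  - by rewrite (kw3 v_c isT) (kw2 v_c isT).
  - by move=> v vn; rewrite !M3 hmm.
rewrite rad3 st3 rsn3 rt3 par3 out30.
move=> s4 tm4 [w1 w2 w3 w4 htm4].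
have sz3 : ball_size s3 (r + st) = ball_size s2 (r + st) by rewrite /ball_size rsn3 rt3.
have mk3 : marks m s3 = marks m s by rewrite /marks out30.
rewrite sz3 mk3 in w4.
have rsnM v : (v < n)%N -> rsn_ s2 v -> mask s v.
  move=> vn /andP[sv _]; have [[_ hU _ _] _] := bc.
  by have := hU v vn sv; rewrite /unmasked vn.
(* The program tests the inner radius only within the outer ball; as [0 <= st], the outer condition
   follows from the inner one. *)
have M4 v : (v < n)%N -> mask s4 v = [&& mask s v, v != c & ~~ (rsn_ s2 v && (rt_ s2 v < r))].
  move=> vn; have [-> _] := w3 v vn; rewrite M3; congr [&& _, _ & ~~ (_ && _)].
  by apply/andb_idl => h; apply: lt_le_trans h _; rewrite lerDl.
have szlt : (mask_size s4 + 1 <= mask_size s)%N.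
  have <- : (\sum_(v < n) (v == c :> nat) = 1)%N.
    rewrite (bigD1 (Ordinal cn)) //= eqxx big1 // => v.
    by case: (eqVneq (val v) c) => // e /eqP[]; apply: val_inj.
  rewrite /mask_size -big_split /=; apply: leq_sum => v _; rewrite M4 //.
  case: (boolP (v == c :> nat)) => [/eqP e|_]; first by rewrite e mc andbF.
  by rewrite /= addn0; case: (mask s v) => //=; case: (~~ _).
have cinle : (mask_size s4 + wvar s3 v_p <= mask_size s)%N.
  move: p3; case: eqP => [_ -> //|_ ->].
  rewrite /mask_size /ball_size -big_split /=; apply: leq_sum => v _; rewrite M4 //.
  case: (boolP (rsn_ s2 v)) => rv /=; last by rewrite addn0; case: (mask s v); case: (_ != _).
  by rewrite (rsnM v) //=; case: (_ < _); case: (_ != _).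
split.
- move=> x y d xn yn xy w dlo; case: (inv x y d xn yn xy w dlo) => [g|[wU Ux Uy]].
    by left; apply: good_mono g.
  have [ax rx] : active m tl hd x /\ rho x <= rho c by apply: hact => //; case/andP: Ux.
  (* If [st <= d < hi], the step is not hi but rho(c)/(k-1), so rho(x) <= rho(c) <= (k-1) d and the
     hitting set serves the pair. If [d < st], the ball argument of [rt_remove] applies. *)
  have [dst|std] := ltP d st; last first.
    have /andP[_ dhi] := dlo.
    left; apply: (@good_mono s) => //; apply: far => //; first exact: le_trans (ltW dhi) hidm.
    apply: le_trans rx _.
    move: std; rewrite /st; case: ifP => [_|_ h]; last by rewrite ltNge h in dhi.
    by rewrite ler_pdivrMr // mulrC.
  have : (rtw tl hd wt (inside m tl hd (unmasked s4)) x y d /\ unmasked s4 x /\ unmasked s4 y) \/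
    exists2 d', rtw tl hd wt (out_edge m s4) x y d' & d' <= 2 * (r + d).
    apply: (rt_remove (cx_tl cx) (cx_hd cx) (cx_W cx) (cx_wt cx) bc _ _ _ wU Ux Uy dst) => //.
    + move=> v e vn rv rtv em; rewrite /out_edge em /= /pr_ /pb_ => -[pe|pe].
        have := w2 v v vn rv rtv (or_introl erefl); rewrite pe => /(_ isT).
        by rewrite /edge_of /= leqNgt em.
      have := w2 v (n + v)%N vn rv rtv (or_intror erefl); rewrite pe => /(_ isT).
      by rewrite /edge_of /= leq_addr addKn.
    + move=> v vn; rewrite /unmasked vn /= M4 // => -> /=.
      rewrite negb_and !negbK => /orP[/eqP ->|/andP[rv /ltW //]].
      have [[[sc kc] _ _ _] [[sc' kc'] _ _ _]] := bc.
      by rewrite /rsn sc sc' /rt kc kc' addr0.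
    + by move=> v /andP[].
  case=> [[h1 [h2 h3]]|[d' w' hd']]; [by right|left].
  exists d' => //; apply: le_trans hd' _.
  have /andP[lod _] := dlo.
  by apply: (stretch_bound ik lo0 lod) (erefl r); rewrite -ehi.
- exact: w1.
- by move=> v vn; split; [rewrite M4 // => /andP[]|have [_ ->] := w3 v vn].
- split; first by rewrite -addn1.
  have : (2 * ball_size s2 (r + st) <= 2 * t * wvar s3 v_p)%N.
    by rewrite -mulnA leq_mul2l out3.
  have : (2 * t * (mask_size s4 + wvar s3 v_p) <= 2 * t * mask_size s)%N by rewrite leq_mul2l cinle orbT.
  by rewrite mulnDr; clear -w4; lia.
- by rewrite /step_time; clear -htm1 htm2 htm3 htm4; lia.
Qed.

End Scale.

(** * All scales in geometric progression *)

Definition phase3 :=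
  RSet r_lo (RCast (K 1)) ;;
  While (BAnd (BLeW (K 2) (V v_k)) (BLeR (RVar r_lo) (RVar r_max)))
    (RSet r_hi (RMul (RVar r_lo)
       (RAdd (RCast (K 1)) (RDiv (RCast (K 1)) (RMul (RCast (K 2)) (RCast (V v_k)))))) ;;
     scale ;;
     RSet r_lo (RVar r_hi)).

Section Phase3.
Context {R : realType}.
Variables (n m k t q B : nat) (tl hd : nat -> nat) (wt : nat -> R) (W : R).
Variable adj : nat -> seq nat.
Hypothesis cx : ctx n m k t q B tl hd wt W adj.
Local Notation envC := (env n m k t q tl hd wt adj).
Local Notation rtwE := (rtw tl hd wt (inside m tl hd xpredT)).
Local Notation act := (active m tl hd).
Local Notation goodC := (good m k tl hd wt).
Local Notation far_goodC := (far_good n m k tl hd wt).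
Implicit Types s : state R.
Variable rho : nat -> R.
Hypothesis rho_ge0 : forall x, (x < n)%N -> act x -> 0 <= rho x.
Hypothesis rho_small : forall x, (x < n)%N -> act x ->
  forall (P : pred nat) r, r <= rho x ->
    (forall y, (y < n)%N -> P y -> exists2 d, rtwE x y d & d < r) ->
    (t * (\sum_(y < n) P y) < n)%N.

Lemma active_edge e : (e < m)%N -> act (tl e) /\ act (hd e).
Proof.
move=> em; split; apply/hasP; exists e; rewrite ?mem_iota //= ?eqxx ?orbT //.
Qed.

Lemma walk_active (A : pred nat) u v l : (forall e, A e -> (e < m)%N) -> walk tl hd wt A u v l ->
  u = v \/ (act u /\ act v).
Proof.
move=> Am; elim=> [w|w e d _ IH /Am em]; first by left.
have [at' ah] := active_edge em; right; split=> //.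
by case: IH => [->|[]].
Qed.

Definition act_count := (\sum_(v < n) act v)%N.
Definition scale_time := (60 * n + 100 + act_count * (step_time n m q + 60 * n + 50))%N.

(** The potential of [scale_step_run] starts at no more than the old marks plus 2 t n. Each step
    removes its centre, so the active vertices bound the number of steps, and an empty mask leaves
    every pair of the scale served. *)
Lemma scale_run s lo hi dmax :
  envC s -> (2 <= k)%N -> (forall v, (v < n)%N -> rarr s x_rho v = rho v) ->
  rvar s r_hi = hi -> 0 < lo -> hi = lo * (1 + (2 * k%:R)^-1) -> hi <= dmax -> far_goodC rho dmax s ->
  run B scale s (fun s' T =>
    [/\ forall x y d, (x < n)%N -> (y < n)%N -> x <> y -> rtwE x y d -> lo <= d < hi -> goodC s' x y d,
        forall e, warr s a_out e != 0%N -> warr s' a_out e != 0%N,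
        (marks m s' <= marks m s + 2 * t * n)%N & (T <= scale_time + 50 * n)%N]).
Proof.
move=> en k2 hrho shi lo0 ehi hidm far.
have [b1 b2 b3 b4 b5] := cx_bounds cx.
have /andP[l1 l2] := cx_lf cx.
have [[[[gn _] _ _ _] _] _ hact] := en.
apply: (@run_seq _ _ _ _ _ (fun s1 tm =>
   (forall v, (v < n)%N -> mask s1 v = act v /\ mask s1 (n + v)%N = act v) /\ (tm <= 30 * n + 20)%N)).
  apply: (@run_for _ _ _ _ _ _ n (fun i s1 T =>
     (forall v, (v < i)%N -> mask s1 v = act v /\ mask s1 (n + v)%N = act v) /\ (T <= 30 * i)%N)) => //.
  - by clear -b1 l1; lia.
  - by clear -b5; lia.
  - by move=> i s2 [kw _ _ _] _ _; rewrite /= (kw v_n isT).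
  - move=> i s2 T lt_in [kw ka kr kx] si [h hT].
    have mod1 : ((n + i) %% B = n + i)%N by rewrite modn_small //; clear -lt_in b1 l1; lia.
    have aE : warr s2 a_act = warr s a_act by rewrite (ka a_act isT).
    apply: wp_run; rewrite /= si (kw v_n isT) gn mod1 aE; split; last by clear -hT; lia.
    move=> v vi; rewrite /mask /= eqn_add2l.
    have e1 : (v == n + i)%N = false by apply/eqP; clear -vi lt_in; lia.
    have e2 : (n + v == i)%N = false by apply/eqP; clear -vi lt_in; lia.
    rewrite e1 e2; have [->|vi'] := eqVneq v i; first by rewrite hact.
    by apply: h; move/eqP: vi'; clear -vi; lia.
  - by move=> s2 T _ _ [h hT]; split=> //=; clear -hT; lia.
move=> s1 tm1 ks1 [hm htm1].
have en1 : envC s1 by apply: env_keep ks1 en.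
have [kw1 ka1 kr1 kx1] := ks1.
have out1 : warr s1 a_out = warr s a_out by rewrite (ka1 a_out isT).
apply: (run_seq (scale_pick_run cx en1)) => s2 tm2 ks2 [p1 p2 htm2].
have en2 : envC s2 by apply: env_keep ks2 en1.
have [kw2 ka2 kr2 kx2] := ks2.
have out2 : warr s2 a_out = warr s a_out by rewrite (ka2 a_out isT).
have M2 v : mask s2 v = mask s1 v by rewrite /mask (ka2 a_mask isT).
have A0 : mask_size n s2 = act_count.
  by apply: eq_bigr => v _; rewrite M2; have [-> _] := hm v (ltn_ord v).
have An : (act_count <= n)%N by apply: (sum_bool_le act).
pose D := (step_time n m q + 60 * n + 50)%N.
pose J mu s' T := [/\ scale_inv n m k tl hd wt s' lo hi,
  forall e, warr s a_out e != 0%N -> warr s' a_out e != 0%N,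
  forall v, (v < n)%N -> (mask s' v -> act v) /\ mask s' (n + v)%N = mask s' v,
  (marks m s' + 2 * t * mask_size n s' <= marks m s + 2 * t * n)%N /\
    (mu = mask_size n s' /\ T + mu * D <= act_count * D)%N &
  (wvar s' v_q = 0%N -> forall v, (v < n)%N -> ~~ mask s' v) /\
  forall c, wvar s' v_q = c.+1 -> [/\ (c < n)%N, mask s' c &
          forall v, (v < n)%N -> mask s' v -> rho v <= rho c]].
apply: (@run_while _ _ _ _ _ J act_count).
- split.
  + move=> x y d xn yn xy w _; right.
    have [d1 [d2 [w1 w2 _]]] := w.
    have aE e : inside m tl hd xpredT e -> (e < m)%N by case/and3P.
    have [//|[ax ay]] := walk_active aE w1.
    have Ua v : (v < n)%N -> act v -> unmasked n s2 v.
      by move=> vn av; rewrite /unmasked vn M2; have [-> _] := hm v vn.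
    split; [|exact: Ua|exact: Ua].
    apply: rtw_mono w => e /and3P[em _ _]; have [at' ah] := active_edge em.
    by rewrite /inside em !Ua // ?(cx_tl cx) ?(cx_hd cx).
  + by rewrite out2.
  + by move=> v vn; rewrite !M2; have [-> ->] := hm v vn.
  + rewrite A0 /marks out2; split=> //; rewrite leq_add2l leq_mul2l An orbT //.
  + split; first by move=> h v vn; rewrite M2; apply: p1.
    move=> c e; have [c1 c2 c3] := p2 c e; split=> //; first by rewrite M2.
    move=> v vn; rewrite M2 => mv; have := c3 v vn mv.
    by rewrite (kx1 x_rho isT) !hrho.
- move=> mu s3 T ks3 [i1 i2 i3 [i4 [emu hT]] [i5 i6]] /=.
  rewrite mod0n -ltnNge => vq.
  have [c ec] : exists c, wvar s3 v_q = c.+1 by exists (wvar s3 v_q).-1; rewrite prednK.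
  have [cn mc cmax] := i6 c ec.
  have en3 : envC s3 by apply: env_keep ks3 en2.
  have [kw3 ka3 kr3 kx3] := ks3.
  have rho3 : rarr s3 x_rho = rarr s x_rho.
    by rewrite (kx3 x_rho isT) (kx2 x_rho isT) (kx1 x_rho isT).
  apply: run_seq.
    apply: (@scale_step_run _ _ _ _ _ _ _ _ _ _ _ _ cx rho rho_ge0 rho_small s3 c lo hi dmax en3 k2 ec cn mc) => //.
    + by move=> v vn mv; have [h _] := i3 v vn; split; [exact: h|exact: cmax].
    + by move=> v vn; have [_ ->] := i3 v vn.
    + by move=> v vn; rewrite rho3 hrho.
    + by rewrite (kr3 r_hi isT) (kr2 r_hi isT) (kr1 r_hi isT).
    + by move=> x y d xn yn ax w h h'; apply: (good_mono i2); apply: far.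
  move=> s4 tm4 ks4 [j1 j2 j3 [j4 j4'] htm4].
  have en4 : envC s4 by apply: env_keep ks4 en3.
  have [kw4 ka4 kr4 kx4] := ks4.
  apply: run_weaken; first by apply: run_keep; exact: (scale_pick_run cx en4).
  move=> s5 tm5 [[q1 q2 htm5] [kw5 ka5 kr5 kx5]].
  have M5 v : mask s5 v = mask s4 v by rewrite /mask (ka5 a_mask isT).
  have O5 : warr s5 a_out = warr s4 a_out by rewrite (ka5 a_out isT).
  have S5 : mask_size n s5 = mask_size n s4 by apply: eq_bigr => v _; rewrite M5.
  have U5 v : unmasked n s5 v = unmasked n s4 v by rewrite /unmasked M5.
  exists (mask_size n s5); first by rewrite S5 emu.
  split.
  + move=> x y d xn yn xy w dlo; case: (j1 x y d xn yn xy w dlo) => [g|[g1 g2 g3]].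
      by left; apply: good_mono g => e; rewrite O5.
    right; rewrite !U5; split=> //; apply: rtw_mono g1 => e.
    by rewrite /inside !U5.
  + by move=> e h; rewrite O5; apply: j2; apply: i2.
  + move=> v vn; rewrite !M5; have [h1 h2] := j3 v vn; split=> // mv.
    by have [h3 _] := i3 v vn; apply: h3; apply: h1.
  + rewrite S5 /marks O5 -/(marks m s4); split; first by apply: leq_trans j4' i4.
    split=> //; apply: leq_trans hT; rewrite emu.
    have : ((mask_size n s4).+1 * D <= mask_size n s3 * D)%N by rewrite leq_mul2r j4 orbT.
    rewrite mulSn /D; clear -htm4 htm5; lia.
  + split; first by move=> h v vn; rewrite M5; apply: q1.
    move=> c' e; have [c1 c2 c3] := q2 c' e; split=> //; first by rewrite M5.
    move=> v vn; rewrite M5 => mv; have := c3 v vn mv.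
    by rewrite (kx4 x_rho isT) rho3 !hrho.
- move=> mu s3 T ks3 [i1 i2 i3 [i4 [emu hT]] [i5 i6]] /=.
  rewrite mod0n -ltnNge -leqNgt leqn0 => /eqP vq.
  split=> //.
  + move=> x y d xn yn xy w dlo; case: (i1 x y d xn yn xy w dlo) => // -[_ /andP[_ mx] _].
    by rewrite (negbTE (i5 vq x xn)) in mx.
  + by apply: leq_trans i4; rewrite leq_addr.
  + by rewrite /scale_time -/D; clear -hT htm1 htm2; lia.
Qed.

(** Shows that the scales eventually pass [r_max], so that the outer loop ends; the quantitative
    count comes later from [scales_bound]. *)
Lemma bernoulli (e : R) N : 0 <= e -> 1 + N%:R * e <= (1 + e) ^+ N.
Proof.
move=> e0; elim: N => [|N IH]; first by rewrite mul0r addr0 expr0.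
rewrite exprS; apply: (@le_trans _ _ ((1 + e) * (1 + N%:R * e))).
  have N0 : 0 <= N%:R * e * e by rewrite !mulr_ge0.
  rewrite -natr1; lra.
by rewrite ler_wpM2l // addr_ge0.
Qed.

Lemma phase3_run s :
  envC s -> (forall v, (v < n)%N -> rarr s x_rho v = rho v) -> far_goodC rho (2 * rvar s r_max) s ->
  run B phase3 s (fun s' T => exists J,
    [/\ (2 <= k)%N -> forall x y d, (x < n)%N -> (y < n)%N -> x <> y -> rtwE x y d ->
          d <= rvar s r_max -> goodC s' x y d,
        forall e, warr s a_out e != 0%N -> warr s' a_out e != 0%N,
        (marks m s' <= marks m s + J * (2 * t * n))%N,
        J = 0%N \/ (1 + (2 * k%:R)^-1) ^+ J.-1 <= rvar s r_max
      & (T <= J * (scale_time + 50 * n + 50) + 50)%N]).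
Proof.
move=> en hrho far.
have [b1 b2 b3 b4 b5] := cx_bounds cx.
have mod1 : (1 %% B = 1)%N by rewrite modn_small //; clear -b5; lia.
have mod2 : (2 %% B = 2)%N by rewrite modn_small //; clear -b5; lia.
have [_ [_ gk] _] := en.
set e := (2 * k%:R : R)^-1.
have e0 : 0 < e by rewrite invr_gt0 mulr_gt0 // ltr0n (cx_k cx).
have e1 : e <= 1.
  by rewrite /e invf_le1 ?mulr_gt0 ?ltr0n ?(cx_k cx) // -natrM ler1n muln_gt0 (cx_k cx).
set M := rvar s r_max.
have [N hN] : exists N, M < (1 + e) ^+ N.
  exists (Num.bound (`|M| / e)); apply: le_lt_trans (ler_norm M) _.
  apply: lt_le_trans (bernoulli _ (ltW e0)).
  apply: (@lt_trans _ _ (1 + `|M|)); first by rewrite ltrDr.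
  by rewrite ltrD2l -ltr_pdivrMr // archi_boundP // divr_ge0 // ltW.
have lt_iN i : (1 + e) ^+ i <= M -> (i < N)%N.
  move=> h; rewrite ltnNge; apply/negP => Ni.
  have : (1 + e) ^+ N <= (1 + e) ^+ i by rewrite ler_weXn2l // lerDl ltW.
  by move=> h'; move: (le_lt_trans (le_trans h' h) hN); rewrite ltxx.
apply: (@run_seq _ _ _ _ _ (fun s1 tm => s1 = set_rvar s r_lo 1 /\ (tm <= 3)%N)).
  by apply: wp_run; rewrite /= mod1.
move=> s1 tm1 _ [-> htm1]; set s2 := set_rvar s r_lo 1.
have en2 : envC s2 by [].
pose I mu s' T := exists i, [/\ mu = (N - i)%N, rvar s' r_lo = (1 + e) ^+ i,
  forall x y d, (x < n)%N -> (y < n)%N -> x <> y -> rtwE x y d -> d < rvar s' r_lo -> goodC s' x y d,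
  (forall e, warr s a_out e != 0%N -> warr s' a_out e != 0%N) /\
  (marks m s' <= marks m s + i * (2 * t * n))%N &
  (i = 0%N \/ (1 + e) ^+ i.-1 <= M) /\ (T <= i * (scale_time + 50 * n + 50))%N].
apply: (@run_while _ _ _ _ _ I N).
- exists 0%N; rewrite subn0 expr0; split=> //.
  (* Distinct vertices are at roundtrip distance at least 1, so no pair lies below the first
     scale. *)
  + move=> x y d xn yn xy [d1 [d2 [w1 w2 ->]]] /=.
    have aE e' : inside m tl hd xpredT e' -> (e' < m)%N by case/and3P.
    have h1 := walk_ge1 (cx_wt cx) aE w1 xy.
    have h2 := walk_ge0 (cx_wt cx) aE w2.
    by rewrite ltNge ler_wpDr.
  + by rewrite mul0n addn0.
  + by split=> //; left.
- move=> mu s3 T ks3 [i [emu loE hg [ho hmk] [hi hT]]] /=.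
  have [kw3 ka3 kr3 kx3] := ks3.
  rewrite mod2 (kw3 v_k isT) /= gk (kr3 r_max isT) /= => /andP[k2 loM].
  have en3 : envC s3 by apply: env_keep ks3 en2.
  rewrite -/M loE in loM.
  have iN := lt_iN i loM.
  apply: (@run_seq _ _ _ _ _ (fun s4 tm => s4 = set_rvar s3 r_hi ((1 + e) ^+ i.+1) /\ (tm <= 20)%N)).
    by apply: wp_run; rewrite /= mod1 mod2 (kw3 v_k isT) /= gk loE div1r -/e exprSr.
  move=> s4 tm4 _ [-> htm4].
  apply: run_seq.
    apply: (@scale_run _ ((1 + e) ^+ i) ((1 + e) ^+ i.+1) (2 * M)) => //=.
    + by move=> v vn; rewrite (kx3 x_rho isT) hrho.
    + by rewrite exprn_gt0 // addr_gt0.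
    + by rewrite exprSr.
    (* The last scale may overshoot [M], but only by the factor 1 + e <= 2; hence the range 2 [M] of
       the far pairs. *)
    + rewrite exprS; apply: ler_pM => //; [by rewrite addr_ge0 // ltW|by rewrite exprn_ge0 // addr_ge0 // ltW|].
      by rewrite -[2](natrD _ 1 1) lerD2l e1.
    + by move=> x y d xn yn ax w h h'; apply: (@good_mono _ m k tl hd wt s) => //; apply: far.
  move=> s5 tm5 ks5 [g1 g2 g3 htm5].
  have [kw5 ka5 kr5 kx5] := ks5.
  apply: wp_run; rewrite /= (kr5 r_hi isT) /=.
  exists (N - i.+1)%N; first by rewrite emu; clear -iN; lia.
  exists i.+1; split=> //=.
  + move=> x y d xn yn xy w dlt.
    have [dlo|dlo] := ltP d ((1 + e) ^+ i).
      apply: (@good_mono _ m k tl hd wt s3); first by move=> e' h; apply: g2.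
      by apply: hg => //; rewrite loE.
    by apply: g1 => //; rewrite dlo.
  + split; first by move=> e' h; apply: g2; apply: ho.
    by move: g3; rewrite -[marks m (set_rvar s3 _ _)]/(marks m s3) => g3;
      rewrite -[marks m (set_rvar s5 _ _)]/(marks m s5) mulSn; clear -g3 hmk; lia.
  + split; first by right.
    by rewrite mulSn; clear -hT htm4 htm5; lia.
- move=> mu s3 T ks3 [i [emu loE hg [ho hmk] [hi hT]]] /=.
  have [kw3 ka3 kr3 kx3] := ks3.
  rewrite mod2 (kw3 v_k isT) /= gk (kr3 r_max isT) /= => hend.
  exists i; split=> //.
  + move=> k2 x y d xn yn xy w dM; apply: hg => //.
    by move: hend; rewrite k2 /= -ltNge; apply: le_lt_trans.
  + by clear -hT htm1; lia.
Qed.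

End Phase3.

(** * The whole program *)

Definition spanner_core := setup ;; phase1 ;; phase2 ;; phase3.

Section Core.
Context {R : realType}.
Variables (n m k B : nat) (tl hd : nat -> nat) (wt : nat -> R) (W : R).
Hypothesis n1 : (1 < n)%N.
Hypothesis m0 : (0 < m)%N.
Hypothesis k0 : (0 < k)%N.
Hypothesis tlN : forall e, (e < m)%N -> (tl e < n)%N.
Hypothesis hdN : forall e, (e < m)%N -> (hd e < n)%N.
Hypothesis W1 : 1 <= W.
Hypothesis wt1 : forall e, (e < m)%N -> 1 <= wt e <= W.
Hypothesis HB : ((n + m + k + 2) ^ 3 <= B)%N.
Local Notation rtwE := (rtw tl hd wt (inside m tl hd xpredT)).
Local Notation goodC := (good m k tl hd wt).
Implicit Types s : state R.

Definition core_time q J := (100 * 100 * J.+1 * (q + 4) * (n * m))%N.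

(** [A] is the number of active vertices. From [A <= 2 * m] comes A n <= 2nm and from [A <= n] comes
    A m <= nm, so [A] Dijkstra runs cost of order q n m; there are J + 1 such batches up to
    constants. *)
Lemma core_time_bound q A J T1 T2 T3 T4 : (A <= n)%N -> (A <= 2 * m)%N -> (2 ^ q <= 4 * n)%N ->
  (T1 <= 150 * m + (20 * q + 50) * n + 20 * q + 60)%N ->
  (T2 <= 50 * n + 50 + A * near_time n m q)%N ->
  (T3 <= 150 * n + 100 + A * (2 * hit_time n m q))%N ->
  (T4 <= J * (60 * n + 100 + A * (step_time n m q + 60 * n + 50) + 50 * n + 50) + 50)%N ->
  (T1 + (T2 + (T3 + T4)) <= core_time q J)%N.
Proof.
move=> An Am l2.
set X := (n * m)%N; set p := (q + 4)%N.
have nX : (n <= X)%N by rewrite leq_pmulr.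
have mX : (m <= X)%N by rewrite leq_pmull // ltnW.
have AnX : (A * n <= 2 * X)%N.
  by apply: (@leq_trans (2 * m * n)); rewrite ?leq_mul2r ?Am ?orbT // /X; clear; lia.
have AmX : (A * m <= X)%N by rewrite /X leq_mul2r An orbT.
have AX : (A <= X)%N by apply: leq_trans An nX.
have Alf : (A * 2 ^ q <= 8 * X)%N.
  apply: (@leq_trans (A * (4 * n))); first by rewrite leq_mul2l l2 orbT.
  by clear -AnX; lia.
have X1 : (0 < X)%N by apply: leq_trans mX.
have px : (4 * X <= p * X)%N by rewrite leq_mul2r leq_addl orbT.
have qp : (q * X <= p * X)%N by rewrite leq_mul2r leq_addr orbT.
have dijA : (A * dij_time n m q <= 1200 * (p * X))%N.
  have -> : (A * dij_time n m q = (50 * q + 200) * (2 * (A * n) + 2 * (A * m) + 2 * (A * 2 ^ q) + 2 * A))%N.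
    by rewrite /dij_time; move: (2 ^ q)%N => lf; clear; nia.
  have : (2 * (A * n) + 2 * (A * m) + 2 * (A * 2 ^ q) + 2 * A <= 24 * X)%N by clear -AnX AmX AX Alf; lia.
  have -> : (1200 * (p * X) = (50 * q + 200) * (24 * X))%N by rewrite /p; clear; nia.
  by move=> h; rewrite leq_mul2l h orbT.
have pAn : (p * (A * n) <= 2 * (p * X))%N by rewrite [leqRHS]mulnCA leq_mul2l AnX orbT.
have pA : (p * A <= p * X)%N by rewrite leq_mul2l AX orbT.
have nearA : (A * near_time n m q <= 1500 * (p * X))%N.
  have -> : (A * near_time n m q = A * dij_time n m q + 2 * (50 * q + 100) * (A * n) + 100 * A)%N.
    by rewrite /near_time; clear; nia.
  have : (2 * (50 * q + 100) * (A * n) <= 100 * (p * (A * n)))%N.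
    by rewrite [leqRHS]mulnA leq_mul2r /p; apply/orP; right; clear; lia.
  by clear -dijA pAn AX px; lia.
have hitA : (A * (2 * hit_time n m q) <= 3000 * (p * X))%N.
  have -> : (A * (2 * hit_time n m q) = 2 * (A * dij_time n m q) + 800 * (A * n) + 400 * A)%N.
    by rewrite /hit_time; clear; nia.
  by clear -dijA AnX AX px; lia.
have stepA : (A * (step_time n m q + 60 * n + 50) <= 1700 * (p * X))%N.
  have -> : (A * (step_time n m q + 60 * n + 50) = A * dij_time n m q +
     60 * ((q + 2) * (A * n)) + 100 * ((q + 2) * A) + 260 * (A * n) + 250 * A)%N.
    by rewrite /step_time; clear; nia.
  have : ((q + 2) * (A * n) <= p * (A * n))%N by rewrite leq_mul2r /p; apply/orP; right; clear; lia.
  have : ((q + 2) * A <= p * A)%N by rewrite leq_mul2r /p; apply/orP; right; clear; lia.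
  by clear -dijA pAn pA AnX AX px; lia.
move=> h1 h2 h3 h4.
have h4' : (T4 <= J * (1800 * (p * X)) + 50)%N.
  apply: leq_trans h4 _; rewrite leq_add2r leq_mul2l; apply/orP; right.
  by clear -stepA nX X1 px; lia.
have qn : (q * n <= p * X)%N by rewrite leq_mul // /p leq_addr.
have -> : core_time q J = (100 * 100 * (p * X) + J * (100 * 100 * (p * X)))%N.
  by rewrite /core_time -/X -/p; clear; nia.
have : (J * (1800 * (p * X)) <= J * (100 * 100 * (p * X)))%N.
  by rewrite leq_mul2l; apply/orP; right; rewrite leq_mul2r; apply/orP; right.
have q1 : (q <= p * X)%N by apply: leq_trans qp; rewrite leq_pmulr.
by clear -h1 h2 h3 h4' nearA hitA nX mX X1 px qn q1; lia.
Qed.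

Lemma core_run s : input_ok n m k tl hd wt s -> rvar s r_max = 0 ->
  run B spanner_core s (fun s' T => exists q t j J,
    [/\ (2 ^ q <= 4 * n)%N, (1 < t)%N /\ (t = 2 \/ (t.-1 ^ k < n)%N),
        forall x y d, (x < n)%N -> (y < n)%N -> rtwE x y d -> goodC s' x y d,
        [/\ (marks m s' <= 2 * n * j + J * (2 * t * n))%N,
            j = 0%N \/ (t ^ j.-1 <= n * t.-1 ^ j.-1)%N
          & J = 0%N \/ (1 + (2 * k%:R)^-1) ^+ J.-1 <= 2 * (W * n%:R)]
      & (T <= core_time q J)%N]).
Proof.
move=> inp rm.
apply: (run_seq (setup_run n1 m0 k0 tlN hdN W1 wt1 HB inp)) => s1 T1 ks1 [q [t [adj [cx en1 hT1]]]].
have [kw1 ka1 kr1 kx1] := ks1; have [_ _ _ _ z] := inp.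
have /andP[l1 l2] := cx_lf cx; have /andP[t1 tn] := cx_t cx.
pose act := active m tl hd.
pose A := (\sum_(v < n) act v)%N.
have An : (A <= n)%N by apply: (sum_bool_le act).
have Am : (A <= 2 * m)%N by apply: active_sum.
apply: run_seq.
  apply: (phase1_run cx en1); last by rewrite (kr1 r_max isT).
  by move=> a i; rewrite !inE => /orP[/eqP ->|/eqP ->]; rewrite ?(ka1 a_near isT) ?(ka1 a_has isT) z.
move=> s2 T2 ks2 [[N1 N2 N3] M2 hT2].
have en2 := env_keep _ ks2 en1; have {}en2 := en2 isT.
have [kw2 ka2 kr2 kx2] := ks2.
pose has2 x := warr s2 a_has x != 0%N.
have hasact x : (x < n)%N -> has2 x -> act x.
  by move=> xn; apply: contraTT => na; rewrite /has2 N2.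
apply: run_seq.
  apply: (phase2_run cx en2 M2).
    by move=> x xn hx; have [[_ h _] _] := N1 x xn (hasact x xn hx); apply: h.
  by move=> y yn; rewrite (ka2 a_cnt isT) (ka1 a_cnt isT) z.
move=> s3 T3 ks3 [j [H1 H2 H3 H4 hT3]].
have en3 := env_keep _ ks3 en2; have {}en3 := en3 isT.
have [kw3 ka3 kr3 kx3] := ks3.
have mk2 : marks m s2 = 0%N.
  apply: big1 => e _; by rewrite (ka2 a_out isT) (ka1 a_out isT) z.
pose D := rvar s2 r_max.
have D3 : rvar s3 r_max = D by rewrite (kr3 r_max isT).
have [D0 DW] : 0 <= D /\ D <= 2 * (W * n%:R) by apply/andP.
pose rho x := if has2 x then rarr s2 x_rho x else 2 * k%:R * D.
have k1R : 1 <= k%:R :> R by rewrite ler1n.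
have aE e : inside m tl hd xpredT e -> (e < m)%N by case/and3P.
have rtw_ge0 x y d : rtwE x y d -> 0 <= d.
  by move=> [d1 [d2 [w1 w2 ->]]]; rewrite addr_ge0 // ?(walk_ge0 wt1 aE w1) ?(walk_ge0 wt1 aE w2).
have rtw_ge1 x y d : rtwE x y d -> x <> y -> 1 <= d.
  by move=> [d1 [d2 [w1 w2 ->]]] xy; rewrite ler_wpDr ?(walk_ge0 wt1 aE w2) ?(walk_ge1 wt1 aE w1).
have rho0 x : (x < n)%N -> act x -> 0 <= rho x.
  move=> xn ax; rewrite /rho; case: ifP => hx; last by rewrite !mulr_ge0.
  have [[a b _] _] := N1 x xn ax.
  case: (pselect (exists2 y, (y < n)%N & warr s2 a_near (x * n + y)%N != 0%N)) => [[y yn ny]|hn].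
    by have [d w dr] := a y yn ny; apply: le_trans dr; apply: rtw_ge0 w.
  exfalso; move: (b hx); rewrite big1 ?muln0 => [|y _]; first by rewrite leqNgt (ltnW n1).
  apply/eqP; rewrite eqb0; apply/negP => h.
  exact: (hn (ex_intro2 _ _ (val y) (ltn_ord y) h)).
have rhos x : (x < n)%N -> act x -> forall (P : pred nat) r, r <= rho x ->
    (forall y, (y < n)%N -> P y -> exists2 d, rtwE x y d & d < r) ->
    (t * (\sum_(y < n) P y) < n)%N.
  move=> xn ax P r hr hP; have [[_ _ c] _] := N1 x xn ax.
  by apply: (c P r) => // hx; move: hr; rewrite /rho /has2 hx.
have goodle s4 x y d d' : d' <= d -> goodC s4 x y d' -> goodC s4 x y d.
  move=> dd [d2 w h]; exists d2 => //; apply: le_trans h _.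
  by rewrite ler_wpM2l //; lra.
have good0 s4 x d : 0 <= d -> goodC s4 x x d.
  by move=> d0; exists 0; [exact: rtw_refl|rewrite mulr_ge0 //; lra].
have far : far_good n m k tl hd wt rho (2 * rvar s3 r_max) s3.
  move=> x y d xn yn ax w dD; rewrite /rho D3 in dD *; case: ifP => hx hr.
    (* Detour over a pick [h] near [x], at distance d0 <= rho(x): it costs at most d0 + (d0 + d) <=
       2 (k-1) d + d. *)
    have [h [hn nh ft]] := H1 x xn hx.
    have [[a _ _] _] := N1 x xn ax; have [d0 w0 d0r] := a h hn nh.
    have [d1 w1 d1le] := ft x d0 xn (rtw_sym w0).
    have [d2 w2 d2le] := ft y (d0 + d) yn (rtw_trans (rtw_sym w0) w).
    exists (d1 + d2); first exact: rtw_trans (rtw_sym w1) w2.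
    have := le_trans d0r hr; lra.
  (* Here rho(x) = 2 k D. For distinct vertices 1 <= d <= 2 D, so D > 0 and rho(x) > (k-1) d: the
     case is contradictory. *)
  have [->|/eqP xy] := eqVneq x y; first by apply: good0; apply: rtw_ge0 w.
  have d1 := rtw_ge1 _ _ _ w xy; exfalso.
  have e1 : 2 * k%:R * D <= (k%:R - 1) * (2 * D).
    by apply: le_trans hr _; rewrite ler_wpM2l //; lra.
  lra.
apply: run_weaken.
  apply: run_keep; exact: (phase3_run cx rho0 rhos en3 H2 far).
move=> s4 T4 [[J [G1 G2 G3 G4 hT4]] ks4].
exists q, t, j, J; split=> //.
- by split=> //; apply: cx_tmin cx.
- move=> x y d xn yn w.
  have [->|/eqP xy] := eqVneq x y; first by apply: good0; apply: rtw_ge0 w.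
  have ax : act x.
    by have [d1 [d2 [w1 _ _]]] := w; case: (walk_active aE w1) => [|[]].
  have [_ mx] := N1 x xn ax.
  have [d' w' [dd dD]] := mx y d yn w.
  apply: (goodle _ _ _ _ _ dd).
  have [k2|k1] := ltnP 1 k; first by apply: G1 => //; rewrite D3.
  (* For [k = 1] no scale is processed and the hitting set must serve all pairs. Since [n <= t],
     already the one-point set of [x] is too large for a ball of positive radius below rho, so
     rho(x) <= 0 = (k-1) d. *)
  have ek : k = 1%N by clear -k0 k1; lia.
  apply: (good_mono G2); apply: far => //.
    by rewrite D3; apply: le_trans dD _; rewrite ler_peMl // ler1n.
  rewrite ek subrr mul0r leNgt; apply/negP => r0.
  have := rhos x xn ax (pred1 x) (rho x) (lexx _).
  have -> : (\sum_(y < n) pred1 x (val y) = 1)%N.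
    rewrite (bigD1 (Ordinal xn)) //= eqxx big1 // => v.
    by case: (eqVneq (val v) x) => // e /eqP[]; apply: val_inj.
  have := cx_tk cx; rewrite ek expn1 muln1 => nt h.
  suff : (t < n)%N by rewrite ltnNge nt.
  by apply: h => y' _ /eqP ->; exists 0; [exact: rtw_refl|].
- split=> //; first by move: G3 H3; rewrite mk2; clear; lia.
  by case: G4 => [|h]; [left|right; apply: le_trans h _; rewrite D3].
- have hT3' : (T3 <= 150 * n + 100 + A * (2 * hit_time n m q))%N.
    apply: leq_trans hT3 _; rewrite leq_add2l leq_mul2r; apply/orP; right.
    apply: (@leq_sum_nat n has2 act) => x xn.
    by case: (boolP (has2 x)) => // /(hasact x xn) ->.
  exact: (core_time_bound An Am l2 hT1 hT2 hT3' hT4).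
Qed.

End Core.

(** * Back to paths and distances *)

Section Paths.
Context {R : realType} {n : nat}.
Implicit Types (E H : {set 'I_n * 'I_n}) (w : 'I_n * 'I_n -> R) (u v : 'I_n).

Lemma path_length_cons w u x p : path_length w u (x :: p) = w (u, x) + path_length w x p.
Proof. by rewrite /path_length /= big_cons. Qed.

Lemma path_length_rcons w u p x :
  path_length w u (rcons p x) = path_length w u p + w (last u p, x).
Proof.
elim: p u => [|y p IH] u /=.
  by rewrite path_length_cons /path_length !big_nil addr0 add0r.
by rewrite !path_length_cons IH addrA.
Qed.

Lemma path_length_ge0 E w u p : (forall e, e \in E -> 0 <= w e) ->
  path (fun x y => (x, y) \in E) u p -> 0 <= path_length w u p.
Proof.
move=> w0; elim: p u => [|x p IH] u /=; first by rewrite /path_length big_nil.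
by case/andP=> ux xp; rewrite path_length_cons addr_ge0 ?w0 ?IH.
Qed.

(** Distances are infima and may be infinite. An infinite one makes the right side infinite as [t]
    is positive; otherwise paths within e/(2t) of both infima are replaced, which costs an error e,
    and e > 0 is arbitrary. *)
Lemma spanner_of_paths (t : R) E w H : H \subset E -> 0 < t ->
  (forall e, e \in E -> 0 <= w e) ->
  (forall u v p p', dipaths E u v p -> dipaths E v u p' ->
     exists r r', [/\ dipaths H u v r, dipaths H v u r' &
       path_length w u r + path_length w v r' <= t * (path_length w u p + path_length w v p')]) ->
  roundtrip_spanner t E w H.
Proof.
move=> HE t0 w0 hyp; split=> // u v.
have dge0 a b : (0 <= dist E w a b)%E.
  apply: le_ereal_inf_tmp => _ [p [pE _] <-]; rewrite lee_fin.
  exact: path_length_ge0 pE.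
have nNy a b : dist E w a b != -oo%E by rewrite gt_eqF // (lt_le_trans _ (dge0 a b)) // ltNyr.
rewrite /roundtrip_dist.
have [->|fa] := eqVneq (dist E w u v) +oo%E; first by rewrite addye // gt0_muley ?lte_fin // leey.
have [->|fb] := eqVneq (dist E w v u) +oo%E; first by rewrite addey // gt0_muley ?lte_fin // leey.
have fina : dist E w u v \is a fin_num by rewrite ge0_fin_numE // ltey.
have finb : dist E w v u \is a fin_num by rewrite ge0_fin_numE // ltey.
apply/lee_addgt0Pr => e e0.
have e2 : 0 < e / (2 * t) by rewrite divr_gt0 // mulr_gt0.
have [_ [p pE <-] pl] := lb_ereal_inf_adherent e2 fina.
have [_ [p' p'E <-] p'l] := lb_ereal_inf_adherent e2 finb.
have [r [r' [rH r'H rr]]] := hyp u v p p' pE p'E.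
have h1 : (dist H w u v <= (path_length w u r)%:E)%E by apply: ereal_inf_lbound; exists r.
have h2 : (dist H w v u <= (path_length w v r')%:E)%E by apply: ereal_inf_lbound; exists r'.
apply: (le_trans (leeD h1 h2)).
move: pl p'l; rewrite -/(dist E w u v) -/(dist E w v u) -(fineK fina) -(fineK finb).
move=> pl p'l; change (path_length w u r + path_length w v r' <=
  t * (fine (dist E w u v) + fine (dist E w v u)) + e).
rewrite -EFinD lte_fin in pl; rewrite -EFinD lte_fin in p'l.
apply: le_trans rr _.
have -> : t * (fine (dist E w u v) + fine (dist E w v u)) + e =
  t * ((fine (dist E w u v) + e / (2 * t)) + (fine (dist E w v u) + e / (2 * t))).
  by field; rewrite gt_eqF.
by rewrite ler_pM2l // lerD // ltW.
Qed.

End Paths.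

(** * Edge numbers versus pairs of vertices *)

Section EdgeList.
Context {R : realType} {n : nat}.
Variables (E : {set 'I_n * 'I_n}) (w : 'I_n * 'I_n -> R) (es : seq ('I_n * 'I_n)).
Hypothesis ues : uniq es.
Hypothesis esE : es =i E.
Local Notation m := (size es).
Definition tail_of e := nth 0%N [seq val p.1 | p <- es] e.
Definition head_of e := nth 0%N [seq val p.2 | p <- es] e.
Definition weight_of e := nth 0 [seq w p | p <- es] e.

Lemma nth_edge d e : (e < m)%N ->
  [/\ tail_of e = val (nth d es e).1, head_of e = val (nth d es e).2 & weight_of e = w (nth d es e)].
Proof.
by move=> em; rewrite /tail_of /head_of /weight_of !(nth_map d).
Qed.

Lemma index_edge p : p \in E ->
  [/\ (index p es < m)%N, tail_of (index p es) = val p.1, head_of (index p es) = val p.2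
    & weight_of (index p es) = w p].
Proof.
move=> pE; have ps : (index p es < m)%N by rewrite index_mem esE.
by have [-> -> ->] := nth_edge p ps; rewrite nth_index ?esE.
Qed.

Lemma path_walk u p : path (fun x y => (x, y) \in E) u p ->
  walk tail_of head_of weight_of (inside m tail_of head_of xpredT) (val u) (val (last u p))
    (path_length w u p).
Proof.
elim: p u => [|x p IH] u /=; first by rewrite /path_length big_nil => _; exact: Walk0.
case/andP=> ux /IH h; rewrite path_length_cons; apply: walk_cat h.
have [h1 h2 h3 h4] := index_edge ux.
have : inside m tail_of head_of xpredT (index (u, x) es) by rewrite /inside h1.
by move=> /(walk1 tail_of head_of weight_of); rewrite h2 h3 h4.
Qed.

Lemma walk_path (s : state R) u v l : walk tail_of head_of weight_of (out_edge m s) u v l ->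
  forall a : 'I_n, val a = u -> exists p,
    [/\ path (fun x y => (x, y) \in output es s) a p, val (last a p) = v & path_length w a p = l].
Proof.
elim=> [u0 a au|u0 e l' h IH /andP[em oe] a au].
  by exists [::]; rewrite /path_length big_nil.
have [p [p1 p2 p3]] := IH a au.
have [t1 t2 t3] := nth_edge (a, a) em; set pr := nth (a, a) es e in t1 t2 t3.
have lp : last a p = pr.1 by apply: val_inj; rewrite p2 t1.
have prH : pr \in output es s by rewrite inE mem_nth //= index_uniq.
exists (rcons p pr.2); rewrite rcons_path p1 last_rcons path_length_rcons p3 lp.
by rewrite -surjective_pairing prH t2 t3.
Qed.

Lemma card_output (s : state R) : #|output es s| = marks m s.
Proof.
have -> : #|output es s| = size [seq e <- es | warr s a_out (index e es) != 0%N].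
  rewrite -(card_uniqP (filter_uniq _ ues)); apply: eq_card => e.
  by rewrite inE mem_filter andbC.
rewrite size_filter -sum1_count; case ees : es => [|d es'].
  by rewrite big_nil /marks big_ord0.
rewrite -ees (big_nth d) big_mkord big_mkcond /=; apply: eq_bigr => i _.
by rewrite index_uniq //; case: (_ == _).
Qed.

End EdgeList.

(** * Sizes and running times *)

Section Bounds.
Context {R : realType}.

(** Apply ln(1+x) <= x to x = -e/(1+e), for which 1 + x = 1/(1+e), and use 1 + e <= 2. *)
Lemma ln1D_ge (e : R) : 0 <= e <= 1 -> e / 2 <= ln (1 + e).
Proof.
case/andP=> e0 e1; have p : 0 < 1 + e by rewrite ltr_wpDr.
have h : ln (1 + - (e / (1 + e))) <= - (e / (1 + e)).
  by apply: le_ln1Dx; rewrite ltrN2 ltr_pdivrMr // mul1r ltrDr.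
have e3 : 1 + - (e / (1 + e)) = (1 + e)^-1 by field; rewrite gt_eqF.
move: h; rewrite e3 lnV ?posrE // lerN2; apply: le_trans.
by rewrite ler_wpM2l // lef_pV2 ?posrE // -[2](natrD _ 1 1) lerD2l.
Qed.

Lemma ln2_bounds : 2^-1 <= ln (2 : R) <= 1.
Proof.
have e : 2 = 1 + 1 :> R by rewrite -[2](natrD _ 1 1).
apply/andP; split; last by rewrite e; apply: le_ln1Dx; lra.
by rewrite -[X in X <= _]mul1r {2}e; apply: ln1D_ge; rewrite ler01 lexx.
Qed.

(** The hypothesis is 1/n <= (1 - 1/t)^j; take logarithms and use ln(1 - 1/t) <= -1/t. *)
Lemma hits_bound (n t j : nat) : (0 < n)%N -> (1 < t)%N -> (t ^ j <= n * t.-1 ^ j)%N ->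
  j%:R <= t%:R * ln (n%:R : R).
Proof.
move=> n0 t1 h.
have tp : 0 < t%:R :> R by rewrite ltr0n ltnW.
have t1p : 0 < t.-1%:R :> R by rewrite ltr0n; case: t t1 {h tp} => [|[]].
have np : 0 < n%:R :> R by rewrite ltr0n.
have : (t%:R ^+ j : R) <= n%:R * t.-1%:R ^+ j by rewrite -!natrX -natrM ler_nat.
rewrite -ler_ln ?posrE ?mulr_gt0 ?exprn_gt0 // lnM ?posrE ?exprn_gt0 // !lnXn //.
have : ln (t.-1%:R : R) <= ln t%:R - t%:R^-1.
  have -> : t.-1%:R = t%:R * (1 + - t%:R^-1) :> R.
    rewrite mulrDr mulr1 mulrN divff ?gt_eqF // -{2}(prednK (ltnW t1)) -natr1 addrK //.
  have i1 : -1 < - (t%:R^-1 : R) by rewrite ltrN2 invf_lt1 // ltr1n.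
  rewrite lnM ?posrE //; last by rewrite subr_gt0 invf_lt1 // ltr1n.
  by rewrite lerD2l; apply: le_ln1Dx.
move=> /(ler_wMn2r j) h1 h2.
have : j%:R / t%:R <= ln (n%:R : R).
  move: h1 h2; rewrite mulrnBl -[(t%:R^-1) *+ j]mulr_natl; lra.
by rewrite ler_pdivrMr // mulrC.
Qed.

(** By [ln1D_ge] each scale contributes at least 1/(4k) to the logarithm, and ln(2x) <= 2 ln x
    because 2 <= x. *)
Lemma scales_bound (k J : nat) (x : R) : (0 < k)%N -> 2 <= x ->
  (1 + (2 * k%:R)^-1) ^+ J <= 2 * x -> J%:R <= 8 * k%:R * ln x.
Proof.
move=> k0 x2 h.
have kp : 0 < k%:R :> R by rewrite ltr0n.
have xp : 0 < x by apply: lt_le_trans x2.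
set e := (2 * k%:R : R)^-1 in h.
have e0 : 0 < e by rewrite invr_gt0 mulr_gt0.
have e1 : e <= 1 by rewrite /e invf_le1 ?mulr_gt0 // -natrM ler1n muln_gt0.
have hl := @ln1D_ge e; rewrite (ltW e0) e1 in hl; have {}hl := hl isT.
move: h; rewrite -ler_ln ?posrE ?mulr_gt0 ?exprn_gt0 ?addr_gt0 // lnM ?posrE // lnXn ?addr_gt0 //.
have lx : ln (2 : R) <= ln x by rewrite ler_ln ?posrE.
have : (e / 2) *+ J <= ln (1 + e) *+ J by apply: ler_wMn2r.
have -> : (e / 2) *+ J = J%:R / (4 * k%:R).
  by rewrite -mulr_natl /e; field; rewrite gt_eqF.
move=> h1 h2; have : J%:R / (4 * k%:R) <= 2 * ln x by lra.
by rewrite ler_pdivrMr ?mulr_gt0 // => h3; lra.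
Qed.

(** Taking roots in (t-1)^k < n gives t < X + 1 <= 2X; the remaining case t = 2 is covered by 1 <=
    X. *)
Lemma root_bound (n k t : nat) : (1 < n)%N -> (0 < k)%N -> t = 2 \/ (t.-1 ^ k < n)%N ->
  let X := (n%:R : R) `^ k%:R^-1 in
  [/\ 1 <= X, t%:R <= 2 * X & n%:R `^ (1 + k%:R^-1) = n%:R * X].
Proof.
move=> n1 k0 ht X.
have np : 0 < n%:R :> R by rewrite ltr0n ltnW.
have kp : k%:R != 0 :> R by rewrite pnatr_eq0 -lt0n.
have X0 : 0 < X by apply: powR_gt0.
have Xk : X ^+ k = n%:R.
  by rewrite -powR_mulrn ?ltW // -powRrM mulVf // powRr1 // ltW.
have X1 : 1 <= X.
  rewrite leNgt; apply/negP => h; have : X ^+ k < 1 by rewrite exprn_ilt1 ?ltW // -lt0n.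
  by rewrite Xk ltNge ler1n ltnW.
split=> //; last by rewrite powRD ?powRr1 ?(ltW np) // (gt_eqF np) implybT.
case: ht => [->|h]; first by rewrite ler_peMr.
have : t.-1%:R < X.
  rewrite ltNge; apply/negP => hX.
  have : X ^+ k <= t.-1%:R ^+ k by rewrite ler_pXn2r ?nnegrE // ltW.
  by rewrite Xk -natrX ler_nat leqNgt h.
have : t%:R <= t.-1%:R + 1 :> R by rewrite natr1 ler_nat leqSpred.
lra.
Qed.

(** With S = ln(nW) >= 1/2, which absorbs additive ones, and X = n^(1/k): the picks satisfy j <= 1 +
    tS <= 4XS and contribute 8 nXS; the scales satisfy J <= 10 kS and contribute at most 10 kS times
    4Xn. The sum is 48 k n X S, as 1 <= k. *)
Lemma size_bound (n k t j J c : nat) (W : R) : (1 < n)%N -> (0 < k)%N -> 1 <= W -> (1 < t)%N ->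
  t = 2 \/ (t.-1 ^ k < n)%N ->
  (c <= 2 * n * j + J * (2 * t * n))%N ->
  j = 0%N \/ (t ^ j.-1 <= n * t.-1 ^ j.-1)%N ->
  J = 0%N \/ (1 + (2 * k%:R)^-1) ^+ J.-1 <= 2 * (W * n%:R) ->
  c%:R <= 48 * (k%:R * n%:R `^ (1 + k%:R^-1) * ln (n%:R * W)).
Proof.
move=> n1 k0 W1 t1 ht hc hj hJ.
have [X1 tX ->] := root_bound n1 k0 ht; set X := _ `^ _ in X1 tX *.
have n2 : 2 <= n%:R :> R by rewrite ler_nat.
have np : 0 < n%:R :> R by apply: lt_le_trans n2.
have Wp : 0 < W by apply: lt_le_trans W1.
have nW2 : 2 <= n%:R * W by apply: le_trans n2 _; rewrite ler_peMr // ltW.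
set S := ln (n%:R * W).
have /andP[l2 _] := ln2_bounds.
have S1 : 1 <= 2 * S.
  have : ln (2 : R) <= S by rewrite ler_ln ?posrE ?mulr_gt0.
  lra.
have lnS : ln (n%:R : R) <= S.
  by rewrite ler_ln ?posrE ?mulr_gt0 // ler_peMr // ltW.
have S0 : 0 <= S by lra.
have k1 : 1 <= k%:R :> R by rewrite ler1n.
have tp : 0 <= t%:R :> R by [].
have jb : j%:R <= 1 + t%:R * S.
  case: hj => [->|h]; first by rewrite addr_ge0 // mulr_ge0.
  have h' := hits_bound (ltnW n1) t1 h.
  have : t%:R * ln (n%:R : R) <= t%:R * S by rewrite ler_wpM2l.
  have : j%:R <= 1 + j.-1%:R :> R by rewrite nat1r ler_nat leqSpred.
  lra.
have kS : 1 <= 2 * (k%:R * S).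
  by apply: le_trans S1 _; rewrite ler_pM2l // ler_peMl.
have Jb : J%:R <= 10 * (k%:R * S).
  case: hJ => [->|]; first by rewrite mulr0n; lra.
  rewrite [W * _]mulrC => /(scales_bound k0 nW2); rewrite -/S => h'.
  have : J%:R <= 1 + J.-1%:R :> R by rewrite nat1r ler_nat leqSpred.
  lra.
have XS : 1 <= 2 * (X * S) by apply: le_trans S1 _; rewrite ler_pM2l // ler_peMl.
apply: (@le_trans _ _ (2 * n%:R * j%:R + J%:R * (2 * t%:R * n%:R))).
  by rewrite -!natrM -natrD ler_nat.
have a1 : j%:R <= 4 * (X * S).
  have : t%:R * S <= 2 * X * S by rewrite ler_wpM2r.
  lra.
have a2 : 2 * n%:R * j%:R <= 2 * n%:R * (4 * (X * S)) by rewrite ler_wpM2l // ?mulr_ge0.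
have a3 : J%:R * (2 * t%:R * n%:R) <= 10 * (k%:R * S) * (2 * (2 * X) * n%:R).
  apply: ler_pM => //.
  by rewrite ler_wpM2r // ler_wpM2l.
have a4 : n%:R * X * S <= k%:R * (n%:R * X * S) by rewrite ler_peMl // !mulr_ge0 //; lra.
have -> : 48 * (k%:R * (n%:R * X) * S) = 8 * (k%:R * (n%:R * X * S)) + 40 * (k%:R * (n%:R * X * S)) by ring.
have : 2 * n%:R * (4 * (X * S)) = 8 * (n%:R * X * S) by ring.
have : 10 * (k%:R * S) * (2 * (2 * X) * n%:R) = 40 * (k%:R * (n%:R * X * S)) by ring.
lra.
Qed.

(** The constant is 100 * 100 from [core_time], times 12 from J + 1 <= 12 k ln(nW), times 8 from q +
    4 <= 8 (1 + ln n). The logarithm of the product nW is at most (1 + ln n)(1 + ln W), which yields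
    the second factor 1 + ln n. *)
Lemma time_bound (n m k q J T : nat) (W : R) : (1 < n)%N -> (0 < m)%N -> (0 < k)%N -> 1 <= W ->
  (2 ^ q <= 4 * n)%N -> J = 0%N \/ (1 + (2 * k%:R)^-1) ^+ J.-1 <= 2 * (W * n%:R) ->
  (T <= core_time n m q J)%N ->
  T%:R <= 960 * 1000 * (k%:R * m%:R * n%:R * (1 + ln W) * (1 + ln n%:R) ^+ 2).
Proof.
move=> n1 m0 k0 W1 hq hJ hT.
have n2 : 2 <= n%:R :> R by rewrite ler_nat.
have np : 0 < n%:R :> R by apply: lt_le_trans n2.
have Wp : 0 < W by apply: lt_le_trans W1.
have nW2 : 2 <= n%:R * W by apply: le_trans n2 _; rewrite ler_peMr // ltW.
have /andP[l2 l2'] := ln2_bounds.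
have k1 : 1 <= k%:R :> R by rewrite ler1n.
have S2 : ln (n%:R * W) = ln n%:R + ln W by rewrite lnM ?posrE.
have W0 : 0 <= ln W by apply: ln_ge0.
have n0 : 0 <= ln (n%:R : R) by apply: ln_ge0; rewrite ler1n ltnW.
set S := ln (n%:R * W) in S2.
have S1 : 1 <= 2 * S.
  have : ln (2 : R) <= S by rewrite ler_ln ?posrE ?mulr_gt0.
  lra.
have S0 : 0 <= S by lra.
have kS : 1 <= 2 * (k%:R * S).
  by apply: le_trans S1 _; rewrite ler_pM2l // ler_peMl.
have Jb : J.+1%:R <= 12 * (k%:R * S).
  rewrite -natr1; case: hJ => [->|]; first by rewrite mulr0n; lra.
  rewrite [W * _]mulrC => /(scales_bound k0 nW2); rewrite -/S => h'.
  have : J%:R <= 1 + J.-1%:R :> R by rewrite nat1r ler_nat leqSpred.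
  lra.
have qb : (q + 4)%:R <= 8 * (1 + ln (n%:R : R)).
  have : (2 ^+ q : R) <= 2 ^+ 2 * n%:R by rewrite -!natrX -natrM ler_nat.
  rewrite -ler_ln ?posrE ?mulr_gt0 ?exprn_gt0 // lnM ?posrE ?exprn_gt0 // !lnXn // => h.
  have : (2^-1 : R) *+ q <= ln 2 *+ q by apply: ler_wMn2r.
  have -> : (2^-1 : R) *+ q = q%:R / 2 by rewrite -[LHS]mulr_natl.
  by rewrite natrD; move: h; rewrite [ln 2 *+ 2]mulr2n; lra.
set D1 := 1 + ln n%:R in qb *; set D2 := 1 + ln W.
have SD : S <= D1 * D2.
  have : 0 <= ln (n%:R : R) * ln W by rewrite mulr_ge0.
  by rewrite S2 /D1 /D2; move: (ln _) (ln _) n0 W0 => a b; nra.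
have D10 : 0 <= D1 by rewrite /D1; lra.
apply: (@le_trans _ _ ((100 * 100)%:R * J.+1%:R * (q + 4)%:R * (n * m)%:R)).
  by rewrite -!natrM ler_nat.
rewrite [(100 * 100)%:R]natrM.
have a1 : 100 * 100 * J.+1%:R <= 100 * 100 * (12 * (k%:R * (D1 * D2))) :> R.
  rewrite -!mulrA !ler_pM2l //; apply: le_trans Jb _.
  by rewrite ler_pM2l // ler_wpM2l.
have a2 : 100 * 100 * J.+1%:R * (q + 4)%:R <= 100 * 100 * (12 * (k%:R * (D1 * D2))) * (8 * D1) :> R.
  by apply: ler_pM => //; rewrite mulr_ge0.
have a3 : 100 * 100 * J.+1%:R * (q + 4)%:R * (n * m)%:R <=
    100 * 100 * (12 * (k%:R * (D1 * D2))) * (8 * D1) * (n * m)%:R :> R by rewrite ler_wpM2r.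
apply: le_trans a3 _; rewrite natrM le_eqVlt; apply/orP; left; apply/eqP.
by ring.
Qed.

End Bounds.

(** * The final program and its guarantees *)

Definition spanner_program :=
  If (BAnd (BLeW (K 1) (V v_m)) (BLeW (K 2) (V v_n))) spanner_core Skip.

Lemma num_words_ge n m k : ((n + m + k + 2) ^ 3 <= num_words 3 n m k)%N.
Proof. by rewrite /num_words mulnC expnM leq_exp2r // up_logP. Qed.

Theorem theorem1 (R : realType) :
  exists (P : cmd) (a b : nat) (C : R),
  forall (n : nat) (E : {set 'I_n * 'I_n}) (w : 'I_n * 'I_n -> R) (W : R)
         (k : nat) (es : seq ('I_n * 'I_n)),
    1 <= W ->
    (forall e, e \in E -> 1 <= w e <= W) ->
    (1 <= k)%N ->
    uniq es -> es =i E ->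
    let m := #|E| in
    exists (H : {set 'I_n * 'I_n}) (T : nat) (s : state R),
      [/\ roundtrip_spanner (2 * k%:R - 1) E w H,
          #|H|%:R <= C * (k%:R * n%:R `^ (1 + k%:R^-1) * ln (n%:R * W)),
          exec (num_words a n m k) P (input es w k) T s,
          output es s = H &
          T%:R <= C * (1 + k%:R * m%:R * n%:R * (1 + ln W) * (1 + ln n%:R) ^+ b)].
Proof.
(* One constant for both bounds: 48 comes from [size_bound], 960 * 1000 from [time_bound]. *)
have [C [C1 C2]] : exists C : R, 48 <= C /\ 960 * 1000 <= C by exists (960 * 1000); lra.
have C0 : 0 <= C by apply: le_trans C1.
exists spanner_program, 3%N, 2%N, C.
move=> n E w W k es W1 wE k0 ues esE m.
have mE : m = size es by rewrite /m -(card_uniqP ues); apply: eq_card => e; rewrite esE.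
set B := num_words 3 n m k.
have hB : ((n + m + k + 2) ^ 3 <= B)%N by apply: num_words_ge.
have B8 : (8 <= B)%N by apply: leq_trans hB; rewrite -[8%N]/(2 ^ 3)%N leq_exp2r // leq_addl.
have mod1 : (1 %% B = 1)%N by rewrite modn_small //; clear -B8; lia.
have mod2 : (2 %% B = 2)%N by rewrite modn_small //; clear -B8; lia.
have w0 e : e \in E -> 0 <= w e by move=> /wE /andP[h _]; apply: le_trans h.
have outE s : output es s \subset E.
  by apply/fintype.subsetP => e; rewrite inE esE => /andP[].
have k1 : 1 <= k%:R :> R by rewrite ler1n.
have t0 : 0 < 2 * k%:R - 1 :> R by lra.
have lnW0 : 0 <= ln W by apply: ln_ge0.
have lnnW : (0 < n)%N -> 0 <= ln (n%:R * W).
  move=> h; have W0 : 0 <= W by apply: le_trans W1.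
  by apply: ln_ge0; apply: le_trans W1 _; rewrite ler_peMl ?ler1n.
(* Without edges or with at most one vertex the program stops at once with empty output. Vertices
   joined in both directions then coincide, and the summand 1 in the time bound pays for the 9
   steps. *)
have [/andP[m1 n2]|skip] := boolP ((0 < m) && (1 < n))%N; last first.
  exists (output es (input es w k)), 9%N, (input es w k).
  have out0 : output es (input es w k) = finset.set0.
    by apply/finset.setP => e; rewrite !inE /= !nth_nil andbF.
  have lnn : 0 <= ln (n%:R : R).
    by case: (n) => [|n']; [rewrite ln0|apply: ln_ge0; rewrite ler1n].
  split=> //.
  - apply: spanner_of_paths => // u v p p' [pE lp] [p'E lp'].
    have uv : u = v.
      move: skip; rewrite negb_and -leqNgt leqn0 -leqNgt => /orP[/eqP m0|n1].
        move: m0; rewrite /m => /eqP; rewrite cards_eq0 => /eqP E0.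
        by case: p pE lp => //= x p; rewrite E0 inE.
      by apply: val_inj => /=; have := ltn_ord u; have := ltn_ord v; clear -n1; lia.
    subst v; exists [::], [::]; split=> //.
    rewrite /path_length !big_nil addr0 mulr_ge0 ?(ltW t0) // addr_ge0 //.
      exact: path_length_ge0 pE.
    exact: path_length_ge0 p'E.
  - rewrite out0 cards0; apply: mulr_ge0 => //; rewrite !mulr_ge0 ?powR_ge0 //.
    have [n0|n0] := leqP n 0; first by move: n0; rewrite leqn0 => /eqP ->; rewrite mul0r ln0.
    exact: lnnW.
  - apply: ExIfFalse; last exact: ExSkip.
    by rewrite /= mod1 mod2 -mE.
  - apply: (@le_trans _ _ (C * 1)); first by rewrite mulr1 (le_trans _ C1) // ler_nat.
    by rewrite ler_wpM2l // lerDl !mulr_ge0 ?exprn_ge0 // addr_ge0.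
have n0 : (0 < n)%N by apply: ltnW.
pose d : 'I_n * 'I_n := (Ordinal n0, Ordinal n0).
have edge e : (e < m)%N -> [/\ (tail_of es e < n)%N, (head_of es e < n)%N & 1 <= weight_of w es e <= W].
  rewrite mE => em; have [-> -> ->] := nth_edge w d em.
  by split; [exact: ltn_ord|exact: ltn_ord|apply: wE; rewrite -esE mem_nth].
have inp : input_ok n m k (tail_of es) (head_of es) (weight_of w es) (input es w k).
  split=> // a i.
  by case: a => [|[|a]] //= _; rewrite !nth_nil.
have [s [T [ex [q [t [j [J [hq [t1 ht] hgood [hc hj hJ] hT]]]]]]]] :=
  core_run n2 m1 k0 (fun e em => let: And3 a _ _ := edge e em in a)
    (fun e em => let: And3 _ a _ := edge e em in a) W1
    (fun e em => let: And3 _ _ a := edge e em in a) hB inp erefl.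
exists (output es s), (7 + T).+1, s; split=> //.
- apply: spanner_of_paths => // u v p p' [pE lp] [p'E lp'].
  have w1 := path_walk w esE pE; have w2 := path_walk w esE p'E.
  rewrite lp in w1; rewrite lp' in w2; rewrite -mE in w1 w2.
  have [d' [d1 [d2 [h1 h2 e12]]] hd'] := hgood _ _ _ (ltn_ord u) (ltn_ord v)
    (ex_intro _ _ (ex_intro _ _ (And3 w1 w2 erefl))).
  rewrite e12 in hd'; rewrite mE in h1 h2.
  have [r [r1 r2 r3]] := walk_path ues h1 erefl.
  have [r' [r1' r2' r3']] := walk_path ues h2 erefl.
  exists r, r'; rewrite r3 r3'; split=> //; split=> //; exact: val_inj.
- have := size_bound n2 k0 W1 t1 ht hc hj hJ; rewrite (card_output ues) mE => h.
  apply: le_trans h _; rewrite ler_wpM2r //.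
  by rewrite !mulr_ge0 ?powR_ge0 // lnnW.
- apply: ExIfTrue ex.
  by rewrite /= mod1 mod2 -mE m1.
- have := time_bound n2 m1 k0 W1 hq hJ hT.
  have lnn : 0 <= ln (n%:R : R) by apply: ln_ge0; rewrite ler1n.
  set Y := k%:R * m%:R * n%:R * (1 + ln W) * (1 + ln n%:R) ^+ 2.
  have Y0 : 0 <= Y by rewrite !mulr_ge0 ?exprn_ge0 // addr_ge0.
  have -> : (7 + T).+1%:R = T%:R + 8 :> R by rewrite -natr1 natrD; ring.
  have : 960 * 1000 * Y <= C * Y by rewrite ler_wpM2r.
  rewrite mulrDr mulr1; move: (960 * 1000 * Y) => z; lra.
Qed.
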